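(* Let $d\ge1$, $1\leq p<\infty$, $\kappa>0$, $r\geq1$ an integer, $s<r$, $\gamma\in(-\infty,d]$ and $\beta=2^{\gamma-d}$. Let $f$ be a $B^s_{pp}$-random variable with wavelet density $\beta$, as defined in the context. If $\gamma\in(-\infty,0]$, then $f\in C^r$ almost surely. If $\gamma\in(0,d]$, then $\mathrm{singsupp}_r(f)$ is an empty set with probability $P_\beta$, where $P_\beta$ is the solution in $[0,1)$ of $$P_\beta=\big((1-\beta)+\beta P_\beta\big)^{2^d},$$ and $\dim_H(\mathrm{singsupp}_r(f))=\gamma$ (Hausdorff dimension) with probability $1-P_\beta$.
   Context: Wavelets. Let $D=[0,1]^d$ and $\mathcal{L}=\{1,\dots,2^d-1\}$. Let $\phi$ and $\Psi^\ell$, $\ell\in\mathcal{L}$, be compactly supported $C^r$ functions (father and mother wavelets) generating an $r$-regular orthonormal wavelet basis (multiresolution analysis) of $L^2(\mathbb{R}^d)$ (e.g. Daubechies wavelets of sufficiently high order), and put $\psi^\ell_{j,k}(x)=2^{jd/2}\Psi^\ell(2^jx-k)$ for $j\ge0$, $k\in\mathbb{Z}^d$, $\ell\in\mathcal{L}$, and $\phi_k(x)=\phi(x-k)$. As throughout the paper, the norm of the Besov space $B^t_{pp}(\mathbb{R}^d)$ is used through the equivalent wavelet expression: for $f=\sum_k f_{-1,k}\phi_k+\sum_{j\geq0,k,\ell}f^\ell_{j,k}\psi^\ell_{j,k}$, $$\|f\|_{B^t_{pp}}\simeq\Big(\sum_{j=-1}^\infty 2^{jp(t+\frac d2-\frac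 dp)}\|\mathbf{f}_j\|_{\ell^p}^p\Big)^{1/p},$$ where $\|\mathbf{f}_j\|_{\ell^p}^p=\sum_{k,\ell}|f^\ell_{j,k}|^p$ for $j\geq 0$ and $\|\mathbf{f}_{-1}\|_{\ell^p}^p=\sum_k|f_{-1,k}|^p$. Random tree $T$. Nodes are pairs $(j,k)$ with $j\in\{0,1,2,\dots\}$ and $k\in\mathbb{Z}^d$. Write $[k/2]=([k_1/2],\dots,[k_d/2])$, where $[\cdot]$ is the integer part (floor). Let $t_{j,k}$ be independent random variables uniformly distributed on $[0,1]$. The random tree $T$ is built recursively: the root node $(0,0)$ always belongs to $T$ and is its only node at level $0$; once all nodes of $T$ at level $j$ have been determined, $(j+1,l)\in T$ if and only if $(j,[l/2])\in T$ and $t_{j+1,l}<\beta$. Random function $f$. Let $X^\ell_{j,k}$ (over all $\ell,j,k$) be i.i.d. real random variables with probability density proportional to $\exp(-\frac{1}{2\kappa^p}|x|^p)$, independent of $T$. The $B^s_{pp}$-random variable with wavelet density $\beta$ is $$f=\sum_{(j,k)\in T,\ \ell\in\mathcal{L}}h_jX^\ell_{j,k}\psi^\ell_{j,k},\qquad h_j=2^{-j(s+\frac d2-\frac dp)},$$ the series being understood as a generalised function. Singular support. $\mathrm{singsupp}_r(f)$, the $C^r$-singular support of $f$, is the set of points $x\in D$ having no open neighbourhood on which $f$ is a $C^r$ function. *)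

(* Defs.v *)
From HB Require Import structures.
From mathcomp Require Import all_boot all_order all_algebra.
From mathcomp Require Import all_classical all_reals all_analysis.

Set Implicit Arguments.
Unset Strict Implicit.
Unset Printing Implicit Defensive.

Import Order.TTheory GRing.Theory Num.Theory.
Import numFieldNormedType.Exports.

Local Open Scope classical_set_scope.
Local Open Scope ring_scope.

(* R^d is 'rV[R]_d, with the product (equivalently, Borel) sigma-algebra. *)

Definition measure_row_display : measure_display -> measure_display.
Proof. exact. Qed.

Section measurable_row.
Context {d} {T : measurableType d} (n : nat).

Let coors (i : 'I_n) (v : 'rV[T]_n) : T := v ord0 i.

Let row_set0 : g_sigma_preimage coors set0.
Proof. exact: sigma_algebra0. Qed.

Let row_setC A : g_sigma_preimage coors A -> g_sigma_preimage coors (~` A).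
Proof. exact: sigma_algebraC. Qed.

Let row_bigcup (F : (set 'rV[T]_n)^nat) :
  (forall i, g_sigma_preimage coors (F i)) ->
  g_sigma_preimage coors (\bigcup_i (F i)).
Proof. exact: sigma_algebra_bigcup. Qed.

HB.instance Definition _ := @isMeasurable.Build (measure_row_display d)
  'rV[T]_n (g_sigma_preimage coors) row_set0 row_setC row_bigcup.

Lemma measurable_coord (i : 'I_n) :
  measurable_fun setT (fun v : 'rV[T]_n => v ord0 i).
Proof.
move=> _ A mA; rewrite setTI; apply: sub_sigma_algebra.
rewrite -bigcup_seq/=; exists i; first by rewrite /= mem_index_enum.
by exists A => //; rewrite setTI.
Qed.

Lemma measurable_to_row d1 (U : measurableType d1) (f : U -> 'rV[T]_n) :
  (forall i, measurable_fun setT (fun x => f x ord0 i)) ->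
  measurable_fun setT f.
Proof.
move=> mf; apply: measurability => //.
move=> _ [B + <-]; rewrite -bigcup_seq => -[i _ [A mA <-]].
by have := mf i measurableT A mA; rewrite !setTI.
Qed.

End measurable_row.

Section lebesgue_row.
Context (R : realType).

Definition consR n (x : measurableTypeR R * 'rV[R]_n) : 'rV[R]_n.+1 :=
  \row_i oapp (x.2 ord0) x.1 (unlift ord0 i).

Let unconsR n (v : 'rV[R]_n.+1) : measurableTypeR R * 'rV[R]_n :=
  (v ord0 ord0, \row_i v ord0 (lift ord0 i)).

Let consRK n : cancel (@consR n) (@unconsR n).
Proof.
move=> [a u]; rewrite /unconsR /consR mxE unlift_none/=; congr pair.
by apply/rowP => i; rewrite !mxE liftK.
Qed.

Lemma measurable_consR n : measurable_fun setT (@consR n).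
Proof.
apply: measurable_to_row => i; under eq_fun do rewrite mxE.
case: unliftP => [j _|_] /=; last exact: measurable_fst.
by apply: (@measurableT_comp _ _ _ _ _ _ (fun v : 'rV[R]_n => v ord0 j)) => //;
  exact: measurable_coord.
Qed.

HB.instance Definition _ n :=
  isMeasurableFun.Build _ _ _ _ (@consR n) (@measurable_consR n).

Let measurable_unconsR n : measurable_fun setT (@unconsR n).
Proof.
apply/measurable_fun_pair; first exact: measurable_coord.
apply: measurable_to_row => i; under eq_fun do rewrite mxE.
exact: measurable_coord.
Qed.

Section pushforward_consR.
Variables (n : nat) (m : {sigma_finite_measure set 'rV[R]_n -> \bar R}).

Definition lebesgue_consR : set 'rV[R]_n.+1 -> \bar R :=
  pushforward (lebesgue_measure \x m)%E (@consR n).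

Let lebesgue_consR0 : lebesgue_consR set0 = 0%E.
Proof. exact: measure0. Qed.

Let lebesgue_consR_ge0 A : (0 <= lebesgue_consR A)%E.
Proof. exact: measure_ge0. Qed.

Let lebesgue_consR_sigma_additive : semi_sigma_additive lebesgue_consR.
Proof. exact: measure_semi_sigma_additive. Qed.

HB.instance Definition _ := isMeasure.Build _ _ _ lebesgue_consR
  lebesgue_consR0 lebesgue_consR_ge0 lebesgue_consR_sigma_additive.

Let lebesgue_consR_sigma_finite : sigma_finite setT lebesgue_consR.
Proof.
have /sigma_finiteP[F [TF ndF Foo]] := sigma_finiteT (@lebesgue_measure R).
have /sigma_finiteP[G [TG ndG Goo]] := sigma_finiteT m.
exists (fun k => @unconsR n @^-1` (F k `*` G k)).
  rewrite predeqE => v; split=> // _.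
  have : setT (v ord0 ord0) by []; rewrite TF => -[i _ Fi].
  have : [set: 'rV[R]_n] (unconsR v).2 by []; rewrite TG => -[j _ Gj].
  exists (maxn i j) => //; split.
  - by move: Fi; exact/subsetPset/ndF/leq_maxl.
  - by move: Gj; exact/subsetPset/ndG/leq_maxr.
move=> k; have [mF Fk] := Foo k; have [mG Gk] := Goo k; split.
  by rewrite -[X in measurable X]setTI; apply: measurable_unconsR => //;
    exact: measurableX.
rewrite /lebesgue_consR /pushforward -comp_preimage.
rewrite (_ : _ \o _ = id) ?preimage_id; last exact/funext/consRK.
by rewrite product_measure1E// lte_mul_pinfty// ge0_fin_numE.
Qed.

HB.instance Definition _ := @Measure_isSigmaFinite.Build _ _ _ lebesgue_consR
  lebesgue_consR_sigma_finite.

End pushforward_consR.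

(* Lebesgue measure on R^n, as the n-fold product of the one on R;
   [lebesgue_row_box] below gives its value on boxes. *)
Fixpoint lebesgue_row n : {sigma_finite_measure set 'rV[R]_n -> \bar R} :=
  if n is n'.+1 then lebesgue_consR (lebesgue_row n')
  else \d_(0 : 'rV[R]_0).

Lemma lebesgue_row_box n (A : 'I_n -> set R) : (forall i, measurable (A i)) ->
  lebesgue_row n [set v | forall i, A i (v ord0 i)] =
  (\prod_(i < n) lebesgue_measure (A i))%E.
Proof.
elim: n A => [A _|n IHn A mA].
  rewrite big_ord0 /= diracE mem_set//; first by move=> [].
have mB : measurable [set v : 'rV[R]_n | forall i, A (lift ord0 i) (v ord0 i)].
  rewrite (_ : [set _ | _] = \bigcap_(i in [set: 'I_n])
      ((fun v : 'rV[R]_n => v ord0 i) @^-1` A (lift ord0 i))).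
    apply: fin_bigcap_measurable => // i _; rewrite -[X in measurable X]setTI.
    exact: measurable_coord.
  by apply/seteqP; split=> v /= H i; [move=> _|]; exact: H.
rewrite big_ord_recl -IHn// -product_measure1E// /= /lebesgue_consR /pushforward.
congr (_ _); apply/seteqP; split=> -[a u] /=.
  move=> H; split => [|i]; first by have := H ord0; rewrite mxE unlift_none.
  by have := H (lift ord0 i); rewrite mxE liftK.
by move=> [Aa Au] i; rewrite mxE; case: unliftP => [j ->|->]//=.
exact: mA.
Qed.

End lebesgue_row.

Section smooth_functions.
Context {R : realType} {d : nat}.
Implicit Types (U : set 'rV[R]_d) (f g phi : 'rV[R]_d -> R).

(* Iterated partial derivatives; the last index of [s] is derived first. *)
Definition pderiv (s : seq 'I_d) f : 'rV[R]_d -> R :=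
  foldr (fun i g x => 'D_(delta_mx ord0 i) g x) f s.

(* Meant for [U] open. *)
Definition Cr_on (r : nat) U f : Prop :=
  forall (s : seq 'I_d) (x : 'rV[R]_d), U x ->
    ((size s <= r)%N -> {for x, continuous (pderiv s f)}) /\
    ((size s < r)%N -> forall i, derivable (pderiv s f) x (delta_mx ord0 i)).

Definition fsupport f : set 'rV[R]_d := closure [set x | f x != 0].

Definition test_function U phi : Prop :=
  [/\ forall n, Cr_on n setT phi, compact (fsupport phi) & fsupport phi `<=` U].

(* A generalised function is given by a sequence [S] of functions, its value
   at [phi] being the limit of [\int S_J phi].  It coincides with [g] on [U] if
   this limit exists and is [\int g phi] for all test functions [phi] on [U]. *)
Definition gen_eq_on U (S : ('rV[R]_d -> R)^nat) g : Prop :=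
  forall phi, test_function U phi ->
    (\int[lebesgue_row R d]_x (S J x * phi x)) @[J --> \oo] -->
    (\int[lebesgue_row R d]_x (g x * phi x) : R).

Definition gen_Cr_on (r : nat) U (S : ('rV[R]_d -> R)^nat) : Prop :=
  exists g, Cr_on r U g /\ gen_eq_on U S g.

Definition unit_cube : set 'rV[R]_d := [set x | forall i, 0 <= x ord0 i <= 1].

Definition singsupp (r : nat) (S : ('rV[R]_d -> R)^nat) : set 'rV[R]_d :=
  [set x | unit_cube x /\ ~ exists U, [/\ open U, U x & gen_Cr_on r U S]].

End smooth_functions.

Section hausdorff_dimension.
Context {R : realType} {d : nat}.
Implicit Types A : set 'rV[R]_d.
Local Open Scope ereal_scope.

Definition euclidean_dist (x y : 'rV[R]_d) : R :=
  Num.sqrt (\sum_i (x ord0 i - y ord0 i) ^+ 2)%R.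

(* [-oo] on the empty set *)
Definition diam A : \bar R :=
  ereal_sup [set (euclidean_dist xy.1 xy.2)%:E | xy in A `*` A].

(* diam^a, with 0^0 = 1 for nonempty sets; the empty set has weight 0 even for
   a = 0. *)
Definition hausdorff_weight (a : R) A : \bar R :=
  if A == set0 then 0 else diam A `^ a.

Definition hausdorff_premeasure (a delta : R) A : \bar R :=
  ereal_inf [set \sum_(0 <= i <oo) hausdorff_weight a (F i) | F in
    [set F : (set 'rV[R]_d)^nat |
      A `<=` \bigcup_i F i /\ forall i, diam (F i) <= delta%:E]].

Definition hausdorff_measure (a : R) A : \bar R :=
  ereal_sup [set hausdorff_premeasure a delta A | delta in [set x | (0 < x)%R]].

Definition hausdorff_dim A : \bar R :=
  ereal_inf [set a%:E | a in [set a | (0 <= a)%R /\ hausdorff_measure a A = 0]].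

End hausdorff_dimension.

Section wavelets.
Context {R : realType} {d : nat}.
Local Notation leb := (lebesgue_row R d).
Implicit Types (f g : 'rV[R]_d -> R) (W : set ('rV[R]_d -> R)).

Definition realv (k : 'rV[int]_d) : 'rV[R]_d := map_mx intr k.

Definition L2 : set ('rV[R]_d -> R) := [set f | f \in Lfun leb 2%:E].

Definition L2norm f : \bar R := 'N[leb]_2%:E[EFin \o f].

Definition inner f g : R := \int[leb]_x (f x * g x).

(* Closed linear subspaces of L^2, as sets of functions; closedness implies
   stability under a.e. equality. *)
Definition closed_subspace W : Prop :=
  [/\ W `<=` L2, W (cst 0),
      forall (a : R) f g, W f -> W g -> W (fun x => a * f x + g x)
    & forall f, L2 f ->
        (forall e : R, 0 < e -> exists2 g, W g & (L2norm (f \- g)%R < e%:E)%E) -> W f].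

Definition orthonormal_basis (I : choiceType) (e : I -> 'rV[R]_d -> R) W : Prop :=
  [/\ forall i, W (e i),
      forall i j, inner (e i) (e j) = (i == j)%:R
    & forall f, W f -> forall eps : R, 0 < eps ->
        exists (s : seq I) (c : I -> R),
          (L2norm (fun x => f x - \sum_(i <- s) c i * e i x)%R < eps%:E)%E].

Record is_mra (V : int -> set ('rV[R]_d -> R)) : Prop := {
  mra_closed : forall j, closed_subspace (V j) ;
  mra_incr : forall j, V j `<=` V (j + 1) ;
  mra_cap : forall f, (forall j, V j f) -> f = cst 0 %[ae leb] ;
  mra_cup : forall f, L2 f -> forall e : R, 0 < e ->
    exists j, exists2 g, V j g & (L2norm (f \- g)%R < e%:E)%E ;
  mra_dilation : forall j f, V j f <-> V (j + 1) (fun x => f (2 *: x)) ;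
  mra_translation : forall k f, V 0 f <-> V 0 (fun x => f (x - realv k)) }.

Definition regular (r : nat) f : Prop :=
  forall (s : seq 'I_d), (size s <= r)%N -> forall m : nat,
    exists C : R, forall x, `|pderiv s f x| <= C / (1 + `|x|) ^+ m.

(* [phi] and the [Psi l] are the father and mother wavelets of an r-regular
   orthonormal wavelet basis: the integer translates of [phi] form an
   orthonormal basis of V_0, those of the [Psi l] an orthonormal basis of the
   orthogonal complement of V_0 in V_1. *)
Definition is_wavelet_basis (r : nat) (phi : 'rV[R]_d -> R)
    (Psi : 'I_(2 ^ d).-1 -> 'rV[R]_d -> R) : Prop :=
  [/\ [/\ Cr_on r setT phi, compact (fsupport phi) & regular r phi],
      forall l, [/\ Cr_on r setT (Psi l), compact (fsupport (Psi l))
                  & regular r (Psi l)]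
    & exists V : int -> set ('rV[R]_d -> R),
      [/\ is_mra V,
          orthonormal_basis (fun k x => phi (x - realv k)) (V 0)
        & orthonormal_basis
            (fun (lk : 'I_(2 ^ d).-1 * 'rV[int]_d) x => Psi lk.1 (x - realv lk.2))
            [set f | V 1 f /\ forall g, V 0 g -> inner f g = 0]]].

Definition psi (Psi : 'I_(2 ^ d).-1 -> 'rV[R]_d -> R)
    (l : 'I_(2 ^ d).-1) (j : nat) (k : 'rV[int]_d) (x : 'rV[R]_d) : R :=
  2 `^ ((j * d)%:R / 2) * Psi l (2 ^+ j *: x - realv k).

End wavelets.

Definition node (d : nat) := (nat * 'rV[int]_d)%type.

(* [divz] by 2 is the floor of the half, also for negative integers. *)
Definition half_row {d : nat} (k : 'rV[int]_d) : 'rV[int]_d :=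
  map_mx (fun z => (z %/ 2)%Z) k.

Section random_tree_besov.
Context {R : realType} {d : nat} {disp : measure_display}
  {Omega : measurableType disp} {P : probability Omega R}.

Fixpoint in_tree (beta : R) (t : node d -> Omega -> R) (w : Omega)
    (j : nat) (k : 'rV[int]_d) : Prop :=
  if j is i.+1 then in_tree beta t w i (half_row k) /\ t (j, k) w < beta
  else k = 0.

Definition mutually_independent (I : choiceType) (Y : I -> {RV P >-> R}) : Prop :=
  forall (s : seq I) (B : I -> set R), uniq s -> (forall i, measurable (B i)) ->
    P (\big[setI/setT]_(i <- s) (Y i @^-1` B i)) =
    (\prod_(i <- s) P (Y i @^-1` B i))%E.

(* Independence of the family [Y] from the random set [T] of nodes: product rule
   on the pi-systems of finite intersections of the events {Y i \in B} and
   {(j, k) \in T}, which generate the sigma-algebras of [Y] and [T]. *)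
Definition independent_of_tree (I : choiceType) (Y : I -> {RV P >-> R})
    (T : Omega -> nat -> 'rV[int]_d -> Prop) : Prop :=
  forall (s : seq I) (B : I -> set R) (ns : seq (node d)),
    (forall i, measurable (B i)) ->
    let EY := \big[setI/setT]_(i <- s) (Y i @^-1` B i) in
    let ET := \big[setI/setT]_(n <- ns) [set w | T w n.1 n.2] in
    P (EY `&` ET) = (P EY * P ET)%E.

Definition uniform01 (Y : {RV P >-> R}) : Prop :=
  forall B : set R, measurable B -> P (Y @^-1` B) = uniform_prob (@ltr01 R) B.

Definition same_exp_power_law (kappa p : R) (I : Type) (Y : I -> {RV P >-> R}) :
    Prop :=
  exists c : R, forall i (B : set R), measurable B ->
    P (Y i @^-1` B) =
    (\int[lebesgue_measure]_(x in B)
       (c * expR (- (1 / (2 * kappa `^ p)) * `|x| `^ p))%:E)%E.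

(* The level-[J] partial sums of the random series (each level of the tree is
   finite), which determine the generalised function [f]. *)
Definition besov_series (Psi : 'I_(2 ^ d).-1 -> 'rV[R]_d -> R) (s p : R)
    (X : 'I_(2 ^ d).-1 * node d -> Omega -> R)
    (T : Omega -> nat -> 'rV[int]_d -> Prop) (w : Omega) :
    ('rV[R]_d -> R)^nat :=
  fun J x => \sum_(j < J) \sum_(k \in [set k | T w j k])
    \sum_(l < (2 ^ d).-1)
      2 `^ (- (j%:R * (s + d%:R / 2 - d%:R / p))) * X (l, (nat_of_ord j, k)) w *
      psi Psi l j k x.

(* Probability [q] for an event of the completed sigma-algebra. *)
Definition has_prob (E : set Omega) (q : R) : Prop :=
  exists B, [/\ measurable B, P B = q%:E
    & P.-negligible ((E `\` B) `|` (B `\` E))].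

End random_tree_besov.
Arguments has_prob {R disp Omega} P E q.

(* Main.v *)
Require Import Defs.
From HB Require Import structures.
From mathcomp Require Import all_boot all_order all_algebra.
From mathcomp Require Import all_classical all_reals all_analysis.
From mathcomp Require Import measurable_realfun ring lra zify.

Set Implicit Arguments.
Unset Strict Implicit.
Unset Printing Implicit Defensive.

Import Order.TTheory GRing.Theory Num.Theory.
Import numFieldNormedType.Exports.

Local Open Scope classical_set_scope.
Local Open Scope ring_scope.

(** The tree is a Galton-Watson tree of mean offspring [2 ^ d * beta = 2 `^ gamma],
    and the singular support is, up to null events, the set of limit points of
    the dyadic cubes along its infinite paths.

    The survival of a finite part of the tree is a multiaffine polynomial in
    the independent indicators of the open nodes. Its expectation is therefore its
    value at the constant [beta], where its recursion is the iteration of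
    [offspring]: [prob_infinite_tree]. For [gamma <= 0] the iterates tend to [0]
    and the tree is almost surely finite; then the series is a finite sum of C^r
    functions, [gen_Cr_on_finite]. For [0 < gamma] they tend to the positive fixed
    point, unique because [offspring e / e] decreases; its complement to [1] is
    [P_beta]. The singular support is empty when the tree is finite,
    [singsupp_finite].

    Wavelets live close to their cubes, so the singular support is
    covered by the cubes of the nodes of any level, [singsupp_sub_cubes]. Their
    expected number at the level [J] is [2 `^ (gamma * J)]; for [a > gamma] the sum
    of the [a]-th powers of their diameters is almost surely small at infinitely
    many levels, [small_levels], and the [a]-dimensional measure vanishes.

    At a node below which the tree is infinite, no neighbourhood of
    the cube carries a C^r function equal to the series, [alive_not_Cr]. The test
    functions are [r]-th differences of bumps at the scale of a node of a deep
    level: their integrals against a C^r function are small by summation by parts,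
    [Rintegral_Cr_fdiff], whereas the pairing with the random series contains the
    coefficient of that node times a larger factor, [pairing_coef_ge]. This
    coefficient has a bounded density and is independent of the tree and of the
    other terms, so the whole pairing is small with a small probability only,
    [small_ball]. Since the probability that it is small tends to [0] with the
    level, one node of each level suffices. Limit points of infinite paths are then
    almost surely singular, [limit_point_singular].

    For [b < gamma] the tree thinned with probability [2 `^ (- b)]
    beyond the level [N] is still supercritical, and on almost all the event that
    the tree is infinite it survives with positive probability for some [N],
    [infinite_surviving]. A covering of the limit points of total [b]-weight less
    than this probability would give a cutset of smaller weight than the
    probability of survival, while some infinite path avoids any such set of nodes,
    [exists_avoiding_path]. Hence the [b]-dimensional measure does not vanish,
    [hausdorff_measure_neq0]; in particular the singular support is not empty. *)

(** * The dyadic tree *)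

Section tree_combinatorics.
Context {d : nat}.
Implicit Types (k l : 'rV[int]_d) (b : {ffun 'I_d -> bool}).

Definition child k b : 'rV[int]_d := \row_i (k ord0 i * 2 + (b i)%:Z).

Lemma half_row_child k b : half_row (child k b) = k.
Proof.
apply/rowP => i; rewrite !mxE divzMDl// divz_small ?addr0//.
by case: (b i).
Qed.

Lemma child_inj k : injective (child k).
Proof.
move=> b c /rowP bc; apply/ffunP => i; have := bc i; rewrite !mxE.
by case: (b i); case: (c i) => //=; lia.
Qed.

Lemma child_half_row l : exists b, l = child (half_row l) b.
Proof.
exists [ffun i => (l ord0 i %% 2)%Z == 1]; apply/rowP => i; rewrite !mxE ffunE.
rewrite [LHS](divz_eq _ 2); congr (_ + _).
have := modz_ge0 (l ord0 i) (isT : 2%:Z != 0); have := ltz_pmod (l ord0 i) (isT : 0 < 2%:Z).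
by case: (_ %% _)%Z => [[|[|n]]|n].
Qed.

Definition ancestor n l : 'rV[int]_d := iter n half_row l.

Fixpoint descendants k n : seq 'rV[int]_d :=
  if n is m.+1 then
    [seq child l b | l <- descendants k m, b <- enum {: {ffun 'I_d -> bool}}]
  else [:: k].

Lemma mem_descendants k n l : (l \in descendants k n) = (ancestor n l == k).
Proof.
elim: n l => [|n IHn] l; first by rewrite inE.
have -> : ancestor n.+1 l = ancestor n (half_row l) by exact: iterSr.
rewrite -IHn; apply/allpairsP/idP.
  by move=> [[l' b] [/= l'k _ ->]]; rewrite half_row_child.
move=> hl; have [b lb] := child_half_row l.
by exists (half_row l, b); split=> //=; rewrite mem_enum.
Qed.

Lemma uniq_descendants k n : uniq (descendants k n).
Proof.
elim: n => //= n IHn; apply: allpairs_uniq => //; first exact: enum_uniq.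
move=> [l b] [l' b'] _ _ /= lb.
have ll' : l = l' by rewrite -(half_row_child l b) lb half_row_child.
by rewrite ll' in lb *; rewrite (child_inj lb).
Qed.

Lemma ancestorD m n l : ancestor (m + n) l = ancestor m (ancestor n l).
Proof. exact: iterD. Qed.

Definition below j k : set (node d) :=
  [set v | (j < v.1)%N /\ ancestor (v.1 - j) v.2 = k].

Lemma below_child j k b : below j.+1 (child k b) `<=` below j k.
Proof.
move=> [n l] [/= jn nl]; split=> /=; first exact: ltnW.
have -> : (n - j = 1 + (n - j.+1))%N by lia.
by rewrite ancestorD nl /ancestor/= half_row_child.
Qed.

Lemma child_below j k b : below j k (j.+1, child k b).
Proof. by split=> //=; rewrite subSnn /ancestor/= half_row_child. Qed.

Definition cone j k : set (node d) :=
  [set v | (j <= v.1)%N /\ ancestor (v.1 - j) v.2 = k].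

Lemma coneE j k : cone j k = [set (j, k)] `|` below j k.
Proof.
apply/seteqP; split=> -[n l] /=.
  move=> [/= jn nl]; have [nj|nj] := eqVneq j n; last first.
    by right; split=> //=; rewrite ltn_neqAle nj.
  by left; rewrite -nl nj subnn.
by move=> [[-> ->]|[/= jn nl]]; split=> //=; rewrite ?subnn// ltnW.
Qed.

Lemma disjoint_cone j k k' : k != k' -> [disjoint cone j k & cone j k'].
Proof.
move=> kk'; apply/disj_setPS => -[n l] [[/= _ nk] [/= _ nk']].
by move/eqP: kk'; rewrite -nk -nk'.
Qed.

End tree_combinatorics.

(** * Multiaffine polynomials *)

Section multiaffine.
Context {R : realType} {I : choiceType}.
Implicit Types (x : I -> R) (A B : set I) (h : (I -> R) -> R).

(** Polynomials of degree at most one in each variable [x i], [i \in A]; the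
    list of monomials lets their expectation be computed term by term. *)
Definition multiaffine A h := exists L : seq (R * seq I),
  [/\ forall cS, cS \in L -> uniq cS.2,
      forall cS, cS \in L -> forall i, i \in cS.2 -> A i
    & forall x, h x = \sum_(cS <- L) cS.1 * \prod_(i <- cS.2) x i].

Lemma eq_multiaffine A h g : h =1 g -> multiaffine A g -> multiaffine A h.
Proof. by move=> /funext ->. Qed.

Lemma multiaffine_cst A c : multiaffine A (fun=> c).
Proof.
exists [:: (c, [::])]; split=> [cS|cS|x]; rewrite ?big_seq1/= ?big_nil ?mulr1//;
  by rewrite inE => /eqP ->.
Qed.

Lemma multiaffine_var A i : A i -> multiaffine A (fun x => x i).
Proof.
move=> Ai; exists [:: (1, [:: i])].
split=> [cS|cS|x]; rewrite ?big_seq1/= ?big_seq1 ?mul1r//;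
  by rewrite inE => /eqP -> // j; rewrite inE => /eqP ->.
Qed.

Lemma multiaffineD A h g : multiaffine A h -> multiaffine A g ->
  multiaffine A (fun x => h x + g x).
Proof.
move=> [L [uL AL hL]] [M [uM AM gM]]; exists (L ++ M).
split=> [cS|cS|x]; rewrite ?mem_cat ?big_cat/= ?hL ?gM//.
- by move=> /orP[]; [exact: uL|exact: uM].
- by move=> /orP[]; [exact: AL|exact: AM].
Qed.

(** Disjointness keeps the degree in each variable at most one. *)
Lemma multiaffineM A B h g : [disjoint A & B] -> multiaffine A h ->
  multiaffine B g -> multiaffine (A `|` B) (fun x => h x * g x).
Proof.
move=> /disj_setPS AB [L [uL AL hL]] [M [uM AM gM]].
exists [seq (p.1 * q.1, p.2 ++ q.2) | p <- L, q <- M]; split.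
- move=> _ /allpairsP[[p q] [/= pL qM ->]] /=.
  rewrite cat_uniq uL// uM// andbT/=; apply/hasPn => i iq; apply/negP => ip.
  by apply: (AB i); split; [exact: AL ip|exact: AM iq].
- move=> _ /allpairsP[[p q] [/= pL qM ->]] i /=.
  by rewrite mem_cat => /orP[ip|iq]; [left; exact: AL ip|right; exact: AM iq].
- move=> x; rewrite hL gM big_allpairs_dep/= big_distrl/=; apply: eq_bigr => p _.
  rewrite big_distrr/=; apply: eq_bigr => q _.
  by rewrite big_cat/= mulrACA.
Qed.

Lemma sub_multiaffine A B h : A `<=` B -> multiaffine A h -> multiaffine B h.
Proof.
by move=> AB [L [uL AL hL]]; exists L; split=> // cS cSL i iS; exact/AB/(AL cS).
Qed.

Lemma multiaffineZ A c h : multiaffine A h -> multiaffine A (fun x => c * h x).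
Proof.
move=> hA; rewrite -[A]set0U; apply: multiaffineM => //.
  by apply/disj_setPS => i [].
exact: multiaffine_cst.
Qed.

Lemma multiaffine_prod (J : eqType) (s : seq J) (A : J -> set I)
    (h : J -> (I -> R) -> R) : uniq s ->
  (forall j j', j != j' -> [disjoint A j & A j']) ->
  (forall j, multiaffine (A j) (h j)) ->
  multiaffine (\bigcup_(j in [set` s]) A j) (fun x => \prod_(j <- s) h j x).
Proof.
move=> us AA hA; elim: s us => [_|j s IHs /= /andP[js us]].
  by apply: eq_multiaffine (multiaffine_cst _ 1) => x; rewrite big_nil.
apply: (eq_multiaffine (g := fun x => h j x * \prod_(j <- s) h j x)) => [x|].
  by rewrite big_cons.
apply: (@sub_multiaffine (A j `|` \bigcup_(j' in [set` s]) A j')).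
  move=> i [Aji|[j' /= j's Aj'i]]; first by exists j => //=; rewrite mem_head.
  by exists j' => //=; rewrite in_cons j's orbT.
apply: multiaffineM => //; last exact: IHs.
apply/disj_setPS => i [Aji [j' /= j's Aj'i]].
have /AA/disj_setPS/(_ i) : j != j' by apply: contra js => /eqP ->.
exact.
Qed.

End multiaffine.

(** * Survival in a thinned tree *)

Section branching_functionals.
Context {R : realType} {d : nat}.
Implicit Types (x : node d -> R) (lam : nat -> R) (k l : 'rV[int]_d).
Local Notation bits := {ffun 'I_d -> bool}.

(** When [x] is the indicator of the open nodes, this is the probability that
    [(j, k)] has descendants [n] levels below if each open node at level [i.+1]
    is kept with probability [lam i], independently. *)
Fixpoint survival lam x n j k : R :=
  if n is m.+1 then
    1 - \prod_(b : bits) (1 - lam j * (x (j.+1, child k b) *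
                                        survival lam x m j.+1 (child k b)))
  else 1.

Lemma multiaffine_child (h : (node d -> R) -> R) j k (b : bits) :
  multiaffine (below j.+1 (child k b)) h ->
  multiaffine (cone j.+1 (child k b)) (fun x => x (j.+1, child k b) * h x).
Proof.
move=> hA; rewrite coneE; apply: multiaffineM => //; last exact: multiaffine_var.
by apply/disj_setPS => v [-> [/=]]; rewrite ltnn.
Qed.

Lemma cone_below j k (b : bits) : cone j.+1 (child k b) `<=` below j k.
Proof.
by rewrite coneE => v [->|/below_child//]; exact: child_below.
Qed.

(** The subtrees of the children have disjoint sets of nodes. *)
Lemma multiaffine_survival lam n j k :
  multiaffine (below j k) (fun x => survival lam x n j k).
Proof.
elim: n j k => [|n IHn] j k /=; first exact: multiaffine_cst.
apply: multiaffineD; first exact: multiaffine_cst.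
apply: eq_multiaffine (fun x => esym (mulN1r _)) _; apply: multiaffineZ.
apply: sub_multiaffine (multiaffine_prod (A := fun b => cone j.+1 (child k b)) _ _ _).
- by move=> v [b _ /cone_below].
- by rewrite /index_enum; case: index_enum_key; rewrite -enumT enum_uniq.
- by move=> b c bc; apply: disjoint_cone; apply: contra bc => /eqP/child_inj ->.
move=> b; apply: multiaffineD; first exact: multiaffine_cst.
apply: eq_multiaffine (fun x => esym (mulNr _ _)) _; apply: multiaffineZ.
exact: multiaffine_child.
Qed.

End branching_functionals.

Section survival_facts.
Context {R : realType} {d : nat}.
Implicit Types (x : node d -> R) (lam : nat -> R) (k l : 'rV[int]_d).
Local Notation bits := {ffun 'I_d -> bool}.

Lemma prod01 (J : Type) (s : seq J) (a : J -> R) :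
  (forall j, 0 <= a j <= 1) -> 0 <= \prod_(j <- s) a j <= 1.
Proof.
move=> a01; rewrite prodr_ile1// andbT; apply: prodr_ge0 => j _.
by have /andP[] := a01 j.
Qed.

Lemma one_sub_prod_le (J : Type) (s : seq J) (a : J -> R) :
  (forall j, 0 <= a j <= 1) ->
  1 - \prod_(j <- s) (1 - a j) <= \sum_(j <- s) a j.
Proof.
move=> a01; elim: s => [|j s IHs]; first by rewrite !big_nil subrr.
rewrite !big_cons; have /andP[aj0 aj1] := a01 j.
have : 0 <= \prod_(j <- s) (1 - a j) <= 1.
  by apply: prod01 => i; have /andP[] := a01 i; lra.
move: IHs; set p := \prod_(j <- s) _; set q := \sum_(j <- s) _ => pq p01.
nra.
Qed.

Section bounds.
Variables (x : node d -> R) (lam : nat -> R).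
Hypotheses (x01 : forall v, 0 <= x v <= 1) (lam01 : forall i, 0 <= lam i <= 1).

Lemma survival01 n j k : 0 <= survival lam x n j k <= 1.
Proof.
elim: n j k => [|n IHn] j k /=; first by rewrite lexx ler01.
have : 0 <= \prod_(b : bits) (1 - lam j * (x (j.+1, child k b) *
    survival lam x n j.+1 (child k b))) <= 1.
  apply: prod01 => b.
  have := IHn j.+1 (child k b); have := x01 (j.+1, child k b); have := lam01 j.
  move: (lam j) (x _) (survival _ _ _ _ _) => a y u a01 y01 u01.
  have : 0 <= y * u <= 1 by nra.
  by nra.
lra.
Qed.

Lemma survival_weight01 n j k l : 0 <= lam j * (x (j.+1, l) * survival lam x n j.+1 k) <= 1.
Proof.
have := survival01 n j.+1 k; have := x01 (j.+1, l); have := lam01 j.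
move: (lam j) (x _) (survival _ _ _ _ _) => a y u a01 y01 u01.
have : 0 <= y * u <= 1 by nra.
by nra.
Qed.

Lemma survival_decr j k : nonincreasing_seq (fun n => survival lam x n j k).
Proof.
apply/nonincreasing_seqP => n; elim: n j k => [|n IHn] j k.
  by have /andP[] := survival01 1 j k.
rewrite [leRHS]/= lerD2l lerN2; apply: ler_prod => b _.
have /andP[h0 h1] := survival_weight01 n j (child k b) (child k b).
rewrite subr_ge0 h1/= lerD2l lerN2.
have /andP[l0 _] := lam01 j; have /andP[x0 _] := x01 (j.+1, child k b).
by do 2! (apply: ler_wpM2l => //); exact: IHn.
Qed.

Definition ult_survival j k := limn (fun n => survival lam x n j k).

Lemma cvg_survival j k : survival lam x n j k @[n --> \oo] --> ult_survival j k.
Proof.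
apply: nonincreasing_is_cvgn; first exact: survival_decr.
by exists 0 => _ [n _ <-]; have /andP[] := survival01 n j k.
Qed.

Lemma ult_survival_le n j k : ult_survival j k <= survival lam x n j k.
Proof.
apply: nonincreasing_cvgn_ge; first exact: survival_decr.
by apply: cvgP; exact: cvg_survival.
Qed.

Lemma ult_survival01 j k : 0 <= ult_survival j k <= 1.
Proof.
rewrite (le_trans (ult_survival_le 0 j k))// andbT.
apply: limr_ge; first by apply: cvgP; exact: cvg_survival.
by apply: nearW => n; have /andP[] := survival01 n j k.
Qed.

(** The union bound over the children. *)
Lemma ult_survival_subadd j k : ult_survival j k <=
  \sum_(b : bits) lam j * (x (j.+1, child k b) * ult_survival j.+1 (child k b)).
Proof.
have h1 : survival lam x n.+1 j k @[n --> \oo] --> ult_survival j k.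
  by have := @cvg_survival j k; rewrite -cvg_shiftS; exact.
apply: (ler_cvg_to h1) => [|].
  apply: cvg_big => [|b _]; first exact: add_continuous.
  by do 2! (apply: cvgM; first exact: cvg_cst); exact: cvg_survival.
by apply: nearW => n; apply: one_sub_prod_le => b; exact: survival_weight01.
Qed.

End bounds.

(** * Cutsets and paths *)

Section avoiding_path.
Variables (x : node d -> R) (lam : nat -> R).
Hypotheses (x01 : forall v, x v = 0 \/ x v = 1)
  (lam01 : forall i, 0 <= lam i <= 1).
Variables (K : finType) (w : nat -> K -> node d).

Let x01' v : 0 <= x v <= 1.
Proof. by case: (x01 v) => ->; rewrite ?lexx ler01. Qed.

Let Lam j := \prod_(i < j) lam i.

Let Lam_ge0 j : 0 <= Lam j.
Proof. by apply: prodr_ge0 => i _; have /andP[] := lam01 i. Qed.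

Let weight i j k : R := \sum_(m : K) Lam (w i m).1 * `[< cone j k (w i m) >]%:R.

Let weight_ge0 i j k : 0 <= weight i j k.
Proof. by apply: sumr_ge0 => m _; rewrite mulr_ge0. Qed.

Let cost j k : \bar R := (\sum_(0 <= i <oo) (weight i j k)%:E)%E.

Let cost_ge0 j k : (0 <= cost j k)%E.
Proof. by apply: nneseries_ge0 => i _ _; rewrite lee_fin. Qed.

Let cost_children j k : (\sum_(b : bits) cost j.+1 (child k b) <= cost j k)%E.
Proof.
rewrite -nneseries_sum => [|b i _]; last by rewrite lee_fin.
apply: lee_nneseries => [i _ _|i _].
  by apply: sume_ge0 => b _; rewrite lee_fin.
rewrite sumEFin lee_fin exchange_big/=; apply: ler_sum => m _.
rewrite -mulr_sumr; apply: ler_wpM2l => //.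
have [[b wb]|nw] := pselect (exists b, cone j.+1 (child k b) (w i m)); last first.
  rewrite big1// => b _; case: asboolP => // wb.
  by exfalso; apply: nw; exists b.
rewrite (bigD1 b)//= big1 => [|c cb].
  by rewrite addr0 ler_nat (asboolT wb) asboolT// coneE; right; exact: cone_below wb.
case: asboolP => // wc.
have /disj_setPS/(_ (w i m)) : [disjoint cone j.+1 (child k b) & cone j.+1 (child k c)].
  by apply: disjoint_cone; apply: contra cb => /eqP/child_inj ->.
by move=> /(_ (conj wb wc)).
Qed.

Let good (v : node d) := (cost v.1 v.2 < (Lam v.1 * ult_survival x lam v.1 v.2)%:E)%E.

Let good_child j k : good (j, k) ->
  exists b, x (j.+1, child k b) = 1 /\ good (j.+1, child k b).
Proof.
move=> gd; apply: contrapT => nb; move: gd; rewrite /good/=; apply/negP.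
rewrite -leNgt; apply: le_trans (cost_children j k).
have le_cost b : ((Lam j * (lam j * (x (j.+1, child k b) *
    ult_survival x lam j.+1 (child k b))))%:E <= cost j.+1 (child k b))%E.
  have [->|xb] := x01 (j.+1, child k b); first by rewrite mul0r !mulr0.
  rewrite xb mul1r mulrA.
  have -> : Lam j * lam j = Lam j.+1 by rewrite /Lam big_ord_recr.
  by rewrite leNgt; apply/negP => gb; apply: nb; exists b.
apply: (@le_trans _ _ (\sum_(b : bits) (Lam j * (lam j * (x (j.+1, child k b) *
    ult_survival x lam j.+1 (child k b))))%:E)%E); last exact: lee_sum.
by rewrite sumEFin lee_fin -mulr_sumr ler_wpM2l// ult_survival_subadd.
Qed.

(** A form of the max-flow min-cut principle: [ult_survival] is subadditive along
    the tree, so it bounds from below the weight of any cutset. If the nodes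
    [w i m] weigh less, some child of every node on the path still has survival
    larger than the weight below it, and the path never meets one of them. *)
Lemma exists_avoiding_path k0 :
  (\sum_(0 <= i <oo) (\sum_(m : K) \prod_(j < (w i m).1) lam j)%:E <
    (ult_survival x lam 0 k0)%:E)%E ->
  exists kap : nat -> 'rV[int]_d,
    [/\ kap 0%N = k0, forall j, half_row (kap j.+1) = kap j,
        forall j, x (j.+1, kap j.+1) = 1
      & forall i m, kap (w i m).1 <> (w i m).2].
Proof.
move=> lt_u.
have g0 : good (0%N, k0).
  rewrite /good/= /Lam big_ord0 mul1r; apply: le_lt_trans lt_u.
  apply: lee_nneseries => [i _ _|i _]; rewrite lee_fin//; apply: ler_sum => m _.
  by rewrite ler_piMr//; case: asboolP.
pose Good := {v : node d | good v}.
pose nxt (v v' : Good) := [/\ (sval v').1 = (sval v).1.+1,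
  half_row (sval v').2 = (sval v).2 & x (sval v') = 1].
have [v|f [f0 fn]] := @dependent_choice Good nxt _ (exist good (0%N, k0) g0).
  apply: cid; case: v => -[j k] g; have [b [xb gb]] := good_child g.
  by exists (exist good (j.+1, child k b) gb); split => //=; rewrite half_row_child.
have f1 j : (sval (f j)).1 = j.
  by elim: j => [|j IHj]; [rewrite f0|have [-> _ _] := fn j; rewrite IHj].
exists (fun j => (sval (f j)).2); split=> [|j|j|i m wim].
- by rewrite f0.
- by have [] := fn j.
- by have [_ _ <-] := fn j; rewrite -{1}(f1 j.+1) -surjective_pairing.
- have := svalP (f (w i m).1); rewrite /good f1 wim; apply/negP; rewrite -leNgt.
  apply: (@le_trans _ _ (Lam (w i m).1)%:E).
    by rewrite lee_fin ler_piMr//; have /andP[] := ult_survival01 x01' lam01 (w i m).1 (w i m).2.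
  apply: (@le_trans _ _ (weight i (w i m).1 (w i m).2)%:E).
    rewrite lee_fin /weight (bigD1 m)//= asboolT ?mulr1 ?lerDl ?sumr_ge0//.
    + by move=> m' _; rewrite mulr_ge0.
    + by split; rewrite ?subnn.
  apply: le_trans (nneseries_lim_ge i.+1 _); last by move=> *; rewrite lee_fin.
  by rewrite big_nat_recr//= leeDr// sume_ge0// => *; rewrite lee_fin.
Qed.

End avoiding_path.
End survival_facts.

(** * Iteration of the offspring function *)

Section offspring_iteration.
Context {R : realType}.
Variables (M : nat) (b : R).
Hypotheses (M2 : (2 <= M)%N) (b0 : 0 < b) (b1 : b <= 1).
Implicit Types e : R.

(** If a child is open and has property E with probability [b * e],
    independently of its siblings, then [offspring e] is the probability that
    some child is open and has property E. *)
Definition offspring e : R := 1 - (1 - b * e) ^+ M.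

Let base01 e : 0 <= e <= 1 -> 0 <= 1 - b * e <= 1.
Proof.
move=> /andP[e0 e1]; have : 0 <= b * e <= 1; last lra.
by apply/andP; split; [apply: mulr_ge0|apply: mulr_ile1] => //; exact: ltW.
Qed.

Let base_anti e e' n : 0 <= e -> e <= e' -> e' <= 1 ->
  (1 - b * e') ^+ n <= (1 - b * e) ^+ n.
Proof.
move=> ge0 le_e le1.
have /andP[? _] : 0 <= 1 - b * e <= 1 by apply: base01; lra.
have /andP[? _] : 0 <= 1 - b * e' <= 1 by apply: base01; lra.
by apply: lerXn2r; rewrite ?nnegrE// lerD2l lerN2 ler_wpM2l// ltW.
Qed.

Lemma offspring01 e : 0 <= e <= 1 -> 0 <= offspring e <= 1.
Proof.
move=> e01; have : 0 <= (1 - b * e) ^+ M <= 1.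
  by have /andP[h0 h1] := base01 e01; rewrite exprn_ge0 ?exprn_ile1.
by rewrite /offspring; lra.
Qed.

Lemma offspring_mono e e' : 0 <= e -> e <= e' -> e' <= 1 ->
  offspring e <= offspring e'.
Proof.
by move=> ge0 le_e le1; rewrite lerD2l lerN2; exact: base_anti.
Qed.

Lemma iter_offspring01 n e : 0 <= e <= 1 -> 0 <= iter n offspring e <= 1.
Proof. by move=> e01; elim: n => //= n; exact: offspring01. Qed.

Lemma iter_offspring_mono n e e' : 0 <= e -> e <= e' -> e' <= 1 ->
  iter n offspring e <= iter n offspring e'.
Proof.
move=> ge0 le_e le1; elim: n => //= n IHn.
apply: offspring_mono => //.
  by have /andP[] : 0 <= iter n offspring e <= 1 by apply: iter_offspring01; lra.
by have /andP[] : 0 <= iter n offspring e' <= 1 by apply: iter_offspring01; lra.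
Qed.

Lemma offspringE e : offspring e = e * (b * \sum_(i < M) (1 - b * e) ^+ i).
Proof. by rewrite /offspring -[LHS]opprB subrX1; ring. Qed.

Lemma offspring_le e : 0 <= e <= 1 -> offspring e <= M%:R * b * e.
Proof.
move=> e01; rewrite offspringE mulrC [M%:R * b]mulrC; apply: ler_wpM2r; first lra.
apply: ler_wpM2l; first exact: ltW.
rewrite -[leRHS](_ : \sum_(i < M) 1 = _); last by rewrite sumr_const card_ord.
by apply: ler_sum => i _; have /andP[? ?] := base01 e01; exact: exprn_ile1.
Qed.

(** By [offspringE], [offspring e / e] is strictly decreasing. *)
Lemma offspring_fixpoint_unique e e' : 0 < e <= 1 -> 0 < e' <= 1 ->
  offspring e = e -> offspring e' = e' -> e = e'.
Proof.
wlog : e e' / e <= e'.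
  move=> wlog_le e01 e'01 eF e'F; have [ee'|e'e] := leP e e'; first exact: wlog_le.
  by apply/esym; apply: wlog_le => //; exact: ltW.
rewrite le_eqVlt => /orP[/eqP//|ee'] /andP[e0 e1] /andP[e'0 e'1].
have cancel (z : R) : 0 < z -> offspring z = z ->
    b * (\sum_(i < M) (1 - b * z) ^+ i) = 1.
  move=> z0; rewrite offspringE => zF; apply: (mulfI (lt0r_neq0 z0)).
  by rewrite zF mulr1.
move=> /cancel-/(_ e0) S1 /cancel-/(_ e'0) S2; exfalso.
have : b * (\sum_(i < M) (1 - b * e') ^+ i) = b * (\sum_(i < M) (1 - b * e) ^+ i).
  by rewrite S1 S2.
move=> /(mulfI (lt0r_neq0 b0))/eqP; apply/negP; rewrite lt_eqF//.
case: M M2 => [|[|m]]// _; rewrite !big_ord_recl/=; apply: ler_ltD => //.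
apply: ltr_leD; first by rewrite /bump/= !expr1 ltrD2l ltrN2 ltr_pM2l.
by apply: ler_sum => i _; apply: base_anti => //; exact: ltW.
Qed.

Hypothesis Mb1 : 1 < M%:R * b.

Let delta : R := 1 - (M%:R * b)^-1.

Let Mb0 : 0 < M%:R * b. Proof. exact: lt_trans Mb1. Qed.

Let delta_gt0 : 0 < delta.
Proof. by rewrite subr_gt0 invf_lt1. Qed.

Let delta_le1 : delta <= 1.
Proof. by rewrite lerBlDr lerDl invr_ge0 ltW. Qed.

(** From Bernoulli's inequality, [(1 - y) ^+ M <= 1 / (1 + M y)]. *)
Lemma offspring_ge e : 0 <= e -> e <= 1 - (M%:R * b)^-1 -> e <= offspring e.
Proof.
move=> e0 ed; have e1 : e <= 1 by exact: le_trans ed delta_le1.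
have bern (y : R) : 0 <= y -> 1 + M%:R * y <= (1 + y) ^+ M.
  move=> y0; elim: (M) => [|m IHm]; first by rewrite mul0r expr0 addr0.
  have m0 : 0 <= m%:R :> R by [].
  rewrite exprS; apply: le_trans (ler_wpM2l _ IHm); last lra.
  by rewrite -natr1; have := mulr_ge0 m0 (mulr_ge0 y0 y0); lra.
have be1 : 0 <= b * e <= 1 by have : 0 <= 1 - b * e <= 1; [apply: base01; rewrite e0 e1|lra].
set y := (1 - b * e) ^+ M.
have y0 : 0 <= y by apply: exprn_ge0; lra.
have le1 : y * (1 + M%:R * b * e) <= 1.
  rewrite -mulrA; apply: (le_trans (ler_wpM2l y0 (bern (b * e) _))); first by lra.
  by rewrite -exprMn; apply: exprn_ile1; nra.
have ed' : M%:R * b * e <= M%:R * b - 1.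
  have := ler_wpM2l (ltW Mb0) ed; rewrite mulrBr mulr1 divff//; exact: lt0r_neq0.
rewrite /offspring -/y; move: Mb0 Mb1 le1 ed'.
set c := M%:R * b => c0 c1 le1 ed'.
(* [y (1 + c e) <= 1] and [c e <= c - 1] give [y <= 1 - e] *)
have : (1 - e - y) * (1 + c * e) >= 0.
  suff : (1 - e) * (1 + c * e) >= 1 by lra.
  by nra.
by rewrite pmulr_lge0 ?subr_ge0; nra.
Qed.

Lemma iter_offspring_cvg_fixpoint e l : 0 <= e <= 1 ->
  iter n offspring e @[n --> \oo] --> l -> offspring l = l.
Proof.
move=> e01 el; have h1 : iter n.+1 offspring e @[n --> \oo] --> l.
  by have := el; rewrite -cvg_shiftS; exact.
have h2 : offspring (iter n offspring e) @[n --> \oo] --> offspring l.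
  have cnt : continuous offspring.
    move=> z; rewrite /offspring; apply: cvgB; first exact: cvg_cst.
    apply: (@cvg_comp _ _ _ (fun z => 1 - b * z) (fun y => y ^+ M)).
      by apply: cvgB; [exact: cvg_cst|apply: cvgM; [exact: cvg_cst|exact: cvg_id]].
    exact: exprn_continuous.
  by apply: (cvg_comp _ _ el); exact: cnt.
exact: cvg_unique h2 h1.
Qed.

(** The iterates from [1] decrease and those from a small positive value
    increase, by [offspring_ge]; both limits are positive fixed points, hence
    equal. *)
Lemma iter_offspring_cvg : exists es : R, [/\ 0 < es <= 1, offspring es = es
  & forall e, 0 < e <= 1 -> iter n offspring e @[n --> \oo] --> es].
Proof.
have dl1 := delta_le1; have dl0 := delta_gt0.
have cvg1 : nonincreasing_seq (fun n => iter n offspring 1).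
  apply/nonincreasing_seqP => n; rewrite iterSr; apply: iter_offspring_mono => //.
  - by have /andP[] : 0 <= offspring 1 <= 1 by apply: offspring01; rewrite ler01 lexx.
  - by have /andP[] : 0 <= offspring 1 <= 1 by apply: offspring01; rewrite ler01 lexx.
have low n (d : R) : 0 <= d -> d <= delta -> d <= iter n offspring d.
  move=> d0 dd; elim: n => //= n IHn.
  have /andP[? ?] : 0 <= iter n offspring d <= 1 by apply: iter_offspring01; lra.
  by apply: le_trans (offspring_mono d0 IHn _) => //; exact: offspring_ge.
have /cvg_ex[/= es es1] : cvgn (fun n => iter n offspring 1).
  apply: nonincreasing_is_cvgn => //.
  by exists 0 => _ [n _ <-]; have /andP[] : 0 <= iter n offspring 1 <= 1
    by apply: iter_offspring01; lra.
have es01 (d l : R) : 0 < d -> d <= delta -> iter n offspring d @[n --> \oo] --> l ->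
    d <= l <= 1.
  move=> d0 dd dl; apply/andP; split.
    rewrite -(cvg_lim (@Rhausdorff R) dl); apply: limr_ge; first exact: cvgP dl.
    by apply: nearW => n; apply: low => //; exact: ltW.
  rewrite -(cvg_lim (@Rhausdorff R) dl); apply: limr_le; first exact: cvgP dl.
  by apply: nearW => n; have /andP[] : 0 <= iter n offspring d <= 1
    by apply: iter_offspring01; lra.
have esd : delta <= es <= 1.
  rewrite -(cvg_lim (@Rhausdorff R) es1); apply/andP; split.
    apply: limr_ge; first exact: cvgP es1.
    apply: nearW => n; apply: (le_trans (low n delta _ _)); [lra|lra|].
    by apply: iter_offspring_mono; lra.
  apply: limr_le; first exact: cvgP es1.
  by apply: nearW => n; have /andP[] : 0 <= iter n offspring 1 <= 1
    by apply: iter_offspring01; lra.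
have esF : offspring es = es by apply: iter_offspring_cvg_fixpoint es1; lra.
exists es; split => //; first by lra.
move=> e /andP[e0 e1].
pose d := Num.min e delta.
have d0 : 0 < d by rewrite lt_min e0.
have dd : d <= delta by rewrite ge_min lexx orbT.
have de : d <= e by rewrite ge_min lexx.
have /cvg_ex[/= l dl] : cvgn (fun n => iter n offspring d).
  apply: nondecreasing_is_cvgn.
    apply/nondecreasing_seqP => n; rewrite iterSr; apply: iter_offspring_mono.
    - exact: ltW.
    - by apply: offspring_ge => //; exact: ltW.
    - by have /andP[] : 0 <= offspring d <= 1 by apply: offspring01; lra.
  by exists 1 => _ [n _ <-]; have /andP[] : 0 <= iter n offspring d <= 1
    by apply: iter_offspring01; lra.
have lE : l = es.
  have := es01 _ _ d0 dd dl => ?.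
  apply: offspring_fixpoint_unique => //; [lra|lra|].
  by apply: iter_offspring_cvg_fixpoint dl; lra.
rewrite lE in dl; apply: squeeze_cvgr dl es1.
by apply: nearW => n; apply/andP; split; apply: iter_offspring_mono; lra.
Qed.

End offspring_iteration.

Section subcritical.
Context {R : realType}.
Variables (M : nat) (b : R).
Hypotheses (M2 : (2 <= M)%N) (b0 : 0 < b) (b1 : b <= 1) (Mb1 : M%:R * b <= 1).

(** A positive [l] is not a fixed point: [offspring l] is less than
    [M%:R * b * l], strictly as [2 <= M], and this is at most [l]. *)
Lemma iter_offspring_cvg0 : iter n (offspring M b) 1 @[n --> \oo] --> (0 : R).
Proof.
have i01 n : 0 <= iter n (offspring M b) 1 <= 1.
  by apply: iter_offspring01 => //; rewrite ler01 lexx.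
have /cvg_ex[/= l l1] : cvgn (fun n => iter n (offspring M b) 1).
  apply: nonincreasing_is_cvgn.
    apply/nonincreasing_seqP => n; have := i01 n => h.
    rewrite iterS; apply: (le_trans (offspring_le M b0 b1 h)).
    by rewrite ler_piMl//; have /andP[] := h.
  by exists 0 => _ [n _ <-]; have /andP[] := i01 n.
have l01 : 0 <= l <= 1.
  rewrite -(cvg_lim (@Rhausdorff R) l1); apply/andP; split.
    by apply: limr_ge; [exact: cvgP l1|apply: nearW => n; have /andP[] := i01 n].
  by apply: limr_le; [exact: cvgP l1|apply: nearW => n; have /andP[] := i01 n].
have lF : offspring M b l = l.
  by apply: iter_offspring_cvg_fixpoint l1; rewrite ler01 lexx.
have [->//|l0] := eqVneq 0 l; exfalso.
have {}l0 : 0 < l by rewrite lt_neqAle l0; have /andP[] := l01.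
suff : offspring M b l < l by rewrite lF ltxx.
rewrite offspringE gtr_pMr//; apply: lt_le_trans Mb1; rewrite mulrC ltr_pM2r//.
rewrite -[ltRHS](_ : \sum_(i < M) 1 = _); last by rewrite sumr_const card_ord.
case: M M2 => [|[|m]]// _; rewrite !big_ord_recl/= expr0; apply: ler_ltD => //.
have bl0 : 0 < b * l by exact: mulr_gt0.
have bl1 : b * l <= 1 by apply: mulr_ile1 => //; [exact: ltW|exact: ltW|have /andP[] := l01].
apply: ltr_leD; first by rewrite /bump/= expr1; lra.
by apply: ler_sum => i _; apply: exprn_ile1; lra.
Qed.

End subcritical.

(** * Probabilities of tree events *)

Section tree_probability.
Context {R : realType} {d : nat} {disp : measure_display}
  {Omega : measurableType disp} {P : probability Omega R}.
Implicit Types (w : Omega) (k l : 'rV[int]_d).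

Lemma measurable_RV_lt (Y : {RV P >-> R}) (a : R) :
  measurable [set w | Y w < a].
Proof.
by exact: (measurable_funPTI Y (measurable_itv `]-oo, a[)).
Qed.

Lemma uniform_prob_lt (Y : {RV P >-> R}) (a : R) : 0 <= a <= 1 ->
  uniform01 Y -> P [set w | Y w < a] = a%:E.
Proof.
move=> /andP[a0 a1] uY.
have -> : [set w | Y w < a] = Y @^-1` `]-oo, a[ by [].
rewrite uY// /uniform_prob integral_uniform_pdf.
have -> : `]-oo, a[ `&` `[0, 1] = [set` `[0, a[] :> set R.
  apply/seteqP; split=> x /=; rewrite !in_itv/=.
    by move=> [xa /andP[x0 x1]]; rewrite x0.
  by move=> /andP[x0 xa]; rewrite xa x0 (le_trans (ltW xa)).
rewrite (eq_integral (cst 1%E)) => [|x]; last first.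
  rewrite inE/= in_itv/= /uniform_pdf => /andP[x0 xa].
  by rewrite x0 (le_trans (ltW xa))// subr0 invr1.
rewrite integral_cst//= mul1e lebesgue_measure_itv/= lte_fin.
case: ifPn => [_|]; first by rewrite sube0.
by rewrite -leNgt => aa0; congr (_%:E); apply/eqP; rewrite eq_le a0 aa0.
Qed.

Variables (beta : R) (t : node d -> {RV P >-> R}).
Hypotheses (beta0 : 0 < beta) (beta1 : beta <= 1)
  (ut : forall v, uniform01 (t v)) (it : mutually_independent t).

Definition opened v : set Omega := [set w | t v w < beta].

Definition open_indicator w (v : node d) : R := (t v w < beta)%R%:R.

Lemma measurable_opened v : measurable (opened v).
Proof. exact: measurable_RV_lt. Qed.

Lemma prob_all_opened (S : seq (node d)) : uniq S ->
  P (\big[setI/setT]_(v <- S) opened v) = (beta ^+ size S)%:E.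
Proof.
move=> uS; have := it (B := fun=> `]-oo, beta[%classic) uS (fun=> measurable_itv _).
rewrite -[X in P X = _]/(\big[setI/setT]_(v <- S) opened v) => ->.
have b01 : 0 <= beta <= 1 by rewrite ltW.
rewrite (eq_bigr (fun=> beta%:E)) => [|v _]; last first.
  exact: uniform_prob_lt b01 (ut v).
elim: S {uS} => [|v S IHS]; first by rewrite big_nil expr0.
by rewrite big_cons IHS/= exprS.
Qed.

Lemma open_indicator01 w v : open_indicator w v = 0 \/ open_indicator w v = 1.
Proof. by rewrite /open_indicator; case: (_ < _); [right|left]. Qed.

Lemma prod_open_indicator (S : seq (node d)) w :
  \prod_(v <- S) open_indicator w v = \1_(\big[setI/setT]_(v <- S) opened v) w.
Proof.
rewrite indicE; elim: S => [|v S IHS].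
  by rewrite !big_nil in_setT.
rewrite !big_cons IHS in_setI -mulnb natrM; congr (_ * _).
by rewrite /open_indicator; congr (nat_of_bool _)%:R; apply/idP/idP; rewrite inE.
Qed.

(** A monomial in distinct indicators is the indicator of an intersection of
    independent events, so that the expectation of [h] is computed by replacing
    every variable by its own expectation, [beta]. *)
Lemma expectation_multiaffine A (h : (node d -> R) -> R) : multiaffine A h ->
  P.-integrable setT (fun w => (h (open_indicator w))%:E) /\
  (\int[P]_w (h (open_indicator w))%:E = (h (fun=> beta))%:E)%E.
Proof.
move=> [L [uL _ hL]].
have mS (S : seq (node d)) : measurable (\big[setI/setT]_(v <- S) opened v).
  by apply: bigsetI_measurable => v _; exact: measurable_opened.
have hE : (fun w => (h (open_indicator w))%:E) = (fun w =>
    \sum_(cS <- L) cS.1%:E * (\1_(\big[setI/setT]_(v <- cS.2) opened v) w)%:E)%E.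
  apply/funext => w; rewrite hL -sumEFin; apply: eq_bigr => cS _.
  by rewrite EFinM prod_open_indicator.
have iL (cS : R * seq (node d)) : P.-integrable setT
    (fun w => cS.1%:E * (\1_(\big[setI/setT]_(v <- cS.2) opened v) w)%:E)%E.
  by apply: integrableZl => //; apply: integrable_indic => //; exact: fin_num_measure.
split; first by rewrite hE; exact: integrable_sum.
rewrite hE integral_sum// hL -sumEFin big_seq [RHS]big_seq; apply: eq_bigr => cS cSL.
rewrite integralZl//; last by apply: integrable_indic => //; exact: fin_num_measure.
rewrite integral_indic// setIT EFinM; congr (_ * _)%E.
etransitivity; first exact: prob_all_opened (uL _ cSL).
congr (_%:E).
by rewrite big_const_seq count_predT iter_mulr_1.
Qed.

Let T := in_tree beta (fun v => t v).

Fixpoint lineage n l : seq (node d) :=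
  if n is m.+1 then (n, l) :: lineage m (half_row l) else [::].

Lemma lineage_le n l v : v \in lineage n l -> (v.1 <= n)%N.
Proof.
elim: n l => //= n IHn l; rewrite in_cons => /orP[/eqP ->//|/IHn].
by move/leqW.
Qed.

Lemma uniq_lineage n l : uniq (lineage n l).
Proof.
elim: n l => //= n IHn l; rewrite IHn andbT; apply/negP => /lineage_le.
by rewrite ltnn.
Qed.

Lemma size_lineage n l : size (lineage n l) = n.
Proof. by elim: n l => //= n IHn l; rewrite IHn. Qed.

Lemma ancestorSr n l : ancestor n.+1 l = ancestor n (half_row l).
Proof. exact: iterSr. Qed.

Lemma in_tree_lineage n l : ancestor n l = 0 ->
  [set w | T w n l] = \big[setI/setT]_(v <- lineage n l) opened v.
Proof.
elim: n l => [|n IHn] l an /=.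
  by rewrite big_nil; apply/seteqP; split=> w //= _; rewrite -an.
rewrite big_cons -IHn -?ancestorSr//.
by apply/seteqP; split=> w /= [].
Qed.

Lemma in_tree_ancestor w n l : T w n l -> ancestor n l = 0.
Proof. by elim: n l => [|n IHn] l //= [/IHn]; rewrite -ancestorSr. Qed.

Lemma in_tree_up w m n l : T w (m + n)%N l -> T w m (ancestor n l).
Proof.
by elim: n l => [|n IHn] l; rewrite ?addn0// addnS ancestorSr => -[/IHn].
Qed.

Lemma measurable_in_tree n l : measurable [set w | T w n l].
Proof.
have [an|an] := eqVneq (ancestor n l) 0; last first.
  rewrite (_ : [set w | T w n l] = set0)// -subset0 => w /= /in_tree_ancestor.
  exact/eqP.
rewrite in_tree_lineage//; apply: bigsetI_measurable => v _.
exact: measurable_opened.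
Qed.

Lemma prob_in_tree n l : ancestor n l = 0 -> P [set w | T w n l] = (beta ^+ n)%:E.
Proof.
move=> an; rewrite in_tree_lineage// prob_all_opened ?uniq_lineage//.
by rewrite size_lineage.
Qed.

Definition tree_level w j k n : seq 'rV[int]_d :=
  [seq l <- descendants k n | `[< T w (j + n)%N l >]].

Lemma mem_tree_level w j k n l :
  (l \in tree_level w j k n) <-> T w (j + n)%N l /\ ancestor n l = k.
Proof.
rewrite mem_filter mem_descendants; split=> [/andP[/asboolP ? /eqP]//|[? ->]].
by rewrite eqxx andbT; apply/asboolP.
Qed.

Definition alive j k n : set Omega :=
  \bigcup_(l in [set` descendants k n]) [set w | T w (j + n)%N l].

Lemma measurable_alive j k n : measurable (alive j k n).
Proof.
by apply: fin_bigcup_measurable => // l _; exact: measurable_in_tree.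
Qed.

Lemma aliveP w j k n :
  alive j k n w <-> exists l, T w (j + n)%N l /\ ancestor n l = k.
Proof.
split=> [[l /=]|[l [Tl ll]]]; first by rewrite mem_descendants => /eqP; exists l.
by exists l => //=; rewrite mem_descendants ll.
Qed.

Lemma alive_decr j k : nonincreasing_seq (alive j k).
Proof.
apply/nonincreasing_seqP => n; apply/subsetPset => w /aliveP[l].
rewrite addnS ancestorSr => -[[Tl _] ll].
by apply/aliveP; exists (half_row l).
Qed.

Lemma survival_alive lam w n j k : (forall i, 0 <= lam i <= 1) ->
  T w j k -> ~ alive j k n w -> survival lam (open_indicator w) n j k = 0.
Proof.
move=> lam01; elim: n j k => [|n IHn] j k Tjk nalive /=.
  by exfalso; apply: nalive; apply/aliveP; exists k; rewrite addn0.
rewrite big1 ?subrr// => b _; rewrite /open_indicator.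
case: ltP => tb; last by rewrite mul0r mulr0 subr0.
rewrite IHn ?mulr0 ?subr0//; first by split; rewrite ?half_row_child.
move=> /aliveP[l [Tl ll]]; apply: nalive; apply/aliveP; exists l.
by rewrite addnS -addSn; split => //; rewrite /ancestor iterS -/(ancestor _ _) ll half_row_child.
Qed.

Lemma survival_one_alive w n j k : T w j k -> alive j k n w ->
  survival (fun=> 1) (open_indicator w) n j k = 1.
Proof.
elim: n j k => [|n IHn] j k Tjk //= /aliveP[l [Tl ll]].
have [b lb] : exists b, ancestor n l = child k b.
  by rewrite -ll; have [b lb] := child_half_row (ancestor n l); exists b.
rewrite addnS -addSn in Tl.
rewrite (bigD1 b)//= IHn; last 2 first.
- by rewrite -lb; exact: in_tree_up Tl.
- by apply/aliveP; exists l.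
have [_ tb] : T w j.+1 (child k b) by rewrite -lb; exact: in_tree_up Tl.
by rewrite /open_indicator tb !mulr1 subrr mul0r subr0.
Qed.

Lemma survival_one_cst n j k :
  survival (fun=> 1) (fun=> beta) n j k = iter n (offspring (2 ^ d) beta) 1.
Proof.
elim: n j k => //= n IHn j k; rewrite /offspring; congr (1 - _).
under eq_bigr do rewrite IHn mul1r.
by rewrite prodr_const card_ffun card_bool card_ord.
Qed.

(** Without thinning, [survival] is the indicator of [alive]; its value at the
    constant [beta] satisfies the recursion of the iterates of [offspring]. *)
Lemma prob_alive n :
  P (alive 0 0 n) = (iter n (offspring (2 ^ d) beta) 1)%:E.
Proof.
rewrite -(survival_one_cst n 0 0).
have [_ <-] := expectation_multiaffine (multiaffine_survival (fun=> 1) n 0 0).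
rewrite -[alive _ _ _]setIT -integral_indic//; last exact: measurable_alive.
apply: eq_integral => w _; rewrite indicE; congr (_%:E).
have [wa|wa] := pselect (alive 0 0 n w).
  by rewrite mem_set// survival_one_alive.
by rewrite memNset// survival_alive// => i; rewrite ler01 lexx.
Qed.

Definition infinite_tree : set Omega := \bigcap_n alive 0 0 n.

Lemma measurable_infinite_tree : measurable infinite_tree.
Proof. by apply: bigcap_measurable => [|n _]; [exists 0%N|exact: measurable_alive]. Qed.

Lemma prob_infinite_tree (q : R) :
  iter n (offspring (2 ^ d) beta) 1 @[n --> \oo] --> q ->
  P infinite_tree = q%:E.
Proof.
move=> cvq; have : (P \o alive 0 0) n @[n --> \oo] --> P infinite_tree.
  apply: nonincreasing_cvg_mu.
  - exact: le_lt_trans (probability_le1 _ (measurable_alive 0 0 0)) (ltry _).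
  - by move=> n; exact: measurable_alive.
  - exact: measurable_infinite_tree.
  - exact: alive_decr.
have -> : P \o alive 0 0 = fun n => (iter n (offspring (2 ^ d) beta) 1)%:E.
  by apply/funext => n; exact: prob_alive.
move=> h; apply: cvg_unique h _ => //.
by apply: cvg_EFin; [exact: nearW|exact: cvq].
Qed.

End tree_probability.

(** * Thinning an infinite tree *)

Section ultimate_survival.
Context {R : realType} {d : nat} {disp : measure_display}
  {Omega : measurableType disp} {P : probability Omega R}.
Variables (beta : R) (t : node d -> {RV P >-> R}).
Hypotheses (d1 : (1 <= d)%N) (beta0 : 0 < beta) (beta1 : beta <= 1)
  (ut : forall v, uniform01 (t v)) (it : mutually_independent t).
Local Notation M := (2 ^ d)%N.
Local Notation u_ lam w := (ult_survival (open_indicator beta t w) lam 0 0).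

Let M2 : (2 <= M)%N.
Proof. by rewrite -{1}(expn1 2) leq_exp2l. Qed.

Let x01 w v : 0 <= open_indicator beta t w v <= 1.
Proof. by case: (open_indicator01 beta t w v) => ->; rewrite ?lexx ler01. Qed.

Section any_weights.
Variables (lam : nat -> R) (c : R).
Hypotheses (lam01 : forall i, 0 <= lam i <= 1)
  (ge_c : forall n, c <= survival lam (fun=> beta) n 0 (0 : 'rV_d)).

Let surv n w := survival lam (open_indicator beta t w) n 0 0.

Let msurv n : measurable_fun setT (surv n).
Proof.
have [/measurable_int + _] := expectation_multiaffine beta0 beta1 ut it
  (multiaffine_survival lam n 0 (0 : 'rV_d)).
by move/measurable_EFinP.
Qed.

Let mult : measurable_fun setT (fun w => u_ lam w).
Proof.
apply: (measurable_fun_cvg msurv) => w _; exact: cvg_survival (x01 w) lam01 0 0.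
Qed.

Definition surviving : set Omega := [set w | 0 < u_ lam w].

Lemma measurable_surviving : measurable surviving.
Proof.
rewrite (_ : surviving = (fun w => u_ lam w) @^-1` `]0, +oo[).
  rewrite -[X in measurable X]setTI; apply: mult => //; exact: measurable_itv.
by apply/seteqP; split=> w /=; rewrite in_itv/= andbT.
Qed.

(** [u_ lam w] is at most the indicator of [surviving], and its expectation is the
    limit of those of [surv n]. *)
Lemma prob_surviving_ge : (c%:E <= P surviving)%E.
Proof.
have [_ _ cvu] : [/\ P.-integrable setT (fun w => (u_ lam w)%:E),
    (\int[P]_w `|(surv n w)%:E - (u_ lam w)%:E| @[n --> \oo] --> 0)%E
  & (\int[P]_w (surv n w)%:E @[n --> \oo] --> \int[P]_w (u_ lam w)%:E)%E].
  apply: (@dominated_convergence _ _ _ P setT measurableT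
      (fun n w => (surv n w)%:E) (fun w => (u_ lam w)%:E) (cst 1%E)).
  - by move=> n; apply/measurable_EFinP.
  - by apply/measurable_EFinP.
  - apply: aeW => w _; apply: cvg_EFin; first exact: nearW.
    exact: cvg_survival (x01 w) lam01 0 0.
  - apply: (eq_integrable _ (fun w => (\1_setT w)%:E)) => //.
      by move=> w _; rewrite indicT.
    by apply: integrable_indic => //; exact: fin_num_measure.
  - apply: aeW => w n _; rewrite /cst/= lee_fin.
    by have /andP[s0 s1] := survival01 (x01 w) lam01 n 0 0; rewrite ger0_norm.
have le_c : (c%:E <= \int[P]_w (u_ lam w)%:E)%E.
  rewrite -(cvg_lim _ cvu)//; apply: lime_ge; first exact: cvgP cvu.
  apply: nearW => n.
  have [_ ->] := expectation_multiaffine beta0 beta1 ut it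
    (multiaffine_survival lam n 0 (0 : 'rV_d)).
  by rewrite lee_fin.
apply: (le_trans le_c); rewrite -[surviving]setIT -integral_indic//; last first.
  exact: measurable_surviving.
apply: ge0_le_integral => //.
- by move=> w _; rewrite lee_fin; have /andP[] := ult_survival01 (x01 w) lam01 0 0.
- exact/measurable_EFinP.
- apply/measurable_EFinP; apply: measurable_indic; exact: measurable_surviving.
- move=> w _; rewrite lee_fin indicE.
  have /andP[u0 u1] := ult_survival01 (x01 w) lam01 0 0.
  have [ws|ws] := pselect (surviving w); first by rewrite mem_set.
  by rewrite memNset// leNgt; apply/negP.
Qed.

Lemma surviving_infinite : surviving `<=` infinite_tree beta t.
Proof.
move=> w uw n _; apply: contrapT => /(survival_alive lam01 (erefl : in_tree _ _ _ 0 0)).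
move=> s0; have := ult_survival_le (x01 w) lam01 n 0 0.
by rewrite s0 leNgt => /negP; apply.
Qed.

End any_weights.

Variable lam : R.
Hypotheses (lam0 : 0 < lam) (lam1 : lam <= 1) (super : 1 < M%:R * (beta * lam)).

(** No thinning up to the level [N]. *)
Definition delayed N i : R := if (i < N)%N then 1 else lam.

Lemma delayed01 N i : 0 <= delayed N i <= 1.
Proof. by rewrite /delayed; case: ifP => _; rewrite ?ler01 ?lexx// ltW. Qed.

(* by [offspring_ge], a generation of the thinned tree does not decrease [delta] *)
Let delta : R := 1 - (M%:R * (beta * lam))^-1.

Let delta01 : 0 < delta <= 1.
Proof.
have c0 : 0 < M%:R * (beta * lam) by exact: lt_trans super.
by rewrite subr_gt0 invf_lt1// super/= lerBlDr lerDl invr_ge0 ltW.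
Qed.

Let offspring_le_prod (a y : R) (s : {ffun 'I_d -> bool} -> R) :
  0 <= a <= 1 -> (forall b, y <= s b <= 1) -> 0 <= y ->
  offspring M a y <= 1 - \prod_b (1 - a * s b).
Proof.
move=> /andP[a0 a1] ys y0; rewrite /offspring lerD2l lerN2.
have -> : (1 - a * y) ^+ M = \prod_(b : {ffun 'I_d -> bool}) (1 - a * y).
  by rewrite prodr_const card_ffun card_bool card_ord.
apply: ler_prod => b _; have /andP[ysb sb1] := ys b.
have as1 : a * s b <= 1 by apply: mulr_ile1 => //; exact: le_trans ysb.
by rewrite subr_ge0 as1/= lerD2l lerN2 ler_wpM2l.
Qed.

Let survival_delayed_ge N n j (k : 'rV[int]_d) :
  iter (N - j) (offspring M beta) delta <= survival (delayed N) (fun=> beta) n j k.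
Proof.
have bl0 : 0 < beta * lam by exact: mulr_gt0.
have bl1 : beta * lam <= 1 by apply: mulr_ile1 => //; exact: ltW.
have b01 : 0 <= beta <= 1 by rewrite ltW.
have d01 : 0 <= delta <= 1 by have /andP[d0 ->] := delta01; rewrite ltW.
elim: n j k => [|n IHn] j k.
  by have /andP[] := iter_offspring01 M beta0 beta1 (N - j) d01.
have s1 b : survival (delayed N) (fun=> beta) n j.+1 (child k b) <= 1.
  by have /andP[] := @survival01 R d (fun=> beta) (delayed N) (fun=> b01) (delayed01 N) n j.+1 (child k b).
rewrite [leRHS]/=; under eq_bigr do rewrite mulrA.
have [Nj|jN] := leqP N j.
  have -> : (N - j = 0)%N by apply/eqP; rewrite subn_eq0.
  have d0 : 0 <= delta by case/andP: d01.
  apply: (le_trans (offspring_ge bl0 bl1 super d0 (lexx _))).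
  rewrite /delayed ltnNge Nj/= [lam * beta]mulrC.
  apply: offspring_le_prod => // [|b]; first by rewrite ltW.
  rewrite s1 andbT; have := IHn j.+1 (child k b).
  by have -> : (N - j.+1 = 0)%N by apply/eqP; rewrite subn_eq0 leqW.
rewrite -subnSK// iterS {1}/delayed jN mul1r; apply: offspring_le_prod => // [b|].
  by rewrite IHn s1.
by have /andP[] := iter_offspring01 M beta0 beta1 (N - j.+1) d01.
Qed.

(** From the level [N] on, the thinned tree is supercritical and survives with
    probability at least [delta]; before it nothing is removed, so the probability
    of surviving is at least the [N]-th iterate of [offspring] from [delta]. These
    iterates tend to the probability that the tree is infinite. *)
Lemma infinite_surviving :
  P.-negligible (infinite_tree beta t `\` \bigcup_N surviving (delayed N)).
Proof.
have Mb1 : 1 < M%:R * beta.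
  by apply: (lt_le_trans super); rewrite ler_wpM2l// ler_piMr// ltW.
have [q [/andP[q0 q1] qF qcv]] := iter_offspring_cvg M2 beta0 beta1 Mb1.
have Pinf : P (infinite_tree beta t) = q%:E.
  by apply: (prob_infinite_tree beta0 beta1 ut it); apply: qcv; rewrite ltr01 lexx.
have minf := measurable_infinite_tree beta t.
have mU : measurable (\bigcup_N surviving (delayed N)).
  by apply: bigcup_measurable => N _; exact: measurable_surviving (delayed01 N).
exists (infinite_tree beta t `\` \bigcup_N surviving (delayed N)); split => //.
  exact: measurableD.
have le_P N : (P (infinite_tree beta t `\` \bigcup_N surviving (delayed N)) <=
    (q - iter N (offspring M beta) delta)%:E)%E.
  have sN : measurable (surviving (delayed N)) by exact: measurable_surviving (delayed01 N).
  apply: (@le_trans _ _ (P (infinite_tree beta t `\` surviving (delayed N)))).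
    apply: le_measure; rewrite ?inE; [exact: measurableD|exact: measurableD|].
    by apply: setDS => w sw; exists N.
  rewrite measureD//; last exact: le_lt_trans (probability_le1 _ minf) (ltry _).
  rewrite setIidr; last exact: surviving_infinite (delayed01 N).
  rewrite [X in (X - _)%E](_ : _ = q%:E)// EFinB leeB// prob_surviving_ge//; first exact: delayed01.
  by move=> n; have := survival_delayed_ge N n 0 0; rewrite subn0.
apply/eqP; rewrite eq_le measure_ge0 andbT.
have := qcv _ delta01 => dcv.
have : (q - iter N (offspring M beta) delta)%:E @[N --> \oo] --> (q - q)%:E.
  apply: cvg_EFin; first exact: nearW.
  by apply: cvgB; [exact: cvg_cst|exact: dcv].
move=> cv0; have -> : (0 = (q - q)%:E)%E by rewrite subrr.
rewrite -(cvg_lim _ cv0)//.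
by apply: lime_ge; [exact: cvgP cv0|exact: nearW].
Qed.

End ultimate_survival.

(** * Hausdorff measures and dyadic cubes *)

Section hausdorff_facts.
Context {R : realType} {d : nat}.
Implicit Types (A F : set 'rV[R]_d) (a : R) (k l : 'rV[int]_d).
Local Open Scope ereal_scope.

Lemma hausdorff_weight_ge0 a F : 0 <= hausdorff_weight a F.
Proof. by rewrite /hausdorff_weight; case: ifP => // _; exact: poweR_ge0. Qed.

Lemma hausdorff_premeasure_ge0 a delta A : 0 <= hausdorff_premeasure a delta A.
Proof.
apply: le_ereal_inf_tmp => _ [F _ <-].
by apply: nneseries_ge0 => i _ _; exact: hausdorff_weight_ge0.
Qed.

Lemma hausdorff_measure_eq0 a A :
  (forall delta : R, (0 < delta)%R -> hausdorff_premeasure a delta A = 0) ->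
  hausdorff_measure a A = 0.
Proof.
move=> H0; rewrite /hausdorff_measure (_ : [set _ | _ in _] = [set 0]) ?ereal_sup1//.
apply/seteqP; split=> [_ [e /= e0 <-]|_ ->]; first exact: H0.
by exists 1%R => //=; apply: H0.
Qed.

Lemma hausdorff_measure_eq0_cover a A (e : R) : (0 < e)%R ->
  hausdorff_measure a A = 0 ->
  exists F : (set 'rV[R]_d)^nat, [/\ A `<=` \bigcup_i F i,
    forall i, diam (F i) <= 1 & \sum_(0 <= i <oo) hausdorff_weight a (F i) < e%:E].
Proof.
move=> e0 H0; have : hausdorff_premeasure a 1 A <= 0.
  by rewrite -H0; apply: ereal_sup_ubound; exists 1%R => /=.
move=> /le_lt_trans/(_ (_ : 0 < e%:E)); rewrite lte_fin => /(_ e0).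
by move=> /ereal_inf_lt[_ [F [AF dF] <-] lt_e]; exists F.
Qed.

Lemma euclidean_dist_coord (x y : 'rV[R]_d) i :
  (`|x ord0 i - y ord0 i| <= euclidean_dist x y)%R.
Proof.
rewrite -sqrtr_sqr; apply: ler_wsqrtr.
by rewrite (bigD1 i)//= lerDl; apply: sumr_ge0 => j _; exact: sqr_ge0.
Qed.

Lemma diam_fin F x : F x -> diam F <= 1 -> exists D : R,
  [/\ diam F = D%:E, (0 <= D <= 1)%R & forall x y, F x -> F y -> (euclidean_dist x y <= D)%R].
Proof.
move=> Fx dF1; have dF0 : 0 <= diam F.
  apply: (@le_trans _ _ (euclidean_dist x x)%:E); first by rewrite lee_fin sqrtr_ge0.
  by apply: ereal_sup_ubound; exists (x, x).
have fd : diam F \is a fin_num by rewrite ge0_fin_numE// (le_lt_trans dF1)// ltry.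
exists (fine (diam F)); rewrite fineK//; split => // [|y z Fy Fz].
  by rewrite fine_ge0//= -lee_fin fineK.
by rewrite -lee_fin fineK//; apply: ereal_sup_ubound; exists (y, z).
Qed.

Local Open Scope ring_scope.

Definition cube j k : set 'rV[R]_d :=
  [set x | forall i, (k ord0 i)%:~R <= 2 ^+ j * x ord0 i <= (k ord0 i)%:~R + 1].

Lemma cube_half_row j l : cube j.+1 l `<=` cube j (half_row l).
Proof.
move=> x xl i; have := xl i; rewrite !mxE exprS -mulrA.
set y := 2 ^+ j * _; set z := l ord0 i => /andP[zy yz].
have zE : z%:~R = (z %/ 2)%Z%:~R * 2 + (z %% 2)%Z%:~R :> R.
  by rewrite {1}(divz_eq z 2) intrD intrM.
have m0 : 0 <= (z %% 2)%Z%:~R :> R by rewrite ler0z modz_ge0.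
have m1 : (z %% 2)%Z%:~R <= 1 :> R.
  by rewrite -[leRHS]/(1%:~R) ler_int -ltzD1 ltz_pmod.
by lra.
Qed.

Lemma cube_ancestor j n l : cube (j + n) l `<=` cube j (ancestor n l).
Proof.
elim: n l => [|n IHn] l; first by rewrite addn0.
by rewrite addnS ancestorSr => x /cube_half_row/IHn.
Qed.

Lemma diam_cube j k : (diam (cube j k) <= (Num.sqrt d%:R * (2 ^+ j)^-1)%:E)%E.
Proof.
apply: ge_ereal_sup => _ [[x y] [/= xk yk] <-]; rewrite lee_fin.
have j0 : 0 < 2 ^+ j :> R by exact: exprn_gt0.
have ji0 : 0 <= (2 ^+ j)^-1 :> R by rewrite invr_ge0 ltW.
rewrite -[(2 ^+ j)^-1](ger0_norm ji0) -sqrtr_sqr -sqrtrM//.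
rewrite /euclidean_dist; apply: ler_wsqrtr.
rewrite -[d in d%:R]card_ord -sum1_card natr_sum mulr_suml; apply: ler_sum => i _.
rewrite mul1r -[leLHS]real_normK ?num_real//.
apply: lerXn2r; rewrite ?nnegrE//=.
have /andP[x1 x2] := xk i; have /andP[y1 y2] := yk i.
rewrite -(ler_pM2l j0) divff ?gt_eqF// -{1}[2 ^+ j]gtr0_norm// -normrM mulrBr.
by rewrite ler_norml; apply/andP; split; lra.
Qed.

(** The cubes of one level are a covering, by sets of comparable small diameters. *)
Lemma hausdorff_measure_cubes a A (L : nat -> seq 'rV[int]_d) : 0 < a ->
  (forall j, A `<=` \bigcup_(k in [set` L j]) cube j k) ->
  (forall (e : R) j0, 0 < e ->
    exists2 j, (j0 <= j)%N & (size (L j))%:R * 2 `^ (- (j%:R * a)) < e) ->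
  hausdorff_measure a A = 0%E.
Proof.
move=> a0 AL smallL; apply: hausdorff_measure_eq0 => delta delta0.
apply/eqP; rewrite eq_le hausdorff_premeasure_ge0 andbT.
apply/lee_addgt0Pr => e e0; rewrite add0e.
pose c : R := Num.sqrt d%:R `^ a + 1.
have c0 : 0 < c by rewrite ltr_wpDl// powR_ge0.
have [j0 j0P] : exists j0, forall j, (j0 <= j)%N -> Num.sqrt d%:R * (2 ^+ j)^-1 <= delta.
  have half1 : `|2^-1 : R| < 1 by rewrite ger0_norm// invf_lt1// ltr1n.
  have : Num.sqrt d%:R * 2^-1 ^+ j @[j --> \oo] --> Num.sqrt d%:R * (0 : R).
    by apply: cvgM; [exact: cvg_cst|exact: cvg_expr].
  rewrite mulr0 => /cvgrPdist_le/(_ _ delta0)[j0 _ j0P]; exists j0 => j jj.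
  have := j0P j jj; rewrite /= sub0r normrN exprVn => /(le_trans _); apply.
  exact: ler_norm.
have [j j0j small] := smallL _ j0 (divr_gt0 e0 c0).
pose F i : set 'rV[R]_d := if (i < size (L j))%N then cube j (nth 0 (L j) i) else set0.
apply: (@le_trans _ _ (\sum_(0 <= i <oo) hausdorff_weight a (F i))%E).
  apply: ereal_inf_lbound; exists F => //; split=> [x /AL-/(_ j)[k /= kL xk]|i].
    by exists (index k (L j)) => //; rewrite /F index_mem kL nth_index.
  rewrite /F; case: ifP => _.
    by apply: le_trans (diam_cube _ _) _; rewrite lee_fin; exact: j0P.
  by apply: ge_ereal_sup => _ [[x y] [/= []]].
have wF i : (hausdorff_weight a (F i) <=
    (if (i < size (L j))%N then c * 2 `^ (- (j%:R * a)) else 0)%:E)%E.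
  rewrite /F; case: ifP => _; rewrite /hausdorff_weight; last by rewrite eqxx.
  case: ifPn => [_|cube0]; first by rewrite lee_fin mulr_ge0 ?ltW// powR_ge0.
  move: (diam_cube j (nth 0 (L j) i)) cube0; set Q := cube _ _ => + /set0P[x Qx].
  have : (0 <= diam Q)%E.
    apply: (@le_trans _ _ (euclidean_dist x x)%:E); first by rewrite lee_fin sqrtr_ge0.
    by apply: ereal_sup_ubound; exists (x, x).
  case: (diam Q) => [D||]//; rewrite !lee_fin => D0 DD.
  apply: (@le_trans _ _ ((Num.sqrt d%:R * (2 ^+ j)^-1) `^ a)).
    apply: ge0_ler_powR; [exact: ltW|exact: D0| |exact: DD].
    by rewrite nnegrE (le_trans D0).
  rewrite powRM ?sqrtr_ge0 ?invr_ge0 ?exprn_ge0//.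
  rewrite -powR_mulrn// -powRN -powRrM mulNr.
  by rewrite ler_wpM2r ?powR_ge0// lerDl.
apply: (@le_trans _ _ (\sum_(0 <= i < size (L j)) (c * 2 `^ (- (j%:R * a)))%:E)%E).
  apply: (@le_trans _ _ (\sum_(0 <= i <oo)
      (if (i < size (L j))%N then c * 2 `^ (- (j%:R * a)) else 0)%:E)%E).
    by apply: lee_nneseries => // i _ _; exact: hausdorff_weight_ge0.
  rewrite (nneseries_split 0 (size (L j))) => [|i _]; last first.
    by case: ifP => _; rewrite lee_fin// mulr_ge0 ?ltW// powR_ge0.
  rewrite add0n eseries0 ?adde0 => [|i ji _]; last by rewrite ltnNge ji.
  by rewrite big_nat [leRHS]big_nat; apply: lee_sum => i /andP[_ ->].
rewrite sumEFin lee_fin sumr_const_nat subn0 -[leLHS]mulr_natl mulrCA.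
by rewrite mulrC -ler_pdivlMr// ltW.
Qed.

End hausdorff_facts.

Lemma powR2_gt1 {R : realType} (x : R) : 0 < x -> 1 < 2 `^ x.
Proof.
move=> x0; have : (1 : R) `^ x < 2 `^ x.
  by apply: gt0_ltr_powR; rewrite ?nnegrE ?ltr1n.
by rewrite powR1.
Qed.

(** * A lower bound for Hausdorff measures *)

Section limit_points.
Context {R : realType} {d : nat}.

Lemma exists_limit_point (kap : nat -> 'rV[int]_d) :
  (forall j, half_row (kap j.+1) = kap j) ->
  exists z : 'rV[R]_d, forall j, cube j (kap j) z.
Proof.
move=> kapS; have p0 j : 0 < 2 ^+ j :> R by exact: exprn_gt0.
pose lo i j : R := (kap j ord0 i)%:~R / 2 ^+ j.
pose hi i j : R := ((kap j ord0 i)%:~R + 1) / 2 ^+ j.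
have step i j : lo i j <= lo i j.+1 /\ hi i j.+1 <= hi i j.
  have kE : (kap j.+1 ord0 i)%:~R =
      (kap j ord0 i)%:~R * 2 + (kap j.+1 ord0 i %% 2)%Z%:~R :> R.
    by rewrite {1}(divz_eq (kap j.+1 ord0 i) 2) intrD intrM -(kapS j) mxE.
  have m0 : 0 <= (kap j.+1 ord0 i %% 2)%Z%:~R :> R by rewrite ler0z modz_ge0.
  have m1 : (kap j.+1 ord0 i %% 2)%Z%:~R <= 1 :> R.
    by rewrite -[leRHS]/(1%:~R) ler_int -ltzD1 ltz_pmod.
  rewrite /lo /hi exprS invfM !mulrA; split.
  - by rewrite ler_pM2r ?invr_gt0// kE; lra.
  - by rewrite ler_pM2r ?invr_gt0// kE; lra.
have lo_nd i : nondecreasing_seq (lo i).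
  by apply/nondecreasing_seqP => j; have [] := step i j.
have hi_ni i : nonincreasing_seq (hi i).
  by apply/nonincreasing_seqP => j; have [] := step i j.
have lohi i j j' : lo i j <= hi i j'.
  apply: (le_trans (lo_nd i _ _ (leq_maxl j j'))).
  apply: le_trans (hi_ni i _ _ (leq_maxr j j')).
  by rewrite ler_pM2r ?invr_gt0// lerDl.
exists (\row_i sup (range (lo i))) => j i; rewrite mxE.
have hs : has_sup (range (lo i)).
  by split; [exists (lo i 0%N), 0%N|exists (hi i 0%N) => _ [j' _ <-]].
rewrite mulrC; apply/andP; split.
  by rewrite -ler_pdivrMr//; apply: ub_le_sup; [case: hs|exists j].
by rewrite -ler_pdivlMr//; apply: ge_sup => [|_ [j' _ <-]]; [case: hs|exact: lohi].
Qed.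

(** The dyadic scale of a set of diameter [D]. For [D = 0], no scale is exact: a
    fine one costs at most [e]. *)
Lemma exists_scale (a b D e : R) : 0 <= a -> a <= b -> 0 < b -> 0 <= D <= 1 ->
  0 < e -> exists n, D <= (2 ^+ n)^-1 /\
    (2 `^ (- b)) ^+ n <= 2 `^ b * D `^ a + e.
Proof.
move=> a0 ab b0 /andP[D0 D1] e0.
have geo0 (z c : R) : 0 < z -> 0 <= c < 1 -> exists n, c ^+ n < z.
  move=> z0 /andP[c0 c1]; have : `|c| < 1 by rewrite ger0_norm.
  move=> /cvg_expr/cvgrPdist_lt/(_ _ z0)[n _ /(_ n (leqnn _))].
  rewrite /= sub0r normrN => h; exists n; exact: le_lt_trans (ler_norm _) h.
have lt1 : 0 <= (2 : R) `^ (- b) < 1.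
  by rewrite powR_ge0/= powRN invf_lt1 ?powR_gt0 ?powR2_gt1.
move: D0; rewrite le_eqVlt => /orP[/eqP <-|D0].
  have [n ne] := geo0 _ _ e0 lt1.
  exists n; split; first by rewrite invr_ge0 exprn_ge0.
  rewrite (le_trans (ltW ne))// lerDr; apply: mulr_ge0; exact: powR_ge0.
have [m0 m0D] : exists n, (2 ^+ n.+1)^-1 < D.
  have half : 0 <= (2^-1 : R) < 1 by lra.
  have [n nD] := geo0 _ _ D0 half; exists n; apply: le_lt_trans nD.
  rewrite exprVn lef_pV2 ?posrE ?exprn_gt0//.
  by rewrite ler_eXn2l// ltr1n.
have [n nD n_min] := ex_minnP (ex_intro (fun n => (2 ^+ n.+1)^-1 < D) m0 m0D).
exists n; split.
  case: n n_min nD => [|n] n_min _; first by rewrite expr0 invr1.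
  by rewrite leNgt; apply/negP => /n_min; rewrite ltnn.
apply: (@le_trans _ _ (2 `^ b * D `^ b)); last first.
  apply: (@le_trans _ _ (2 `^ b * D `^ a)); last by rewrite lerDl ltW.
  by rewrite ler_wpM2l ?powR_ge0// ger_powR// D0.
have -> : (2 `^ (- b)) ^+ n = 2 `^ b * ((2 ^+ n.+1)^-1) `^ b :> R.
  rewrite -powR_mulrn ?powR_ge0// -powRrM -[2 ^+ n.+1]powR_mulrn// -powRN -powRrM.
  rewrite -powRD ?pnatr_eq0 ?implybT//; congr (_ `^ _).
  by rewrite -natr1; ring.
rewrite ler_wpM2l ?powR_ge0// ge0_ler_powR ?nnegrE ?invr_ge0 ?exprn_ge0 ?ltW//.
Qed.

End limit_points.

Section lower_bound.
Context {R : realType} {d : nat}.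
Implicit Types (lam : R).

Lemma prod_delayed_le lam N n : 0 < lam -> lam <= 1 ->
  \prod_(j < n) delayed lam N j <= lam ^+ n / lam ^+ N.
Proof.
move=> lam0 lam1; rewrite ler_pdivlMr ?exprn_gt0//.
have small m : (m <= N)%N -> \prod_(j < m) delayed lam N j = 1.
  by move=> mN; apply: big1 => j _; rewrite /delayed (leq_trans (ltn_ord j)).
elim: n => [|n IHn]; first by rewrite big_ord0 mul1r expr0 exprn_ile1// ltW.
have [nN|Nn] := leqP n.+1 N.
  by rewrite small// mul1r ler_wiXn2l// ltW.
rewrite big_ord_recr/= {2}/delayed ltnNge -ltnS Nn/= mulrAC exprSr.
by rewrite ler_wpM2r// ltW.
Qed.

Variables (x : node d -> R) (A : set 'rV[R]_d).
Hypotheses (x01 : forall v, x v = 0 \/ x v = 1).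
Hypothesis limA : forall (kap : nat -> 'rV[int]_d) z, kap 0%N = 0 ->
  (forall j, half_row (kap j.+1) = kap j) ->
  (forall j, x (j.+1, kap j.+1) = 1) -> (forall j, cube j (kap j) z) -> A z.

(** A covering of [A] yields a cutset of the tree by cubes of comparable
    diameters, at most [4 ^ d] for each set, as [A] contains the limit points of
    all infinite paths. Weighted by the thinning, which is at most a constant times
    [diam ^ b], the cutset weighs at least the probability [u] that the thinned
    tree survives; hence the sum over the covering cannot be small. *)
Lemma hausdorff_measure_neq0 a b N : 0 <= a -> a <= b -> 0 < b ->
  0 < ult_survival x (delayed (2 `^ (- b)) N) 0 0 -> hausdorff_measure a A <> 0%E.
Proof.
move=> a0 ab b0; set lam := 2 `^ (- b); set u := ult_survival _ _ _ _ => u0 HA.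
have lam0 : 0 < lam by exact: powR_gt0.
have lam1 : lam <= 1.
  by rewrite /lam -[leRHS](powRr0 2); apply: ler_powR; rewrite ?ler1n ?oppr_le0 ?ltW.
pose K := {ffun 'I_d -> 'I_4}.
pose c : R := #|K|%:R / lam ^+ N.
have c0 : 0 < c.
  by rewrite divr_gt0 ?exprn_gt0// ltr0n card_ffun !card_ord expn_gt0.
(* [c] bounds the weight of the cubes of a set, [e] makes the total [u / 2] *)
pose e := u / (2 * (2 `^ b + 1) * c).
have b2 : 0 < 2 `^ b + 1 :> R by rewrite ltr_wpDl ?powR_ge0.
have e0 : 0 < e by rewrite divr_gt0// mulr_gt0// mulr_gt0.
have [F [AF dF Fe]] := hausdorff_measure_eq0_cover e0 HA.
have scale i : exists ny : nat * 'rV[R]_d,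
    (forall z, F i z -> forall m, `|z ord0 m - ny.2 ord0 m| <= (2 ^+ ny.1)^-1) /\
    ((lam ^+ ny.1)%:E <= (2 `^ b)%:E * hausdorff_weight a (F i) +
                         (e / (2 ^ i.+1)%:R)%:E)%E.
  have ei : 0 < e / (2 ^ i.+1)%:R by rewrite divr_gt0// ltr0n expn_gt0.
  have [F0|/set0P[y Fy]] := eqVneq (F i) set0.
    have z01 : 0 <= (0 : R) <= 1 by rewrite lexx ler01.
    have [m [_ mP]] := exists_scale (ltW b0) (lexx b) b0 z01 ei.
    exists (m, 0); rewrite F0; split => //=.
    rewrite /hausdorff_weight eqxx mule0 add0e lee_fin.
    by move: mP; rewrite powR0 ?gt_eqF// mulr0 add0r.
  have [D [dD D01 Deuc]] := diam_fin Fy (dF i).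
  have [n [Dn nP]] := exists_scale a0 ab b0 D01 ei.
  exists (n, y); split=> [z Fz m|] /=.
    exact: le_trans (euclidean_dist_coord _ _ _) (le_trans (Deuc _ _ Fz Fy) Dn).
  rewrite /hausdorff_weight ifF ?dD ?poweR_EFin; first by rewrite -EFinM -EFinD lee_fin.
  by apply/negbTE/set0P; exists y.
have [ny nyP] := choice scale.
pose n i := (ny i).1; pose y i := (ny i).2.
pose w i (g : K) : node d :=
  (n i, \row_m (Num.floor (2 ^+ n i * y i ord0 m) - 2 + (g m)%:Z)).
have lam01 i : 0 <= delayed lam N i <= 1 by exact: delayed01.
have [|kap [k0 kS kx kw]] := exists_avoiding_path (k0 := 0) (w := w) x01 lam01.
  apply: (@le_lt_trans _ _ (\sum_(0 <= i <oo) (c%:E *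
    ((2 `^ b)%:E * hausdorff_weight a (F i) + (e / (2 ^ i.+1)%:R)%:E)))%E).
    apply: lee_nneseries => [i _ _|i _].
      by rewrite lee_fin; apply: sumr_ge0 => g _; apply: prodr_ge0 => j _; case/andP: (lam01 j).
    rewrite /= sumr_const; have [_ /(lee_wpmul2l _)] := nyP i.
    move=> /(_ c%:E) => h; apply: le_trans (h _); last by rewrite lee_fin ltW.
    rewrite -EFinM lee_fin -[leLHS]mulr_natl /c -mulrA ler_wpM2l// mulrC.
    exact: prod_delayed_le.
  have w0 i : (0 <= (2 `^ b)%:E * hausdorff_weight a (F i))%E.
    by rewrite mule_ge0 ?hausdorff_weight_ge0// lee_fin powR_ge0.
  rewrite nneseriesZl => [|i _]; last first.
    by rewrite adde_ge0// lee_fin divr_ge0// ltW.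
  apply: (@le_lt_trans _ _ (c%:E * ((2 `^ b)%:E * e%:E + e%:E))%E).
    apply: lee_wpmul2l; first by rewrite lee_fin ltW.
    apply: (le_trans (epsilon_trick _ w0 (ltW e0))); apply: leeD => //.
    rewrite nneseriesZl => [|i _]; last exact: hausdorff_weight_ge0.
    by apply: lee_wpmul2l; [rewrite lee_fin powR_ge0|exact: ltW].
  have -> : (c%:E * ((2 `^ b)%:E * e%:E + e%:E) = (c * ((2 `^ b + 1) * e))%R%:E)%E.
    by rewrite mulrDl mul1r.
  rewrite lte_fin /e.
  set B := 2 `^ b + 1; have -> : c * (B * (u / (2 * B * c))) = u / 2.
    by field; rewrite !gt_eqF.
  by rewrite ltr_pdivrMr// ltr_pMr// ltr1n.
have [z zk] := @exists_limit_point R d kap kS.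
have [i _ Fz] := AF _ (limA k0 kS kx zk).
have [/(_ _ Fz) zy _] := nyP i.
(* [z] is within [2 ^- n i] of [y i], so its cube of level [n i] is a [w i g] *)
pose f m := Num.floor (2 ^+ n i * y i ord0 m).
have kf m : f m - 2 <= kap (n i) ord0 m /\ kap (n i) ord0 m < f m + 2.
  have n0 : 0 < 2 ^+ n i :> R by exact: exprn_gt0.
  have := zy m; rewrite -/(n i) -/(y i) -(ler_pM2l n0) divff ?gt_eqF//.
  rewrite -{1}[2 ^+ n i]gtr0_norm// -normrM mulrBr ler_norml => /andP[z1 z2].
  have /andP[k1 k2] := zk (n i) m.
  have /andP[f1 f2] := floor_itv (2 ^+ n i * y i ord0 m).
  move: f1 f2; rewrite -/(f m) intrD => f1 f2.
  split; first by rewrite -(ler_int R) intrB; move: f1 f2 k1 k2 z1 z2; lra.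
  by rewrite -(ltr_int R) intrD; move: f1 f2 k1 k2 z1 z2; lra.
pose g : K := [ffun m => inord (absz (kap (n i) ord0 m - f m + 2))].
apply: (kw i g); rewrite /w/=; apply/rowP => m; rewrite !mxE ffunE -/(f m).
have [k1 k2] := kf m.
have h : 0 <= kap (n i) ord0 m - f m + 2 < 4 by lia.
rewrite inordK; last by lia.
by rewrite gez0_abs; [ring|case/andP: h].
Qed.

End lower_bound.

(** * Integration of continuous functions on R^d *)

Section row_measure.
Context {R : realType}.

Section topology_and_measurability.
Context {d : nat}.
Implicit Types (x y : 'rV[R]_d) (U : set 'rV[R]_d) (f g : 'rV[R]_d -> R).

Definition in_box (M : R) : set 'rV[R]_d := [set x | forall i, `|x ord0 i| <= M].

Lemma row_ballP x (e : R) y : 0 < e ->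
  ball x e y <-> forall i, `|x ord0 i - y ord0 i| < e.
Proof.
move=> e0; split=> [[_ xy] i|xy]; first exact: xy.
by split=> // i j; rewrite ord1; exact: xy.
Qed.

Lemma open_rowP U : open U <-> forall x, U x -> exists2 e : R, 0 < e &
  forall y, (forall i, `|x ord0 i - y ord0 i| < e) -> U y.
Proof.
rewrite openE; split=> Uo x Ux.
  have /nbhs_ballP[e e0 eU] := Uo x Ux; exists e => // y xy.
  by apply/eU/row_ballP.
have [e e0 eU] := Uo x Ux; apply/nbhs_ballP; exists e => // y.
by move=> /(row_ballP _ _ e0); exact: eU.
Qed.

Lemma bigcup_countType_measurable (I : countType) (F : I -> set 'rV[R]_d)
    (D : set I) : (forall i, measurable (F i)) -> measurable (\bigcup_(i in D) F i).
Proof.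
move=> mF; have -> : \bigcup_(i in D) F i =
    \bigcup_n (if unpickle n is Some i then if `[< D i >] then F i else set0 else set0).
  apply/seteqP; split=> x.
    by move=> [i Di Fi]; exists (pickle i) => //; rewrite pickleK asboolT.
  by move=> [n _]; case: (unpickle n) => // i; case: asboolP => // Di Fi; exists i.
apply: bigcupT_measurable => n; case: (unpickle n) => // i.
by case: ifP.
Qed.

Lemma exists_half_pow_lt (e : R) : 0 < e -> exists n : nat, (2 ^+ n)^-1 < e.
Proof.
move=> e0; have half1 : `|2^-1 : R| < 1 by rewrite ger0_norm; lra.
have /cvgrPdist_lt/(_ _ e0)[n _ /(_ n (leqnn _))] := cvg_expr half1.
rewrite /= sub0r normrN exprVn => h; exists n; exact: le_lt_trans (ler_norm _) h.
Qed.

(** An open set is a countable union of half-open dyadic cubes. *)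
Lemma open_measurable_row U : open U -> measurable U.
Proof.
move=> /open_rowP Uo; pose hc (nk : nat * 'rV[int]_d) : set 'rV[R]_d :=
  [set x | forall i, ((nk.2 ord0 i)%:~R <= 2 ^+ nk.1 * x ord0 i) /\
                     (2 ^+ nk.1 * x ord0 i < (nk.2 ord0 i)%:~R + 1)].
have -> : U = \bigcup_(nk in [set nk | hc nk `<=` U]) hc nk.
  apply/seteqP; split=> [x Ux|x [nk /= nkU]]; last exact: nkU.
  have [e e0 eU] := Uo x Ux; have [n ne] := exists_half_pow_lt e0.
  have n0 : 0 < 2 ^+ n :> R by exact: exprn_gt0.
  pose k := \row_i Num.floor (2 ^+ n * x ord0 i) : 'rV[int]_d.
  have xk : hc (n, k) x.
    move=> i; rewrite /= mxE; have := floor_itv (2 ^+ n * x ord0 i).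
    by rewrite intrD => /andP[].
  exists (n, k) => //= y yk; apply: eU => i; apply: lt_trans ne.
  have [x1 x2] := xk i; have [y1 y2] := yk i.
  rewrite -(ltr_pM2l n0) divff ?gt_eqF// -{1}[2 ^+ n]gtr0_norm// -normrM mulrBr.
  by move: x1 x2 y1 y2 => /=; rewrite ltr_norml => *; apply/andP; split; lra.
apply: bigcup_countType_measurable => -[n k].
have -> : hc (n, k) = \bigcap_(i in [set: 'I_d])
    ((fun x : 'rV[R]_d => x ord0 i) @^-1`
       [set z | (k ord0 i)%:~R <= 2 ^+ n * z /\ 2 ^+ n * z < (k ord0 i)%:~R + 1]).
  by apply/seteqP; split=> x xk i; [move=> _|]; exact: xk.
apply: fin_bigcap_measurable => // i _; rewrite -[X in measurable X]setTI.
apply: measurable_coord => //.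
have n0 : 0 < 2 ^+ n :> R by exact: exprn_gt0.
rewrite (_ : [set _ | _] = `[(k ord0 i)%:~R / 2 ^+ n, ((k ord0 i)%:~R + 1) / 2 ^+ n[%classic).
  exact: measurable_itv.
apply/seteqP; split=> z /=; rewrite in_itv/= ler_pdivrMr// ltr_pdivlMr// [z * _]mulrC.
  by move=> [-> ->].
by move=> /andP.
Qed.

Lemma continuous_measurable_row f : continuous f -> measurable_fun setT f.
Proof.
move=> /continuousP cf; apply: (measurability _ (RGenOpens.measurableE R)).
move=> _ [_ [a [b ->] <-]]; rewrite setTI; apply: open_measurable_row.
by apply: cf; exact: interval_open.
Qed.

Lemma compact_in_box M : compact (in_box M).
Proof.
rewrite (_ : in_box M = [set v | forall i, `[- M, M]%classic (v ord0 i)]).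
  by apply: (@rV_compact R d (fun=> `[- M, M]%classic)) => i; exact: segment_compact.
by apply/seteqP; split=> x xM i; have := xM i; rewrite /= in_itv/= ler_norml.
Qed.

Lemma measurable_in_box M : measurable (in_box M).
Proof.
rewrite (_ : in_box M = \bigcap_(i in [set: 'I_d])
    ((fun x : 'rV[R]_d => x ord0 i) @^-1` `[- M, M]%classic)).
  apply: fin_bigcap_measurable => // i _; rewrite -[X in measurable X]setTI.
  by apply: measurable_coord => //; exact: measurable_itv.
by apply/seteqP; split=> x xM i; [move=> _|]; have := xM i;
  rewrite /= in_itv/= ler_norml//; apply.
Qed.

Lemma lebesgue_in_box_lty M : (lebesgue_row R d (in_box M) < +oo)%E.
Proof.
rewrite (_ : in_box M = [set v | forall i, `[- M, M]%classic (v ord0 i)]); last first.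
  by apply/seteqP; split=> x xM i; have := xM i; rewrite /= in_itv/= ler_norml.
rewrite (@lebesgue_row_box R d (fun=> `[- M, M]%classic)) => [|i]; last exact: measurable_itv.
rewrite -ge0_fin_numE; last by apply: prode_ge0 => i _; exact: measure_ge0.
apply: prode_fin_num => i _; rewrite lebesgue_measure_itv/=.
by case: ifP.
Qed.

Definition compactly_supported f : Prop :=
  continuous f /\ exists M, forall x, f x != 0 -> in_box M x.

Lemma compactly_supported_integrable f : compactly_supported f ->
  (lebesgue_row R d).-integrable setT (EFin \o f).
Proof.
move=> [cf [M fM]]; have mB := measurable_in_box M.
rewrite (_ : EFin \o f = (EFin \o f) \_ (in_box M)).
  apply/(integrable_mkcond _ _).1 => //.
  apply: measurable_bounded_integrable => //.
  - exact: lebesgue_in_box_lty.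
  - by apply: measurable_funTS; exact: continuous_measurable_row.
  - have /compact_bounded[N [Nr Nb]] : compact (f @` in_box M).
      apply: continuous_compact; last exact: compact_in_box.
      exact: continuous_subspaceT.
    by exists N; split => // K NK x xM; apply: Nb NK _ _; exists x.
apply/funext => x; rewrite patchE; case: ifPn => //; rewrite notin_setE => nx /=.
by have [->//|/fM] := eqVneq (f x) 0.
Qed.

Lemma compactly_supportedM f g : continuous g -> compactly_supported f ->
  compactly_supported (fun x => g x * f x).
Proof.
move=> cg [cf [M fM]]; split=> [x|]; first by apply: continuousM; [exact: cg|exact: cf].
by exists M => x; rewrite mulf_eq0 negb_or => /andP[_]; exact: fM.
Qed.

Lemma compactly_supportedZ c f : compactly_supported f ->
  compactly_supported (fun x => c * f x).
Proof. by apply: compactly_supportedM => x; exact: cst_continuous. Qed.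

Lemma compactly_supportedD f g : compactly_supported f -> compactly_supported g ->
  compactly_supported (fun x => f x + g x).
Proof.
move=> [cf [M fM]] [cg [N gN]]; split=> [x|]; first by apply: continuousD; [exact: cf|exact: cg].
exists (Num.max M N) => x fgx i; rewrite le_max.
have [fx0|/fM ->//] := eqVneq (f x) 0.
by rewrite fx0 add0r in fgx; rewrite (gN _ fgx) orbT.
Qed.

Lemma compactly_supported0 : compactly_supported (fun=> 0).
Proof. by split=> [x|]; [exact: cst_continuous|exists 0 => x; rewrite eqxx]. Qed.

Lemma compactly_supported_sum (I : Type) (s : seq I) (F : I -> 'rV[R]_d -> R) :
  (forall i, compactly_supported (F i)) ->
  compactly_supported (fun x => \sum_(i <- s) F i x).
Proof.
move=> csF; elim: s => [|i s IHs].
  rewrite (_ : (fun _ => _) = fun=> 0); first exact: compactly_supported0.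
  by apply/funext => x; rewrite big_nil.
rewrite (_ : (fun _ => _) = fun x => F i x + \sum_(j <- s) F j x).
  exact: compactly_supportedD.
by apply/funext => x; rewrite big_cons.
Qed.

Lemma Rintegral_sum_compactly_supported (I : Type) (s : seq I)
    (F : I -> 'rV[R]_d -> R) : (forall i, compactly_supported (F i)) ->
  \int[lebesgue_row R d]_x (\sum_(i <- s) F i x) =
  \sum_(i <- s) \int[lebesgue_row R d]_x F i x.
Proof.
move=> csF; elim: s => [|i s IHs].
  rewrite big_nil; transitivity (\int[lebesgue_row R d]_(x in setT) (0 : R)).
    by apply: eq_Rintegral => x _; rewrite big_nil.
  by rewrite Rintegral_cst// mul0r.
rewrite big_cons -IHs -RintegralD//; last 2 first.
- exact: compactly_supported_integrable.
- exact: compactly_supported_integrable (compactly_supported_sum _ _).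
by apply: eq_Rintegral => x _; rewrite big_cons.
Qed.

End topology_and_measurability.

(** * Translation invariance of Lebesgue measure *)

Definition translate d (c v : 'rV[R]_d) : 'rV[R]_d := v + c.

Let measurable_translate d (c : 'rV[R]_d) : measurable_fun setT (translate c).
Proof.
apply: measurable_to_row => i; under eq_fun do rewrite mxE.
by apply: measurable_funD; [exact: measurable_coord|exact: measurable_cst].
Qed.

HB.instance Definition _ d (c : 'rV[R]_d) :=
  isMeasurableFun.Build _ _ _ _ (translate c) (@measurable_translate d c).

Definition translate1 (c x : measurableTypeR R) : measurableTypeR R := (x : R) + c.

Let measurable_translate1 c : measurable_fun setT (translate1 c).
Proof. exact: measurable_funD. Qed.

HB.instance Definition _ c :=
  isMeasurableFun.Build _ _ _ _ (translate1 c) (@measurable_translate1 c).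

Lemma lebesgue_measure_translate1 (c : R) (A : set R) : measurable A ->
  lebesgue_measure (translate1 c @^-1` A) = lebesgue_measure A.
Proof.
move=> mA; apply/esym.
apply: (lebesgue_measure_unique (mu := pushforward lebesgue_measure (translate1 c))) => // X [[a b] _ <-].
rewrite -[RHS]/(lebesgue_measure (translate1 c @^-1` `]a, b]%classic)).
rewrite (_ : translate1 c @^-1` _ = `]a - c, b - c]%classic).
  rewrite !lebesgue_measure_itv/= !lte_fin ltrD2r; case: ifP => // _.
  by rewrite -!EFinB; congr (_%:E); ring.
apply/seteqP; split=> x /=; rewrite !in_itv/= /translate1 => /andP[h1 h2];
  apply/andP; split; move: h1 h2; lra.
Qed.

Lemma lebesgue_row_translate d (c : 'rV[R]_d) (A : set 'rV[R]_d) : measurable A ->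
  lebesgue_row R d (translate c @^-1` A) = lebesgue_row R d A.
Proof.
elim: d c A => [|d IHd] c A mA.
  by congr (_ _); apply/seteqP; split=> v; rewrite /= /translate [v + c]thinmx0 [v]thinmx0.
rewrite /= /lebesgue_consR /pushforward.
pose sh (xv : measurableTypeR R * 'rV[R]_d) : measurableTypeR R * 'rV[R]_d :=
  (translate1 (c ord0 ord0) xv.1, translate (\row_i c ord0 (lift ord0 i)) xv.2).
have msh : measurable_fun setT sh.
  by apply/measurable_fun_pair; apply: measurableT_comp.
pose Msh := isMeasurableFun.Build _ _ _ _ sh msh.
pose fsh : {mfun (measurableTypeR R * 'rV[R]_d)%type >-> (measurableTypeR R * 'rV[R]_d)%type} :=
  HB.pack sh Msh.
have -> : @consR R d @^-1` (translate c @^-1` A) = sh @^-1` (@consR R d @^-1` A).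
  apply/seteqP; split=> -[x v] /=; (set l := translate _ _; set l' := consR _);
    (suff -> : l = l' by []); apply/rowP => i; rewrite !mxE/=;
    by case: unliftP => [j ->|->]//=; rewrite !mxE.
apply/esym; apply: (product_measure_unique (m' := pushforward (lebesgue_measure \x lebesgue_row R d)%E fsh)).
  move=> B C mB mC.
  rewrite -[LHS]/((lebesgue_measure \x lebesgue_row R d)%E
    ((translate1 (c ord0 ord0) @^-1` B) `*` (translate (\row_i c ord0 (lift ord0 i)) @^-1` C))).
  rewrite product_measure1E//; last 2 first.
  - exact: measurable_funPTI.
  - exact: measurable_funPTI.
  by congr (_ * _)%E; [exact: lebesgue_measure_translate1|exact: IHd].
exact: measurable_funPTI.
Qed.

Lemma continuous_translate d (c : 'rV[R]_d) (f : 'rV[R]_d -> R) : continuous f ->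
  continuous (fun x : 'rV[R]_d => f (x + c)).
Proof.
move=> cf x; apply: (@continuous_comp _ _ _ (translate c) f); last exact: cf.
by apply: (continuousD (f := id) (g := cst c)) => //; exact: cst_continuous.
Qed.

Lemma compactly_supported_translate d (c : 'rV[R]_d) (f : 'rV[R]_d -> R) :
  compactly_supported f -> compactly_supported (fun x => f (x + c)).
Proof.
move=> [cf [M fM]]; split=> [|]; first exact: continuous_translate.
exists (M + \sum_i `|c ord0 i|) => x /fM xcM i.
have := xcM i; rewrite mxE => h.
have : `|c ord0 i| <= \sum_i `|c ord0 i| by rewrite (bigD1 i)//= lerDl sumr_ge0.
by have := ler_normB (x ord0 i + c ord0 i) (c ord0 i); rewrite addrK; lra.
Qed.

Lemma Rintegral_translate d (c : 'rV[R]_d) (f : 'rV[R]_d -> R) :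
  compactly_supported f ->
  \int[lebesgue_row R d]_x f (x + c) = \int[lebesgue_row R d]_x f x.
Proof.
move=> csf; have [cf _] := csf; have csfc := compactly_supported_translate c csf.
rewrite /Rintegral; congr fine.
have mf : measurable_fun setT (EFin \o f).
  by apply/measurable_EFinP; exact: continuous_measurable_row.
have intf : (lebesgue_row R d).-integrable (translate c @^-1` setT) ((EFin \o f) \o translate c).
  by rewrite preimage_setT; exact: compactly_supported_integrable csfc.
have := integral_pushforward (@measurable_translate d c) mf intf measurableT.
rewrite preimage_setT => <-.
by apply: eq_measure_integral => A mA _; exact: lebesgue_row_translate.
Qed.

End row_measure.

(** * Smooth functions of one variable *)

Section smooth_chains.
Context {R : realType}.
Implicit Types (F G : nat -> R -> R) (f g : R -> R).

Lemma near_is_derive f g (x df : R) : (\forall y \near x, f y = g y) ->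
  is_derive x 1 f df -> is_derive x 1 g df.
Proof.
move=> fg [dvf <-]; split; first exact: near_eq_derivable dvf.
by apply/esym/near_eq_derive.
Qed.

(** A smooth function [F 0] given together with its derivatives [F n], which
    spares derivability conditions in computations. *)
Definition smooth_chain F := forall n (x : R), is_derive x 1 (F n) (F n.+1 x).

Lemma smooth_chain_continuous F n : smooth_chain F -> continuous (F n).
Proof.
move=> sF x; apply/differentiable_continuous/derivable1_diffP.
by have [] := sF n x.
Qed.

Lemma is_derive_affine f (a c x df : R) : is_derive (a * x + c) 1 f df ->
  is_derive x 1 (fun y => f (a * y + c)) (a * df).
Proof.
move=> /is_derive1_caratheodory[g [gE cg <-]]; apply/is_derive1_caratheodory.
exists (fun z => a * g (a * z + c)); split => // [z|]; first by rewrite gE; ring.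
apply: continuousM; first exact: cst_continuous.
apply: (@continuous_comp _ _ _ (fun z => a * z + c) g) => //.
apply: continuousD; last exact: cst_continuous.
by apply: continuousM; [exact: cst_continuous|exact: cvg_id].
Qed.

Lemma smooth_chain_affine F (a c : R) : smooth_chain F ->
  smooth_chain (fun n x => a ^+ n * F n (a * x + c)).
Proof.
move=> sF n x; have := is_deriveZ (a ^+ n) (is_derive_affine (sF n (a * x + c))).
by move=> /is_derive_eq; apply; rewrite /GRing.scale/= exprSr mulrA.
Qed.

Lemma is_derive_line1 f (x a df : R) : is_derive (x + a) 1 f df ->
  is_derive x 1 (fun y => f (y + a)) df.
Proof.
rewrite -[X in is_derive (X + a)]mul1r => /is_derive_affine.
by rewrite mul1r; under eq_fun do rewrite mul1r.
Qed.

Lemma is_derive_sub f g (x df dg : R) : is_derive x 1 f df -> is_derive x 1 g dg ->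
  is_derive x 1 (fun y => f y - g y) (df - dg).
Proof. by move=> ? ?; exact: is_deriveB. Qed.

Definition diff1 (h : R) f : R -> R := fun x => f (x + h) - f x.

Lemma smooth_chain_diff1 F (h : R) m : smooth_chain F ->
  smooth_chain (fun n => iter m (diff1 h) (F n)).
Proof.
move=> sF; elim: m => //= m IHm n x.
by apply: is_derive_sub => //; exact: is_derive_line1.
Qed.

(** The mean value theorem, iterated. *)
Lemma iter_diff1_le F r (a h C : R) : 0 <= h ->
  (forall n x, (n < r)%N -> a <= x <= a + r%:R * h ->
    is_derive x 1 (F n) (F n.+1 x)) ->
  (forall x, a <= x <= a + r%:R * h -> `|F r x| <= C) ->
  `|iter r (diff1 h) (F 0%N) a| <= C * h ^+ r.
Proof.
move=> h0; elim: r F C => [|r IHr] F C dF bF.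
  by rewrite mulr1; apply: bF; rewrite mul0r addr0 lexx.
have rh0 : 0 <= r%:R * h by rewrite mulr_ge0.
have rE : r.+1%:R * h = r%:R * h + h by rewrite -natr1 mulrDl mul1r.
rewrite iterSr exprS mulrA.
apply: (IHr (fun n => diff1 h (F n)) (C * h)) => [n x nr /andP[ax xa]|x /andP[ax xa]].
  apply: is_derive_sub; [apply: is_derive_line1|]; apply: dF; try exact: ltnW.
  - by rewrite rE; apply/andP; split; lra.
  - by rewrite rE; apply/andP; split; lra.
have in_I y : y \in `[x, x + h] -> a <= y <= a + r.+1%:R * h.
  by rewrite in_itv/= rE => /andP[h1 h2]; apply/andP; split; lra.
rewrite /diff1; have [|y yI||y yI ->] := @MVT_segment R (F r) (F r.+1) x (x + h).
- by rewrite lerDl.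
- by apply: dF => //; apply: in_I; exact: subset_itv_oo_cc.
- apply: derivable_within_continuous => y /in_I yI.
  by have [] := dF r y (ltnSn r) yI.
- have -> : x + h - x = h by ring.
  rewrite normrM (ger0_norm h0); apply: ler_wpM2r => //.
  by apply: bF; exact: in_I.
Qed.

(* formal linear combinations of products of derivatives, and Leibniz' rule *)
Let eval F G (L : seq (R * (nat * nat))) (x : R) : R :=
  \sum_(t <- L) t.1 * (F t.2.1 x * G t.2.2 x).

Let leibniz (L : seq (R * (nat * nat))) : seq (R * (nat * nat)) :=
  [seq (t.1, (t.2.1.+1, t.2.2)) | t <- L] ++ [seq (t.1, (t.2.1, t.2.2.+1)) | t <- L].

Let eval_leibniz F G L x : eval F G (leibniz L) x =
  \sum_(t <- L) t.1 * (F t.2.1.+1 x * G t.2.2 x + F t.2.1 x * G t.2.2.+1 x).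
Proof.
rewrite /eval /leibniz big_cat/= !big_map/= -big_split/=.
by apply: eq_bigr => t _; rewrite mulrDr.
Qed.

Lemma smooth_chainM F G : smooth_chain F -> smooth_chain G ->
  exists2 B, smooth_chain B & B 0%N = fun x => F 0%N x * G 0%N x.
Proof.
move=> sF sG; exists (fun n => eval F G (iter n leibniz [:: (1, (0%N, 0%N))])).
  move=> n x /=; elim: (iter n _ _) => [|[c [i j]] L IHL].
    rewrite (_ : eval F G [::] = cst 0); last by apply/funext => y; rewrite /eval big_nil.
    exact: is_derive_cst.
  rewrite (_ : eval F G _ = fun y => c * (F i y * G j y) + eval F G L y); last first.
    by apply/funext => y; rewrite /eval big_cons.
  have -> : eval F G (leibniz ((c, (i, j)) :: L)) x =
      c * (F i.+1 x * G j x + F i x * G j.+1 x) + eval F G (leibniz L) x.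
    by rewrite !eval_leibniz big_cons.
  have dF := sF i x; have dG := sG j x.
  have dM : is_derive x 1 (fun y => c * (F i y * G j y))
      (c * (F i.+1 x * G j x + F i x * G j.+1 x)).
    have dFG := is_deriveM dF dG; have dcFG := is_deriveZ c dFG.
    by apply: is_derive_eq dcFG _; rewrite /GRing.scale/=; ring.
  exact: is_deriveD.
by apply/funext => x; rewrite /eval/= big_seq1/= mul1r.
Qed.

End smooth_chains.

(** * A bump function *)

Section bump.
Context {R : realType}.

(** The derivatives of [exp (- 1 / t)] are polynomials in [1 / t] times it. *)
Fixpoint flat_poly n : {poly R} :=
  if n is m.+1 then 'X^2 * (flat_poly m - (flat_poly m)^`()) else 1.

Definition flat n (t : R) : R :=
  if 0 < t then (flat_poly n).[t^-1] * expR (- t^-1) else 0.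

Lemma exprn_le_expR (y : R) k : 0 <= y -> y ^+ k <= k%:R ^+ k * expR y.
Proof.
move=> y0; case: k => [|k].
  by rewrite !expr0 mul1r (le_trans _ (expR_ge1Dx y))// lerDl.
have k0 : 0 < k.+1%:R :> R by rewrite ltr0n.
have -> : expR y = expR (y / k.+1%:R) ^+ k.+1.
  by rewrite -expRM_natl mulrC divfK// gt_eqF.
rewrite -exprMn; apply: lerXn2r; rewrite ?nnegrE// ?mulr_ge0 ?expR_ge0//.
apply: le_trans (ler_wpM2l (ltW k0) (expR_ge1Dx (y / k.+1%:R))).
by rewrite mulrDr mulr1 mulrCA divff ?gt_eqF// mulr1 lerDr ltW.
Qed.

Lemma horner_expR_bounded (p : {poly R}) :
  exists2 C, 0 <= C & forall y, 1 <= y -> `|p.[y] * expR (- y)| <= C * y^-1 ^+ 2.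
Proof.
pose c := \sum_(i < size p) `|p`_i|; pose k := (size p + 2)%N.
have c0 : 0 <= c by apply: sumr_ge0.
exists (c * k%:R ^+ k) => [|y y1]; first by rewrite mulr_ge0// exprn_ge0.
have y0 : 0 < y by exact: lt_le_trans y1.
have py : `|p.[y]| <= c * y ^+ size p.
  rewrite horner_coef; apply: (le_trans (ler_norm_sum _ _ _)).
  rewrite mulr_suml; apply: ler_sum => i _; rewrite normrM ler_wpM2l//.
  rewrite ger0_norm ?exprn_ge0 ?(ltW y0)//; apply: ler_weXn2l => //; exact: ltnW.
rewrite normrM [`|expR _|]ger0_norm ?expR_ge0//.
apply: (le_trans (ler_wpM2r (expR_ge0 _) py)).
rewrite -mulrA -[leRHS]mulrA ler_wpM2l// expRN exprVn.
rewrite ler_pdivlMr ?exprn_gt0// mulrAC ler_pdivrMr ?expR_gt0// -exprD.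
exact/exprn_le_expR/ltW.
Qed.

(** At [0] the difference quotients tend to [0], by [horner_expR_bounded] at
    [y = 1 / t]. *)
Lemma flat_smooth : smooth_chain flat.
Proof.
move=> n t; have [t0|t0|<-] := ltgtP 0 t.
- have t_neq0 : t != 0 by rewrite gt_eqF.
  apply: (@near_is_derive _ (fun t => (flat_poly n).[t^-1] * expR (- t^-1))).
    near=> s; rewrite /flat ifT//; near: s; exact: lt_nbhsr.
  have dV : is_derive t 1 (fun s : R => s^-1) (- t ^- 2).
    by apply: is_derive_eq (is_deriveV t_neq0 (is_derive_id t 1)) _; rewrite /GRing.scale/= mulr1.
  have dP : is_derive t 1 (fun s : R => (flat_poly n).[s^-1])
      ((flat_poly n)^`().[t^-1] * (- t ^- 2)).
    exact: (@is_derive1_comp _ (horner (flat_poly n)) (fun s => s^-1)).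
  have dE : is_derive t 1 (fun s : R => expR (- s^-1)) (expR (- t^-1) * (t ^- 2)).
    apply: (@is_derive1_comp _ expR (fun s => - s^-1)).
    by apply: is_derive_eq (is_deriveN dV) _; rewrite opprK.
  apply: is_derive_eq (is_deriveM dP dE) _.
  rewrite /flat t0/= hornerM hornerXn hornerD hornerN exprVn /GRing.scale/=; ring.
- have -> : flat n.+1 t = 0 by rewrite /flat ltNge (ltW t0).
  have d0 : is_derive t (1 : R) (cst (0 : R)) 0 := is_derive_cst _ _ _.
  apply: near_is_derive d0.
  near=> s; rewrite /flat ifF//; apply/negbTE; rewrite -leNgt; apply: ltW.
  by near: s; exact: lt_nbhsl.
- have flat0 m : flat m 0 = 0 by rewrite /flat ltxx.
  rewrite flat0; apply/is_derive1_caratheodory.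
  exists (fun z => if z == 0 then 0 else flat n z / z); split.
  + move=> z; rewrite flat0 !subr0.
    by case: eqP => [->|/eqP z0]; [rewrite flat0 mulr0|rewrite divfK].
  + have [C C0 bC] := horner_expR_bounded (flat_poly n).
    have near0 (e : R) : 0 < e -> \forall z \near (0 : R), `|z| < e by exact: nbhs0_lt.
    have C1 : 0 < C + 1 by rewrite ltr_wpDl.
    apply/cvgrPdist_le => e e0; rewrite eqxx.
    have eC0 : 0 < e / (C + 1) by exact: divr_gt0.
    near=> z; rewrite sub0r normrN; case: eqP => [_|/eqP z0]; first by rewrite normr0 ltW.
    rewrite /flat; case: ltP => [zp|_]; last by rewrite mul0r normr0 ltW.
    have z1 : `|z| < 1 by near: z; exact: near0.
    have zC : `|z| < e / (C + 1) by near: z; exact: near0 eC0.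
    rewrite (ger0_norm (ltW zp)) in z1; rewrite (ger0_norm (ltW zp)) ltr_pdivlMr// in zC.
    rewrite normrM normfV (ger0_norm (ltW zp)) ler_pdivrMr//.
    apply: (le_trans (bC _ _)); first by rewrite invf_ge1// ltW.
    rewrite invrK expr2 mulrA ler_wpM2r ?(ltW zp)// (le_trans _ (ltW zC))//.
    by rewrite mulrC ler_wpM2l ?(ltW zp)// lerDl.
  + by rewrite eqxx.
Unshelve. all: by end_near. Qed.

End bump.

Section bump_existence.
Context {R : realType}.

Lemma flat0_gt0 (t : R) : (0 < flat 0 t) = (0 < t).
Proof.
rewrite /flat; have [t0|t0] := ltP 0 t; first by rewrite /= hornerE mul1r expR_gt0.
by rewrite ltxx.
Qed.

Lemma exists_bump (c rho : R) : exists B : nat -> R -> R,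
  [/\ smooth_chain B, forall t, 0 <= B 0%N t,
      forall t, B 0%N t != 0 -> `|t - c| < rho
    & forall t, `|t - c| < rho -> 0 < B 0%N t].
Proof.
have sL := smooth_chain_affine 1 (rho - c) (@flat_smooth R).
have sR := smooth_chain_affine (-1) (rho + c) (@flat_smooth R).
have [B sB B0] := smooth_chainM sL sR.
have flat_ge0 t : 0 <= flat 0 t :> R.
  have [t0|t0] := ltP 0 t; first by rewrite ltW// flat0_gt0.
  by rewrite /flat ltNge t0.
have posE t : (0 < B 0%N t) = (`|t - c| < rho).
  rewrite B0 !expr0 !mul1r ltr_norml.
  have lE : (0 < t + (rho - c)) = (- rho < t - c) by apply/idP/idP; lra.
  have rE : (0 < -1 * t + (rho + c)) = (t - c < rho) by apply/idP/idP; lra.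
  rewrite -lE -rE -(flat0_gt0 (t + _)) -(flat0_gt0 (-1 * t + _)).
  have := flat_ge0 (t + (rho - c)); rewrite le_eqVlt => /orP[/eqP <-|h].
    by rewrite mul0r ltxx.
  by rewrite pmulr_rgt0// h.
have B_ge0 t : 0 <= B 0%N t by rewrite B0 !expr0 !mul1r mulr_ge0.
exists B; split => // t; last by rewrite posE.
by move=> Bt; rewrite -posE lt_neqAle eq_sym Bt B_ge0.
Qed.

End bump_existence.

(** * Finite differences on R^d *)

Section lines.
Context {R : realType} {d : nat}.
Implicit Types (f g : 'rV[R]_d -> R) (x v : 'rV[R]_d).

Lemma is_derive_line f x v (g : R -> R) (a df : R) :
  (forall h, f (h *: v + x) = g (h + a)) ->
  is_derive x v f df <-> is_derive a (1 : R) g df.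
Proof.
move=> fg; have fxE : f x = g a by have := fg 0; rewrite scale0r !add0r.
have qE : (fun h : R => h^-1 *: ((f \o shift x) (h *: v) - f x)) =
          (fun h : R => h^-1 *: ((g \o shift a) (h *: (1 : R)) - g a)).
  by apply/funext => h; rewrite /= fg fxE /GRing.scale/= mulr1.
by split=> -[df1 df2]; split; move: df1 df2; rewrite /derivable /derive qE.
Qed.

Definition unit_row (i : 'I_d) : 'rV[R]_d := delta_mx ord0 i.

Definition fdiff v f : 'rV[R]_d -> R := fun x => f (x + v) - f x.

Lemma iter_fdiff_line r v f x :
  iter r (fdiff v) f x = iter r (diff1 1) (fun s : R => f (s *: v + x)) 0.
Proof.
have gen s : iter r (fdiff v) f (s *: v + x) =
    iter r (diff1 1) (fun s : R => f (s *: v + x)) s.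
  elim: r s => //= r IHr s; rewrite /fdiff /diff1 -!IHr; congr (iter r (fdiff v) f _ - _).
  by rewrite scalerDl scale1r addrAC.
by have := gen 0; rewrite scale0r add0r.
Qed.

Lemma eq_iter_diff1 r (h a : R) (f g : R -> R) :
  (forall m : nat, (m <= r)%N -> f (a + m%:R * h) = g (a + m%:R * h)) ->
  iter r (diff1 h) f a = iter r (diff1 h) g a.
Proof.
elim: r f g => [|r IHr] f g fg; first by have := fg 0%N; rewrite mul0r addr0; apply.
rewrite !iterSr; apply: IHr => m mr; rewrite /diff1 fg ?leqW//.
have -> : a + m%:R * h + h = a + m.+1%:R * h by rewrite -natr1; ring.
by rewrite fg.
Qed.

Lemma continuous_fdiff v f : continuous f -> continuous (fdiff v f).
Proof.
by move=> cf x; apply: continuousB; [exact: continuous_translate|exact: cf].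
Qed.

Lemma compactly_supported_fdiff v f : compactly_supported f ->
  compactly_supported (fdiff v f).
Proof.
move=> csf; rewrite /fdiff; under eq_fun do rewrite -mulN1r.
apply: compactly_supportedD; last exact: compactly_supportedZ.
exact: compactly_supported_translate.
Qed.

(** Summation by parts, from the translation invariance of the integral. *)
Lemma Rintegral_iter_fdiff r v f g : continuous g -> compactly_supported f ->
  \int[lebesgue_row R d]_x (g x * iter r (fdiff (- v)) f x) =
  \int[lebesgue_row R d]_x (iter r (fdiff v) g x * f x).
Proof.
elim: r g => //= r IHr g cg csf.
have csi : compactly_supported (iter r (fdiff (- v)) f).
  by elim: (r) => //= n csn; exact: compactly_supported_fdiff.
set z := iter r (fdiff (- v)) f in csi *.
transitivity (\int[lebesgue_row R d]_x (fdiff v g x * z x)); last first.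
  by rewrite IHr; [rewrite -iterS iterSr|exact: continuous_fdiff|].
have csgz : compactly_supported (fun x => g x * z x) by exact: compactly_supportedM.
have csgvz : compactly_supported (fun x => g (x + v) * z x).
  by apply: compactly_supportedM => //; exact: continuous_translate.
have csgzv : compactly_supported (fun x => g x * z (x - v)).
  by apply: compactly_supportedM => //; exact: compactly_supported_translate.
transitivity (\int[lebesgue_row R d]_x (g x * z (x - v) - g x * z x)).
  by apply: eq_Rintegral => x _; rewrite /fdiff mulrBr.
transitivity (\int[lebesgue_row R d]_x (g (x + v) * z x - g x * z x)); last first.
  by apply: eq_Rintegral => x _; rewrite /fdiff mulrBl.
rewrite !RintegralB//; try exact: compactly_supported_integrable.
congr (_ - _); rewrite -(Rintegral_translate v csgzv).
by apply: eq_Rintegral => x _; rewrite addrK.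
Qed.

End lines.

(** * Test functions on boxes *)

Section boxes.
Context {R : realType} {d : nat}.

Definition box (c : 'rV[R]_d) (rho : R) : set 'rV[R]_d :=
  [set x | forall i, `|x ord0 i - c ord0 i| <= rho].

Lemma clamp_lipschitz (lo hi a b : R) :
  `|Num.max lo (Num.min a hi) - Num.max lo (Num.min b hi)| <= `|a - b|.
Proof.
wlog ba : a b / b <= a.
  by move=> wlog_le; have [/wlog_le//|/ltW/wlog_le] := leP b a; rewrite distrC [leRHS]distrC.
rewrite [leRHS]ger0_norm ?subr_ge0// ger0_norm; last first.
  by rewrite subr_ge0; apply: le_max2 => //; exact: le_min2.
rewrite lerBlDr ge_max; apply/andP; split.
  by apply: ler_wpDl; rewrite ?subr_ge0// le_max lexx.
have m1 : Num.min a hi <= a by rewrite ge_min lexx.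
have m2 : Num.min a hi <= hi by rewrite ge_min lexx orbT.
have m3 : Num.min a hi - (a - b) <= Num.min b hi.
  by rewrite le_min; apply/andP; split; lra.
have : Num.min b hi <= Num.max lo (Num.min b hi) by rewrite le_max lexx orbT.
move: (Num.min a hi) (Num.min b hi) (Num.max _ _) m3 => x y z; lra.
Qed.

Lemma compact_box c rho : compact (box c rho).
Proof.
rewrite (_ : box c rho = [set v | forall i, `[c ord0 i - rho, c ord0 i + rho]%classic (v ord0 i)]).
  apply: (@rV_compact R d (fun i => `[c ord0 i - rho, c ord0 i + rho]%classic)) => i.
  exact: segment_compact.
apply/seteqP; split=> x xB i; have := xB i; rewrite /= in_itv/= ler_norml => /andP[h1 h2];
  apply/andP; split; lra.
Qed.

Lemma closed_box c rho : closed (box c rho).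
Proof.
have cB := @compact_box c rho; exact: compact_closed (@norm_hausdorff _ _) cB.
Qed.

End boxes.

Section tensors.
Context {R : realType} {d : nat}.
Implicit Types (x y v : 'rV[R]_d) (B : 'I_d -> nat -> R -> R) (n : 'I_d -> nat).

(** Partial derivatives of a product of smooth functions of one variable each:
    [n i] is the order of derivation in the variable [i]. *)
Definition tensor B n x : R := \prod_i B i (n i) (x ord0 i).

Definition incr_order (i : 'I_d) n : 'I_d -> nat := fun j => ((i == j) + n j)%N.

Lemma unit_row_coord (i j : 'I_d) (h : R) x :
  (h *: unit_row i + x) ord0 j = h * (i == j)%:R + x ord0 j.
Proof. by rewrite !mxE eqxx /= eq_sym. Qed.

Section smooth.
Variable B : 'I_d -> nat -> R -> R.
Hypothesis sB : forall i, smooth_chain (B i).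

Lemma tensor_derive n i x :
  is_derive x (unit_row i) (tensor B n) (tensor B (incr_order i n) x).
Proof.
pose c := \prod_(j | j != i) B j (n j) (x ord0 j).
apply/(is_derive_line (g := fun s => B i (n i) s * c) (a := x ord0 i)) => [h|].
  rewrite /tensor (bigD1 i)//= unit_row_coord eqxx mulr1; congr (_ * _).
  apply: eq_bigr => j ji; rewrite unit_row_coord eq_sym (negbTE ji).
  by rewrite mulr0 add0r.
have -> : tensor B (incr_order i n) x = c * B i (n i).+1 (x ord0 i).
  rewrite /tensor (bigD1 i)//= mulrC /incr_order eqxx add1n; congr (_ * _).
  by apply: eq_bigr => j ji; rewrite eq_sym (negbTE ji).
have dc := is_deriveZ c (sB i (n i) (x ord0 i)).
rewrite (_ : (fun s => _) = c \*: B i (n i)) //.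
by apply/funext => s; rewrite /= mulrC.
Qed.

Lemma tensor_continuous n : continuous (tensor B n).
Proof.
move=> x; apply: (@cvg_big R _ *%R 1 xpredT mul_continuous _ (nbhs x)) => i _.
apply: (@continuous_comp _ _ _ (fun y : 'rV[R]_d => y ord0 i) (B i (n i))).
  exact: coord_continuous.
exact: smooth_chain_continuous.
Qed.

Lemma pderiv_tensor (s : seq 'I_d) n : exists m, pderiv s (tensor B n) = tensor B m.
Proof.
elim: s => [|i s [m sm]]; first by exists n.
exists (incr_order i m); apply/funext => x; rewrite /= -/(pderiv s _) sm.
by have [_ ->] := tensor_derive m i x.
Qed.

Lemma tensor_Cr r n : Cr_on r setT (tensor B n).
Proof.
move=> s x _; have [m sm] := pderiv_tensor s n; rewrite sm; split=> [_|_ i].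
  exact: tensor_continuous.
by have [] := tensor_derive m i x.
Qed.

End smooth.

Lemma iter_fdiff_tensor B i (h : R) r x :
  iter r (fdiff (h *: unit_row i)) (tensor B (fun=> 0%N)) x =
  tensor (fun j => if j == i then fun m : nat => iter r (diff1 h) (B j m) else B j) (fun=> 0%N) x.
Proof.
elim: r x => [|r IHr] x /=.
  by apply: eq_bigr => j _; case: ifP.
rewrite /fdiff !IHr /tensor (bigD1 i)//= [X in _ - X](bigD1 i)//= [RHS](bigD1 i)//=.
rewrite eqxx /diff1 mulrBl.
have -> : (x + h *: unit_row i) ord0 i = x ord0 i + h.
  by rewrite addrC unit_row_coord eqxx mulr1 addrC.
congr (_ * _ - _ * _); apply: eq_bigr => j ji; rewrite (negbTE ji)//.
by rewrite addrC unit_row_coord eq_sym (negbTE ji) mulr0 add0r.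
Qed.

Lemma test_function_box U phi (c : 'rV[R]_d) (rho : R) :
  (forall m, Cr_on m setT phi) ->
  box c rho `<=` U ->
  (forall x, phi x != 0 -> box c rho x) ->
  test_function U phi.
Proof.
move=> sphi BU phiB; set Bx := box c rho in BU *.
have cB : compact Bx by exact: compact_box.
have clB : closed Bx by exact: closed_box.
have sB : fsupport phi `<=` Bx.
  have -> : Bx = closure Bx by apply/closure_id.
  by apply: closureS => x /phiB.
split => //; last exact: subset_trans BU.
by apply: subclosed_compact cB sB; exact: closed_closure.
Qed.

End tensors.

Section oscillating_test_functions.
Context {R : realType} {d : nat}.
Local Notation leb := (lebesgue_row R d).

(** After summation by parts the differences fall on [g], and by the mean value
    theorem each of them gains a factor [h]. *)
Lemma Rintegral_Cr_fdiff r U g (c : 'rV[R]_d) (rho : R) (i : 'I_d) :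
  open U -> Cr_on r U g -> 0 <= rho ->
  box c rho `<=` U ->
  exists2 C : R, 0 <= C & forall (h : R) eta, 0 <= h -> compactly_supported eta ->
    (forall x, 0 <= eta x) ->
    (forall x s, eta x != 0 -> 0 <= s <= r%:R * h ->
      box c rho (s *: unit_row i + x)) ->
    (forall x, iter r (fdiff (- (h *: unit_row i))) eta x != 0 ->
      box c rho x) ->
    `|\int[leb]_x (g x * iter r (fdiff (- (h *: unit_row i))) eta x)| <=
      C * h ^+ r * \int[leb]_x eta x.
Proof.
move=> oU gU rho0 BU; set Bx := box c rho in BU *.
have cB : compact Bx by exact: compact_box.
pose F n := pderiv (nseq n i) g.
have [C C0 FC] : exists2 C : R, 0 <= C & forall x, Bx x -> `|F r x| <= C.
  have /compact_bounded[N [Nr Nb]] : compact (F r @` Bx).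
    apply: continuous_compact => //; apply: continuous_in_subspaceT => x.
    rewrite inE => /BU Ux; have [+ _] := gU (nseq r i) x Ux.
    by rewrite size_nseq; apply.
  exists (`|N| + 1) => [|x xB]; first by rewrite addr_ge0.
  by apply: Nb (F r x) _; [rewrite ltr_pwDr// ler_norm|exists x].
exists C => // h eta h0 cse eta0 supp_line supp_theta.
(* retracting onto the box extends [g] to a continuous function *)
pose cl (x : 'rV[R]_d) : 'rV[R]_d := \row_j Num.max (c ord0 j - rho) (Num.min (x ord0 j) (c ord0 j + rho)).
have clB x : Bx (cl x).
  move=> j; rewrite mxE ler_norml; apply/andP; split.
    by rewrite lerBrDl le_max lexx.
  by rewrite lerBlDl ge_max ge_min lexx orbT andbT; lra.
have clE x : Bx x -> cl x = x.
  move=> xB; apply/rowP => j; rewrite mxE; have := xB j; rewrite ler_norml => /andP[h1 h2].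
  by rewrite min_l ?max_r//; lra.
have cl_cont : continuous cl.
  move=> x A /nbhs_ballP[e /= e0 eA]; apply/nbhs_ballP; exists e => //= y.
  move=> /(row_ballP _ _ e0) xy; apply: eA; apply/row_ballP => // j.
  by rewrite !mxE; apply: le_lt_trans (xy j); exact: clamp_lipschitz.
pose G := g \o cl.
have cG : continuous G.
  move=> x; apply: continuous_comp; first exact: cl_cont.
  by have [+ _] := gU [::] _ (BU _ (clB x)); apply.
have -> : \int[leb]_x (g x * iter r (fdiff (- (h *: unit_row i))) eta x) =
    \int[leb]_x (iter r (fdiff (h *: unit_row i)) G x * eta x).
  rewrite -Rintegral_iter_fdiff//; apply: eq_Rintegral => x _.
  have [->|/supp_theta xB] := eqVneq (iter r (fdiff (- (h *: unit_row i))) eta x) 0.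
    by rewrite !mulr0.
  by rewrite /G /= clE.
have bound x : eta x != 0 -> `|iter r (fdiff (h *: unit_row i)) G x| <= C * h ^+ r.
  move=> ex; have lineB s : 0 <= s <= r%:R * h -> Bx (s *: unit_row i + x).
    by move=> sr j; exact: supp_line.
  pose f n (s : R) := F n (s *: unit_row i + x).
  have -> : iter r (fdiff (h *: unit_row i)) G x = iter r (diff1 h) (f 0%N) 0.
    rewrite iter_fdiff_line.
    have scale m a : iter m (diff1 1) (fun s => G (s *: (h *: unit_row i) + x)) a =
        iter m (diff1 h) (fun s => G (s *: unit_row i + x)) (a * h).
      elim: m a => [|m IHm] a /=; first by rewrite scalerA.
      by rewrite /diff1 !IHm mulrDl mul1r.
    rewrite scale mul0r; apply: eq_iter_diff1 => m mr; rewrite add0r /G /f /=.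
    by rewrite clE//; apply: lineB; rewrite mulr_ge0//= ler_wpM2r// ler_nat.
  apply: iter_diff1_le => // [n s nr|s]; rewrite add0r => sr; last exact/FC/lineB.
  have [_ /(_ _ i)] := gU (nseq n i) _ (BU _ (lineB _ sr)).
  rewrite size_nseq => /(_ nr) /derivableP dg.
  apply/(is_derive_line (f := F n) (x := s *: unit_row i + x) (v := unit_row i)) => //.
  by move=> k; rewrite /f scalerDl addrA.
have csGe : compactly_supported (fun x => iter r (fdiff (h *: unit_row i)) G x * eta x).
  apply: compactly_supportedM => //; elim: (r) => //= n; exact: continuous_fdiff.
have csCe : compactly_supported (fun x => C * h ^+ r * eta x) by exact: compactly_supportedZ.
have ie := compactly_supported_integrable cse.
rewrite -RintegralZl//; apply: (le_trans (le_normr_Rintegral _ _)) => //.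
  exact: compactly_supported_integrable.
apply: le_Rintegral => //.
- have csN : compactly_supported (fun x => `|iter r (fdiff (h *: unit_row i)) G x * eta x|).
    have [cGe [M GeM]] := csGe; split => [x|].
      have cN : continuous (fun z : R => `|z|) := @norm_continuous R R^o.
      exact: continuous_comp (cGe x) (cN _).
    by exists M => x; rewrite normr_eq0; exact: GeM.
  exact: compactly_supported_integrable csN.
- exact: compactly_supported_integrable csCe.
move=> x _; have [->|ex] := eqVneq (eta x) 0; first by rewrite !mulr0 normr0.
by rewrite normrM (ger0_norm (eta0 x)) ler_wpM2r// bound.
Qed.

End oscillating_test_functions.

(** * Test functions adapted to a wavelet *)

Section difference_supports.
Context {R : realType}.
Implicit Types (f : R -> R).

Lemma iter_diff1_neq0 r (h t : R) f : iter r (diff1 h) f t != 0 ->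
  exists2 m : nat, (m <= r)%N & f (t + m%:R * h) != 0.
Proof.
move=> nz; apply: contrapT => nm; move/eqP: nz; apply.
rewrite (@eq_iter_diff1 _ r h t f (fun=> 0)) => [|m mr]; last first.
  by apply/eqP/negP => /negP fm; apply: nm; exists m.
elim: r {nm} t => //= r IHr t; by rewrite /diff1 !IHr subrr.
Qed.

Lemma iter_diff1_left r (h A t : R) f : 0 < h -> (forall s, s < A -> f s = 0) ->
  t - h < A -> iter r (diff1 (- h)) f t = (-1) ^+ r * f t.
Proof.
move=> h0 fA tA; suff [_ ->//] : (forall s, s < A -> iter r (diff1 (- h)) f s = 0) /\
    (forall s, s - h < A -> iter r (diff1 (- h)) f s = (-1) ^+ r * f s).
elim: r => [|r [IH0 IH1]]; first by split=> // s _; rewrite mul1r.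
split=> s sA /=; rewrite /diff1.
  by rewrite IH0 ?IH0 ?subrr//; lra.
by rewrite (IH0 (s - h))// (IH1 _ sA) sub0r exprS mulN1r mulNr.
Qed.

End difference_supports.

Section positive_integral.
Context {R : realType} {d : nat}.
Local Notation leb := (lebesgue_row R d).

Lemma Rintegral_gt0 (f : 'rV[R]_d -> R) x0 : compactly_supported f ->
  (forall x, 0 <= f x) -> 0 < f x0 -> 0 < \int[leb]_x f x.
Proof.
move=> csf f0 fx0; have [cf _] := csf.
have c0 : 0 < f x0 / 2 by rewrite divr_gt0.
have /open_rowP/(_ x0) : open (f @^-1` `]f x0 / 2, +oo[).
  by move/continuousP : cf; apply; exact: interval_open.
rewrite /= in_itv/= andbT => /(_ _)[|e e0 eU]; first lra.
pose Q : set 'rV[R]_d := [set v | forall i, `]x0 ord0 i - e, x0 ord0 i + e[%classic (v ord0 i)].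
have mI i : measurable (`]x0 ord0 i - e, x0 ord0 i + e[%classic : set R).
  exact: measurable_itv.
have mQ : measurable Q.
  rewrite (_ : Q = \bigcap_(i in [set: 'I_d])
      ((fun x : 'rV[R]_d => x ord0 i) @^-1` `]x0 ord0 i - e, x0 ord0 i + e[%classic)).
    apply: fin_bigcap_measurable => // i _; rewrite -[X in measurable X]setTI.
    exact: measurable_coord.
  by apply/seteqP; split=> v vQ i; [move=> _|]; exact: vQ.
have lebQ : leb Q = (\prod_(i < d) (e + e)%:E)%E.
  rewrite (@lebesgue_row_box R d (fun i => `]x0 ord0 i - e, x0 ord0 i + e[%classic))//.
  apply: eq_bigr => i _.
  rewrite lebesgue_measure_itv/= lte_fin ifT; last by lra.
  by rewrite -EFinB; congr (_%:E); ring.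
have Q0 : (0 < leb Q)%E.
  by rewrite lebQ prodEFin lte_fin; apply: prodr_gt0 => i _; exact: addr_gt0.
have fQ x : Q x -> f x0 / 2 <= f x.
  move=> xQ; apply: ltW; have := eU x; rewrite /= in_itv/= andbT; apply => i.
  have := xQ i; rewrite /= in_itv/= => /andP[h1 h2].
  by rewrite ltr_norml; apply/andP; split; lra.
have if_ := compactly_supported_integrable csf.
rewrite /Rintegral fine_gt0//; apply/andP; split; last first.
  by rewrite -ge0_fin_numE ?integrable_fin_num//; apply: integral_ge0 => x _; rewrite lee_fin.
apply: (@lt_le_trans _ _ (\int[leb]_x ((f x0 / 2) * \1_Q x)%:E)%E).
  under eq_integral do rewrite EFinM.
  rewrite ge0_integralZl//; last 2 first.
  - by apply/measurable_EFinP; exact: measurable_indic.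
  - by rewrite lee_fin ltW.
  by rewrite integral_indic// setIT mule_gt0// lte_fin.
apply: ge0_le_integral => //.
- by move=> x _; rewrite lee_fin mulr_ge0// ltW.
- by apply/measurable_EFinP; apply: measurable_funM => //; exact: measurable_indic.
- by case/integrableP : if_.
move=> x _; rewrite lee_fin indicE; have [xQ|xQ] := pselect (Q x).
  by rewrite mem_set// mulr1 fQ.
by rewrite memNset// mulr0.
Qed.

End positive_integral.

Section wavelet_test_functions.
Context {R : realType} {d : nat}.
Variables (Psi : 'rV[R]_d -> R) (M : R) (y0 : 'rV[R]_d) (i0 : 'I_d) (r : nat).
Hypotheses (cPsi : continuous Psi) (suppPsi : forall y, Psi y != 0 -> in_box M y)
  (Psi_y0 : Psi y0 != 0).
Local Notation leb := (lebesgue_row R d).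

(** At frequency [L] and position [k], [theta] is an [r]-th difference, so its
    integral against C^r functions is small, of order [L ^- r] relatively to the
    mass of the bump [eta]. Its step [H / L] exceeds the support of the rescaled
    [Psi], which meets only one term of the difference; the integral of [theta]
    against [Psi] is thus comparable to that mass. *)
Lemma exists_wavelet_test : exists (H rho c0 : R)
    (eta : R -> 'rV[R]_d -> 'rV[R]_d -> R), [/\ 0 < H, 0 < c0 &
  forall (L : R) (k : 'rV[R]_d), 0 < L ->
  let theta := iter r (fdiff (- ((H / L) *: unit_row i0))) (eta L k) in
  [/\ [/\ compactly_supported (eta L k), forall x, 0 <= eta L k x,
          0 < \int[leb]_x eta L k x,
          forall n, Cr_on n setT theta
        & compactly_supported theta],
      forall x s, eta L k x != 0 -> 0 <= s <= r%:R * (H / L) ->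
        box (L^-1 *: k) (rho / L) (s *: unit_row i0 + x),
      forall x, theta x != 0 -> box (L^-1 *: k) (rho / L) x
    & c0 * \int[leb]_x eta L k x <=
      `|\int[leb]_x (Psi (L *: x - k) * theta x)|]].
Proof.
have Py0 : 0 < `|Psi y0| / 2 by rewrite divr_gt0// normr_gt0.
have /open_rowP/(_ y0) : open (Psi @^-1` (ball (Psi y0) (`|Psi y0| / 2))).
  by move/continuousP : cPsi; apply; exact: ball_open.
move=> /(_ (ballxx _ Py0))[e e0 eP].
have [b bP] := choice (fun i : 'I_d => exists_bump (y0 ord0 i) e).
pose M1 : R := \sum_i `|y0 ord0 i| + e.
have bM1 i (t : R) : b i 0%N t != 0 -> `|t| <= M1.
  move=> bt; have [_ _ /(_ t bt) h _] := bP i.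
  have : `|y0 ord0 i| <= \sum_i `|y0 ord0 i| by rewrite (bigD1 i)//= lerDl sumr_ge0.
  have := ler_normB (t - y0 ord0 i) (- y0 ord0 i); rewrite opprK subrK normrN /M1; lra.
pose H : R := `|M| + M1 + 1.
have H0 : 0 < H.
  by rewrite ltr_wpDl// addr_ge0// addr_ge0 ?(ltW e0)// sumr_ge0.
pose B (L : R) (k : 'rV[R]_d) (i : 'I_d) (n : nat) (t : R) : R := L ^+ n * b i n (L * t + - k ord0 i).
have sB L k i : smooth_chain (B L k i).
  by have [sb _ _ _] := bP i; exact: smooth_chain_affine.
have BE L k i t : B L k i 0%N t = b i 0%N (L * t - k ord0 i) by rewrite /B expr0 mul1r.
pose eta (L : R) (k : 'rV[R]_d) := tensor (B L k) (fun=> 0%N).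
exists H, (M1 + r%:R * H), (`|Psi y0| / 2), eta; split=> // L k L0 theta.
set h := H / L in theta *.
have h0 : 0 < h by exact: divr_gt0.
have Lh : L * h = H by rewrite mulrC divfK// gt_eqF.
have eta_supp (x : 'rV[R]_d) : eta L k x != 0 -> forall i, `|L * x ord0 i - k ord0 i| <= M1.
  move=> ex i; apply: (bM1 i); apply: contra ex => /eqP bi.
  by rewrite /eta /tensor (bigD1 i)//= BE bi mul0r.
have boxE (x : 'rV[R]_d) (z : R) : (forall i, `|L * x ord0 i - k ord0 i| <= z) -> box (L^-1 *: k) (z / L) x.
  move=> xz i; rewrite !mxE ler_pdivlMr// -{2}(gtr0_norm L0) -normrM.
  by rewrite mulrBl mulrC mulrAC mulVf ?gt_eqF// mul1r.
have thetaE x : theta x = tensor (fun j => if j == i0 then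
    fun m : nat => iter r (diff1 (- h)) (B L k j m) else B L k j) (fun=> 0%N) x.
  by rewrite /theta -scaleNr iter_fdiff_tensor.
have thetaE' := funext thetaE.
have theta_supp (x : 'rV[R]_d) : theta x != 0 -> forall i, `|L * x ord0 i - k ord0 i| <= M1 + r%:R * H.
  rewrite thetaE => tx i.
  have : (if i == i0 then fun m : nat => iter r (diff1 (- h)) (B L k i m) else B L k i)
      0%N (x ord0 i) != 0.
    by apply: contra tx => /eqP bi; rewrite /tensor (bigD1 i)//= bi mul0r.
  have rH0 : 0 <= r%:R * H by rewrite mulr_ge0// ltW.
  case: ifP => _; last by rewrite BE => /(bM1 i); lra.
  move=> /iter_diff1_neq0[m mr]; rewrite BE => /(bM1 i).
  rewrite mulrDr mulrN mulrN mulrCA Lh => bm.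
  have mH : 0 <= m%:R * H by rewrite mulr_ge0// ltW.
  have mrH : m%:R * H <= r%:R * H by rewrite ler_wpM2r ?ler_nat// ltW.
  by move: bm; rewrite !ler_norml => /andP[h1 h2]; apply/andP; split; lra.
have eta_cont : continuous (eta L k) by exact: tensor_continuous.
have box_in_box (x : 'rV[R]_d) (z : R) : box (L^-1 *: k) z x ->
    in_box (z + \sum_i `|(L^-1 *: k) ord0 i|) x.
  move=> xz i; have := xz i.
  have : `|(L^-1 *: k) ord0 i| <= \sum_i `|(L^-1 *: k) ord0 i|.
    by rewrite (bigD1 i)//= lerDl sumr_ge0.
  have := ler_normD (x ord0 i - (L^-1 *: k) ord0 i) ((L^-1 *: k) ord0 i).
  by rewrite subrK; lra.
have cs_eta : compactly_supported (eta L k).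
  split=> //; exists (M1 / L + \sum_i `|(L^-1 *: k) ord0 i|) => x /eta_supp/boxE.
  exact: box_in_box.
have eta0 x : 0 <= eta L k x.
  by apply: prodr_ge0 => i _; rewrite BE; have [_ + _ _] := bP i; exact.
have s_theta i : smooth_chain (if i == i0 then
    fun m : nat => iter r (diff1 (- h)) (B L k i m) else B L k i).
  by case: ifP => _ //; exact: smooth_chain_diff1.
have int_eta : 0 < \int[leb]_x eta L k x.
  apply: (Rintegral_gt0 (x0 := L^-1 *: (y0 + k))) => //.
  apply: prodr_gt0 => i _; rewrite BE !mxE mulVKf ?gt_eqF// addrK.
  by have [_ _ _ ->//] := bP i; rewrite subrr normr0.
have cs_theta : compactly_supported theta.
  by rewrite /theta; elim: (r) => //= n; exact: compactly_supported_fdiff.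
split.
- split=> // n; rewrite thetaE'; exact: tensor_Cr.
- move=> x s /eta_supp ex /andP[s0 sr]; apply: boxE => i.
  rewrite unit_row_coord mulrDr.
  have Ls : 0 <= L * (s * (i0 == i)%:R) <= r%:R * H.
    case: eqP => _; rewrite ?mulr1 ?mulr0.
      rewrite mulr_ge0 ?(ltW L0)//=.
      by apply: (le_trans (ler_wpM2l (ltW L0) sr)); rewrite mulrCA Lh.
    by rewrite lexx mulr_ge0// ltW.
  have := ex i; rewrite !ler_norml => /andP[h1 h2].
  by move: Ls => /andP[h3 h4]; apply/andP; split; lra.
- by move=> x /theta_supp/boxE.
- have PtE x : Psi (L *: x - k) * theta x = (-1) ^+ r * (Psi (L *: x - k) * eta L k x).
    have [->|Px] := eqVneq (Psi (L *: x - k)) 0; first by rewrite !mul0r mulr0.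
    rewrite mulrCA; congr (_ * _); rewrite thetaE /eta /tensor.
    rewrite (bigD1 i0)//= eqxx [in RHS](bigD1 i0)//= mulrA; congr (_ * _); last first.
      by apply: eq_bigr => j /negbTE ->.
    apply: (@iter_diff1_left _ r h ((k ord0 i0 - M1) / L)) => // [s|].
      rewrite ltr_pdivlMr// mulrC => sL; rewrite BE; apply/eqP/negP => /negP/(bM1 i0).
      by rewrite ler_norml => /andP[h1 _]; lra.
    have := suppPsi Px i0; rewrite !mxE ler_norml => /andP[_ h2].
    rewrite ltr_pdivlMr// mulrBl [h * L]mulrC Lh /H mulrC.
    by have := ler_norm M; lra.
  have Psi_eta x : `|Psi y0| / 2 * eta L k x <=
      Num.sg (Psi y0) * (Psi (L *: x - k) * eta L k x).
    rewrite mulrA; have [->|ex] := eqVneq (eta L k x) 0; first by rewrite !mulr0.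
    apply: ler_wpM2r => //.
    have : ball (Psi y0) (`|Psi y0| / 2) (Psi (L *: x - k)).
      apply: (eP (L *: x - k)) => i; rewrite distrC !mxE; have [_ _ + _] := bP i; apply.
      apply: contra ex => /eqP bi.
      by rewrite /eta /tensor (bigD1 i)//= BE bi mul0r.
    rewrite /ball/= ltr_norml => /andP[h1 h2].
    have [P0|P0] := ltP 0 (Psi y0); first by rewrite gtr0_sg// gtr0_norm// in h1 h2 *; lra.
    have P0' : Psi y0 < 0 by rewrite lt_neqAle Psi_y0.
    by rewrite ltr0_sg// ltr0_norm// in h1 h2 *; lra.
  have csPe : compactly_supported (fun x => Psi (L *: x - k) * eta L k x).
    apply: compactly_supportedM => // x.
    have cA : {for x, continuous (fun x : 'rV[R]_d => L *: x - k)}.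
      by apply: (continuousB (f := fun x => L *: x)); [exact: scaler_continuous|exact: cst_continuous].
    by move=> A /cPsi/cA.
  have -> : `|\int[leb]_x (Psi (L *: x - k) * theta x)| =
      `|\int[leb]_x (Psi (L *: x - k) * eta L k x)|.
    under eq_Rintegral do rewrite PtE.
    rewrite RintegralZl//; last exact: compactly_supported_integrable csPe.
    by rewrite normrM normrX normrN1 expr1n mul1r.
  rewrite -RintegralZl//; last exact: compactly_supported_integrable.
  apply: (@le_trans _ _ (\int[leb]_x (Num.sg (Psi y0) * (Psi (L *: x - k) * eta L k x)))).
    apply: le_Rintegral => //.
    + exact: compactly_supported_integrable (compactly_supportedZ _ cs_eta).
    + exact: compactly_supported_integrable (compactly_supportedZ _ csPe).
  rewrite RintegralZl//; last exact: compactly_supported_integrable csPe.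
  apply: (le_trans (ler_norm _)); rewrite normrM normr_sg Psi_y0 mul1r.
  exact: lexx.
Qed.

End wavelet_test_functions.

(** * Independence and small balls *)

Section independence.
Context {R : realType} {d : nat} {disp : measure_display}
  {Omega : measurableType disp} {P : probability Omega R} {I : choiceType}.
Variables (X : I -> {RV P >-> R}) (T : Omega -> nat -> 'rV[int]_d -> Prop).
Hypotheses (mT : forall n l, measurable [set w | T w n l])
  (iX : mutually_independent X) (iXT : independent_of_tree X T).
Variable i0 : I.

(** A pi-system, which generates the sigma-algebra of the tree and of all the
    [X i] but [X i0]. *)
Definition other_events : set (set Omega) :=
  [set E | exists (s : seq I) (B : I -> set R) (ns : seq (node d)),
    [/\ i0 \notin s, forall i, measurable (B i) &
        E = \big[setI/setT]_(i <- s) (X i @^-1` B i) `&`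
            \big[setI/setT]_(n <- ns) [set w | T w n.1 n.2]]].

Lemma other_events_measurable : other_events `<=` measurable.
Proof.
move=> _ [s [B [ns [_ mB ->]]]]; apply: measurableI; apply: bigsetI_measurable => i _.
  exact: measurable_funPTI.
exact: mT.
Qed.

Lemma other_events_setI : setI_closed other_events.
Proof.
move=> _ _ [s [B [ns [nis mB ->]]]] [s' [B' [ns' [nis' mB' ->]]]].
exists (s ++ s'), (fun i => (if i \in s then B i else setT) `&`
                           (if i \in s' then B' i else setT)), (ns ++ ns').
split=> [|i|].
- by rewrite mem_cat negb_or nis.
- by apply: measurableI; case: ifP.
- rewrite -!bigcap_seq; apply/seteqP; split=> w.
    move=> [[ws wns] [ws' wns']]; split=> [i _|n /=].
      by split; case: ifP => // im; [exact: ws|exact: ws'].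
    by rewrite mem_cat => /orP[]; [exact: wns|exact: wns'].
  move=> [wss wnn]; split; split=> i /= im.
  + by have := (wss i); rewrite /= mem_cat im => /(_ isT)[].
  + by apply: wnn; rewrite /= mem_cat im.
  + by have := (wss i); rewrite /= mem_cat im orbT => /(_ isT)[_].
  + by apply: wnn; rewrite /= mem_cat im orbT.
Qed.

Lemma other_events_setT : other_events setT.
Proof.
by exists [::], (fun=> setT), [::]; split=> //; rewrite !big_nil setIT.
Qed.

Let prob_pi (A : set R) E : measurable A -> other_events E ->
  P (E `&` X i0 @^-1` A) = (P (X i0 @^-1` A) * P E)%E.
Proof.
move=> mA [s [B [ns [nis mB ->]]]].
have mAB i : measurable (if i == i0 then A else B i) by case: ifP.
have congrB (u : seq I) : i0 \notin u ->
    \big[setI/setT]_(i <- u) (X i @^-1` (if i == i0 then A else B i)) =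
    \big[setI/setT]_(i <- u) (X i @^-1` B i).
  move=> iu; rewrite big_seq [RHS]big_seq; apply: eq_bigr => i iu'.
  by rewrite ifF//; apply/negbTE; apply: contra iu => /eqP <-.
have -> : \big[setI/setT]_(i <- s) (X i @^-1` B i) =
    \big[setI/setT]_(i <- undup s) (X i @^-1` (if i == i0 then A else B i)).
  rewrite congrB ?mem_undup// -!bigcap_seq.
  by apply/seteqP; split=> w ws i /= h; apply: ws; rewrite /= ?mem_undup// -mem_undup.
set ET := \big[setI/setT]_(n <- ns) _.
have iu : i0 \notin undup s by rewrite mem_undup.
have -> : \big[setI/setT]_(i <- undup s) (X i @^-1` (if i == i0 then A else B i)) `&` ET `&`
    X i0 @^-1` A =
    \big[setI/setT]_(i <- i0 :: undup s) (X i @^-1` (if i == i0 then A else B i)) `&` ET.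
  by rewrite big_cons eqxx setIC setIA.
rewrite (iXT (i0 :: undup s) ns mAB) (iXT (undup s) ns mAB) !iX//=; last 2 first.
- by rewrite undup_uniq.
- by rewrite iu undup_uniq.
by rewrite big_cons eqxx muleA.
Qed.

Lemma prob_indep (A : set R) E : measurable A -> <<s other_events >> E ->
  P (E `&` X i0 @^-1` A) = (P (X i0 @^-1` A) * P E)%E.
Proof.
move=> mA sE; have mXA : measurable (X i0 @^-1` A) by exact: measurable_funPTI.
have fXA : P (X i0 @^-1` A) \is a fin_num by exact: fin_num_measure.
have pXA : 0 <= fine (P (X i0 @^-1` A)) by exact: fine_ge0.
pose m1 := mrestr P mXA.
pose m2 := mscale (NngNum pXA) P.
have -> : P (E `&` X i0 @^-1` A) = m1 E by [].
have -> : (P (X i0 @^-1` A) * P E)%E = m2 E by rewrite /m2 /mscale/= fineK.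
apply: (@g_sigma_algebra_measure_unique _ _ _ other_events other_events_measurable
  (fun=> setT) _ _ m1 m2) => //.
- by move=> _; exact: other_events_setT.
- by rewrite bigcup_const//; exists 0%N.
- exact: other_events_setI.
- move=> F FG; rewrite /= /mscale/= fineK//; exact: prob_pi.
- by move=> _; rewrite /= /mrestr setTI -ge0_fin_numE.
Qed.

(** On the event that [Y] lies between [z e] and [(z + 1) e], for an integer [z],
    the inequality confines [X i0] to an interval of length [3 e / |a|] that depends on
    [z] only. As these events are independent of [X i0], summing over [z] replaces
    an integration over the law of [Y]. *)
Lemma small_ball (c a e : R) (Y : g_sigma_algebraType other_events -> R) E :
  0 <= c ->
  (forall A : set R, measurable A -> (P (X i0 @^-1` A) <= c%:E * lebesgue_measure A)%E) ->
  a != 0 -> 0 < e -> measurable_fun setT Y -> <<s other_events >> E ->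
  (P (E `&` [set w | (`|a * X i0 w + Y w| <= e)%R]) <= P E * (c * (3 * e / `|a|))%:E)%E.
Proof.
move=> c0 cX a0 e0 mY sE.
have sm := smallest_sub (@sigma_algebra_measurable _ Omega) other_events_measurable.
have mE : measurable E by exact: sm.
pose En (z : int) : set Omega := E `&` [set w | z%:~R * e <= Y w < (z%:~R + 1) * e].
have sEn z : <<s other_events >> (En z).
  have := @measurableI _ (g_sigma_algebraType other_events) E.
  apply; first exact: sE.
  rewrite (_ : [set w | _] = Y @^-1` `[z%:~R * e, (z%:~R + 1) * e[); last first.
    by apply/seteqP; split=> w /=; rewrite in_itv.
  by rewrite -[X in measurable X]setTI; apply: mY => //; exact: measurable_itv.
have na0 : 0 < `|a| by rewrite normr_gt0.
pose dl := 3 / 2 * e / `|a|.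
pose m (z : int) := - ((z%:~R + 2^-1) * e) / a.
pose An (z : int) : set R := `[m z - dl, m z + dl]%classic.
have subAn z : En z `&` [set w | `|a * X i0 w + Y w| <= e] `<=`
    En z `&` X i0 @^-1` An z.
  move=> w [Ez /= le_e]; split => //; move: Ez => [_ /= /andP[Y1 Y2]].
  rewrite /An/= in_itv/= -ler_distl -(ler_pM2l na0) -normrM.
  have -> : `|a| * dl = 3 / 2 * e by rewrite mulrC divfK ?gt_eqF.
  have -> : a * (X i0 w - m z) = a * X i0 w + (z%:~R + 2^-1) * e.
    by rewrite mulrBr mulrC /m [a * (_ / a)]mulrCA divff// mulr1 opprK mulrC.
  by move: le_e; rewrite !ler_norml => /andP[h1 h2]; apply/andP; split; lra.
have mAn z : measurable (An z) by exact: measurable_itv.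
have lebAn z : lebesgue_measure (An z) = (3 * e / `|a|)%:E.
  have dl0 : 0 < dl by rewrite divr_gt0// mulr_gt0// divr_gt0.
  rewrite lebesgue_measure_itv/= lte_fin ifT; last by lra.
  by rewrite -EFinB /dl; congr (_%:E); field; rewrite gt_eqF.
have mEe : measurable [set w | `|a * X i0 w + Y w| <= e].
  have mYd : measurable_fun setT (Y : Omega -> R).
    by move=> _ B mB; rewrite setTI; apply: sm; rewrite -[X in <<s _ >> X]setTI; exact: mY.
  have mS : measurable_fun setT (fun w => `|a * X i0 w + Y w|).
    apply: measurableT_comp => //; apply: measurable_funD => //.
    exact: measurable_funM.
  rewrite (_ : [set w | _] = (fun w => `|a * X i0 w + Y w|) @^-1` `]-oo, e]).
    by rewrite -[X in measurable X]setTI; apply: mS => //; exact: measurable_itv.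
  by apply/seteqP; split=> w /=; rewrite in_itv.
have PEn z : (P (En z `&` [set w | (`|a * X i0 w + Y w| <= e)%R]) <=
    P (En z) * (c * (3 * e / `|a|))%:E)%E.
  apply: (@le_trans _ _ (P (En z `&` X i0 @^-1` An z))).
    have mEn : measurable (En z) by exact: sm (sEn z).
    apply: le_measure => //; rewrite inE; first exact: measurableI.
    by apply: measurableI => //; exact: measurable_funPTI.
  rewrite prob_indep// muleC; apply: lee_wpmul2l; first exact: measure_ge0.
  by rewrite EFinM -(lebAn z); exact: cX.
pose F n := if pickle_inv n is Some z then En z else set0.
have sF n : <<s other_events >> (F n).
  rewrite /F; case: (pickle_inv n) => // ; exact: (@measurable0 _ (g_sigma_algebraType other_events)).
have mF n : measurable (F n) by exact: sm (sF n).
have tF : trivIset setT F.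
  apply/trivIsetP => n n' _ _ nn'; rewrite /F.
  case nE : (pickle_inv n) => [z|]; last by rewrite set0I.
  case n'E : (pickle_inv n') => [z'|]; last by rewrite setI0.
  rewrite -subset0 => w [[_ /= /andP[z1 z2]] [_ /= /andP[z1' z2']]].
  have lt1 : z%:~R < (z' + 1)%:~R :> R.
    by rewrite intrD -(ltr_pM2r e0) (le_lt_trans z1).
  have lt2 : z'%:~R < (z + 1)%:~R :> R.
    by rewrite intrD -(ltr_pM2r e0) (le_lt_trans z1').
  have zz' : z = z'.
    by move: lt1 lt2; rewrite !ltr_int !ltzD1 => h1 h2; apply/eqP; rewrite eq_le h1.
  move/eqP: nn'; apply; have := @pickle_invK int n; have := @pickle_invK int n'.
  by rewrite nE n'E /= zz' => <- <-.
have UF : E = \bigcup_n F n.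
  apply/seteqP; split=> w; last by move=> [n _]; rewrite /F; case: pickle_inv => // z [].
  move=> Ew; pose z := Num.floor (Y w / e).
  have Fz : F (pickle z) w.
    rewrite /F pickleK_inv; split; first exact: Ew.
    have := floor_itv (Y w / e); rewrite intrD -/z => /andP[z1 z2] /=.
    by rewrite -ler_pdivlMr// z1 -ltr_pdivrMr.
  by exists (pickle z); [exact: Logic.I|exact: Fz].
apply: (@le_trans _ _ (\sum_(0 <= n <oo) P (F n `&` [set w | (`|a * X i0 w + Y w| <= e)%R]))%E).
  apply: measure_sigma_subadditive => //.
  - by move=> n; exact: measurableI.
  - exact: measurableI.
  - by rewrite -setI_bigcupl -UF.
have -> : P E = (\sum_(0 <= n <oo) P (F n))%E.
  by rewrite UF measure_bigcup//; apply: eq_eseriesl => n; rewrite in_setT.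
rewrite muleC -nneseriesZl//.
apply: lee_nneseries => [n _ _|n _]; first exact: measure_ge0.
rewrite muleC /F; case: (pickle_inv n) => [z|]; first exact: PEn.
by rewrite set0I measure0 mul0e.
Qed.

End independence.

(** * Sums and dilations of C^r functions *)

Section Cr_closure.
Context {R : realType} {d : nat}.
Implicit Types (f g : 'rV[R]_d -> R) (U : set 'rV[R]_d).

Lemma sub_Cr_on r U U' f : U' `<=` U -> Cr_on r U f -> Cr_on r U' f.
Proof. by move=> UU' fr s x /UU'; exact: fr. Qed.

Lemma is_derive_affine_row f (c L df : R) (k x v : 'rV[R]_d) :
  is_derive (L *: x - k) v f df ->
  is_derive x v (fun x => c * f (L *: x - k)) (c * (L * df)).
Proof.
set y := L *: x - k => dfy.
have dfl : is_derive (0 : R) 1 (fun h => f (h *: v + y)) df.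
  by apply/(is_derive_line (f := f) (x := y) (v := v)) => // h; rewrite addr0.
have dL : is_derive (0 : R) 1 (fun h => f ((L * h + 0) *: v + y)) (L * df).
  by apply: (is_derive_affine (f := fun h => f (h *: v + y))); rewrite mulr0 addr0.
apply/(is_derive_line (g := fun h => c * f ((L * h + 0) *: v + y)) (a := 0)).
by move=> h; congr (_ * f _); rewrite !addr0 /y scalerDr scalerA addrA.
Qed.

Lemma pderiv_affine r f (c L : R) (k : 'rV[R]_d) (s : seq 'I_d) :
  Cr_on r setT f -> (size s <= r)%N ->
  pderiv s (fun x => c * f (L *: x - k)) =
  fun x => c * L ^+ size s * pderiv s f (L *: x - k).
Proof.
move=> fr; elim: s => [|i s IHs] sr; first by rewrite /= expr0 mulr1.
apply/funext => x; rewrite /= -!/(pderiv s _) IHs ?(ltnW sr)//.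
have [_ /(_ sr i) /derivableP df] := fr s (L *: x - k) Logic.I.
by have [_ ->] := is_derive_affine_row (c * L ^+ size s) df; rewrite exprSr; ring.
Qed.

Lemma continuous_affine f (c L : R) (k x : 'rV[R]_d) :
  {for L *: x - k, continuous f} ->
  {for x, continuous (fun x : 'rV[R]_d => c * f (L *: x - k))}.
Proof.
move=> cf; apply: continuousM; first exact: cst_continuous.
have cA : {for x, continuous (fun x : 'rV[R]_d => L *: x - k)}.
  by apply: (continuousB (f := fun x => L *: x)); [exact: scaler_continuous|exact: cst_continuous].
by move=> A /cf/cA.
Qed.

Lemma Cr_on_affine r f (c L : R) (k : 'rV[R]_d) : Cr_on r setT f ->
  Cr_on r setT (fun x => c * f (L *: x - k)).
Proof.
move=> fr s x _; have [cf df] := fr s (L *: x - k) Logic.I; split=> [sr|sr i].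
  by rewrite (pderiv_affine _ _ _ fr sr); apply: continuous_affine; exact: cf.
rewrite (pderiv_affine _ _ _ fr (ltnW sr)).
by have [] := is_derive_affine_row (c * L ^+ size s) (derivableP (df sr i)).
Qed.

Lemma pderivD r f g (s : seq 'I_d) : Cr_on r setT f -> Cr_on r setT g ->
  (size s <= r)%N ->
  pderiv s (fun x => f x + g x) = fun x => pderiv s f x + pderiv s g x.
Proof.
move=> fr gr; elim: s => // i s IHs sr.
apply/funext => x; rewrite /= -!/(pderiv s _) IHs ?(ltnW sr)//.
have [_ /(_ sr i) /derivableP df] := fr s x Logic.I.
have [_ /(_ sr i) /derivableP dg] := gr s x Logic.I.
by have [_ ->] := is_deriveD df dg.
Qed.

Lemma Cr_onD r f g : Cr_on r setT f -> Cr_on r setT g ->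
  Cr_on r setT (fun x => f x + g x).
Proof.
move=> fr gr s x _; have [cf df] := fr s x Logic.I; have [cg dg] := gr s x Logic.I.
split=> [sr|sr i].
  by rewrite (pderivD fr gr sr); apply: continuousD; [exact: cf|exact: cg].
rewrite (pderivD fr gr (ltnW sr)).
by have [] := is_deriveD (derivableP (df sr i)) (derivableP (dg sr i)).
Qed.

Lemma Cr_on0 r : Cr_on r setT ((fun=> 0) : 'rV[R]_d -> R).
Proof.
have E (s : seq 'I_d) : pderiv s (fun=> 0 : R) = cst 0 :> ('rV[R]_d -> R).
  elim: s => // i s IHs; apply/funext => x; rewrite /= -/(pderiv s _) IHs.
  by rewrite derive_cst.
by move=> s x _; rewrite E; split=> [_|_ i]; [exact: cst_continuous|exact: derivable_cst].
Qed.

Lemma Cr_on_sum r (I : Type) (s : seq I) (F : I -> 'rV[R]_d -> R) :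
  (forall i, Cr_on r setT (F i)) -> Cr_on r setT (fun x => \sum_(i <- s) F i x).
Proof.
move=> Fr; elim: s => [|i s IHs].
  rewrite (_ : (fun _ => _) = fun=> 0); first exact: Cr_on0.
  by apply/funext => x; rewrite big_nil.
rewrite (_ : (fun _ => _) = fun x => F i x + \sum_(j <- s) F j x).
  exact: Cr_onD.
by apply/funext => x; rewrite big_cons.
Qed.

Lemma Cr_on_continuous r f : Cr_on r setT f -> continuous f.
Proof. by move=> fr x; have [+ _] := fr [::] x Logic.I; apply. Qed.

Lemma gen_eq_on_stationary U (S : ('rV[R]_d -> R)^nat) J0 :
  (forall J x, (J0 <= J)%N -> U x -> S J x = S J0 x) -> gen_eq_on U S (S J0).
Proof.
move=> SE phi [_ _ phiU]; apply: cvg_near_cst; exists J0 => // J /= J0J.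
apply: eq_Rintegral => x _.
have [->|px] := eqVneq (phi x) 0; first by rewrite !mulr0.
by rewrite SE//; apply: phiU; exact: subset_closure.
Qed.

Lemma closed_cube j (k : 'rV[int]_d) : closed (cube (R := R) j k).
Proof.
have j0 : 0 < 2 ^+ j :> R by exact: exprn_gt0.
rewrite (_ : cube j k = box ((2 ^+ j)^-1 *: (realv k + const_mx 2^-1)) (2^-1 / 2 ^+ j)).
  exact: closed_box.
have boxE (y z : R) : (`|y - (2 ^+ j)^-1 * (z + 2^-1)| <= 2^-1 / 2 ^+ j) =
    (z <= 2 ^+ j * y <= z + 1).
  have -> : y - (2 ^+ j)^-1 * (z + 2^-1) = (2 ^+ j * y - (z + 2^-1)) / 2 ^+ j.
    by field; rewrite gt_eqF.
  rewrite normrM normfV (gtr0_norm j0) ler_pM2r ?invr_gt0// ler_norml.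
  by apply/idP/idP => /andP[h1 h2]; apply/andP; split; lra.
by apply/seteqP; split=> x xk i; have := xk i; rewrite !mxE boxE.
Qed.

End Cr_closure.

(** * The random wavelet series *)

Section wavelet_series.
Context {R : realType} {d : nat} {disp : measure_display}
  {Omega : measurableType disp} {P : probability Omega R}.
Variables (Psi : 'I_(2 ^ d).-1 -> 'rV[R]_d -> R) (r : nat) (M s p beta : R).
Hypotheses (rPsi : forall l, Cr_on r setT (Psi l))
  (suppPsi : forall l y, Psi l y != 0 -> in_box M y).
Variables (t : node d -> {RV P >-> R})
  (X : 'I_(2 ^ d).-1 * node d -> Omega -> R).

Local Notation T := (in_tree beta (fun v => t v)).
Local Notation S w := (besov_series Psi s p X T w).

Definition besov_weight j : R := 2 `^ (- (j%:R * (s + d%:R / 2 - d%:R / p))).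

Lemma in_treeE w j : [set k | T w j k] = [set` tree_level beta t w 0 0 j].
Proof.
apply/seteqP; split=> k /=.
  by move=> Tk; apply/mem_tree_level; split => //; exact: in_tree_ancestor Tk.
by move=> /mem_tree_level[].
Qed.

Lemma besov_seriesE w J x : S w J x =
  \sum_(j < J) \sum_(k <- tree_level beta t w 0 0 j) \sum_(l < (2 ^ d).-1)
    besov_weight j * X (l, (nat_of_ord j, k)) w * psi Psi l j k x.
Proof.
apply: eq_bigr => j _; rewrite in_treeE -fsbig_seq//.
by apply: filter_uniq; exact: uniq_descendants.
Qed.

Lemma Cr_on_psi l j k : Cr_on r setT (psi Psi l j k).
Proof. exact: Cr_on_affine. Qed.

Lemma Cr_on_besov_series w J : Cr_on r setT (S w J).
Proof.
rewrite (_ : S w J = fun x => \sum_(j < J) \sum_(k <- tree_level beta t w 0 0 j)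
    \sum_(l < (2 ^ d).-1) besov_weight j * X (l, (nat_of_ord j, k)) w * psi Psi l j k x).
  apply: Cr_on_sum => j; apply: Cr_on_sum => k; apply: Cr_on_sum => l.
  have := Cr_on_affine (besov_weight j * X (l, (nat_of_ord j, k)) w) 1 0 (Cr_on_psi l j k).
  by under eq_fun do rewrite scale1r subr0.
by apply/funext => x; exact: besov_seriesE.
Qed.

Lemma besov_series_stationary w J0 J x : (J0 <= J)%N ->
  (forall j k l, (J0 <= j)%N -> T w j k -> psi Psi l j k x = 0) ->
  S w J x = S w J0 x.
Proof.
move=> J0J psi0; rewrite !besov_seriesE -!(big_mkord xpredT (fun j =>
  \sum_(k <- tree_level beta t w 0 0 j) \sum_(l < (2 ^ d).-1)
    besov_weight j * X (l, (j, k)) w * psi Psi l j k x)).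
rewrite (big_cat_nat (n := J0))//= [X in _ + X]big1_seq ?addr0// => j /andP[_].
rewrite mem_index_iota => /andP[J0j _]; rewrite big1_seq// => k /andP[_].
move=> /mem_tree_level[Tk _]; apply: big1 => l _.
by rewrite psi0// mulr0.
Qed.

(** A finite tree makes the series a finite sum. *)
Lemma gen_Cr_on_finite w J0 : ~ alive beta t 0 0 J0 w -> gen_Cr_on r setT (S w).
Proof.
move=> dead; exists (S w J0); split; first exact: Cr_on_besov_series.
apply: gen_eq_on_stationary => J x J0J _; apply: besov_series_stationary => //.
move=> j k l J0j Tk; exfalso; apply: dead; apply/aliveP.
exists (ancestor (j - J0) k); split; first by apply: in_tree_up; rewrite subnKC.
by rewrite -ancestorD subnKC//; exact: in_tree_ancestor Tk.
Qed.

(** Near a point at a positive distance from the cubes of some level, only finitely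
    many terms of the series do not vanish: wavelets of a high level are supported
    close to their cubes, which are contained in those of that level. *)
Lemma singsupp_sub_cubes w J0 :
  singsupp r (S w) `<=` \bigcup_(k in [set` tree_level beta t w 0 0 J0]) cube J0 k.
Proof.
move=> x [_ sing]; apply: contrapT => xC; apply: sing.
have /open_rowP/(_ x xC)[e e0 eC] :
    open (~` \bigcup_(k in [set` tree_level beta t w 0 0 J0]) cube (R := R) J0 k).
  by apply: closed_openC; apply: closed_bigcup => [|k _]; [exact: finite_seq|exact: closed_cube].
have M0 : 0 < 2 * (`|M| + 1) by rewrite mulr_gt0// ltr_wpDl.
have [n nM] := exists_half_pow_lt (divr_gt0 e0 M0).
pose J1 := maxn J0 n; pose U : set 'rV[R]_d := [set y | forall i, `|x ord0 i - y ord0 i| < e / 2].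
exists U; split.
- rewrite (_ : U = ball x (e / 2)); first exact: ball_open.
  by apply/seteqP; split=> y /row_ballP; apply; exact: divr_gt0.
- by move=> i; rewrite subrr normr0 divr_gt0.
exists (S w J1); split; first by apply: sub_Cr_on (Cr_on_besov_series w J1).
apply: gen_eq_on_stationary => J y J1J yU; apply: besov_series_stationary => //.
move=> j k l J1j Tk; apply/eqP; rewrite /psi mulf_eq0; apply/orP; right.
apply/negP => /negP/suppPsi supp.
have j0 : 0 < 2 ^+ j :> R by exact: exprn_gt0.
have pk : cube J0 (ancestor (j - J0) k) ((2 ^+ j)^-1 *: realv k : 'rV[R]_d).
  apply: cube_ancestor; rewrite subnKC ?(leq_trans (leq_maxl _ _) J1j)// => i.
  by rewrite !mxE mulVKf ?gt_eqF// lexx lerDl ler01.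
apply: (eC ((2 ^+ j)^-1 *: realv k)) => [i|]; last first.
  exists (ancestor (j - J0) k) => //=; apply/mem_tree_level; split.
    by apply: in_tree_up; rewrite subnKC ?(leq_trans (leq_maxl _ _) J1j).
  rewrite -ancestorD subnKC ?(leq_trans (leq_maxl _ _) J1j)//.
  exact: in_tree_ancestor Tk.
have := supp i; rewrite !mxE => sM.
have yp : `|y ord0 i - (2 ^+ j)^-1 * (k ord0 i)%:~R| < e / 2.
  have -> : y ord0 i - (2 ^+ j)^-1 * (k ord0 i)%:~R =
      (2 ^+ j)^-1 * (2 ^+ j * y ord0 i - (k ord0 i)%:~R).
    by rewrite mulrBr mulKf ?gt_eqF.
  rewrite normrM gtr0_norm ?invr_gt0//.
  have jn : (2 ^+ j)^-1 <= (2 ^+ n)^-1 :> R.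
    rewrite lef_pV2 ?posrE ?exprn_gt0// ler_weXn2l ?ler1n//.
    exact: leq_trans (leq_maxr _ _) J1j.
  apply: (@le_lt_trans _ _ ((2 ^+ n)^-1 * (`|M| + 1))).
    have ji0 : 0 <= (2 ^+ j)^-1 :> R by rewrite invr_ge0 ltW.
    apply: ler_pM => //.
    by apply: (le_trans sM); rewrite (le_trans (ler_norm M))// lerDl.
  move: nM; rewrite !ltr_pdivlMr// mulrA; lra.
have := yU i; have := ler_distD (y ord0 i) (x ord0 i) ((2 ^+ j)^-1 * (k ord0 i)%:~R).
lra.
Qed.

Lemma singsupp_finite w J0 : ~ alive beta t 0 0 J0 w -> singsupp r (S w) = set0.
Proof.
move=> dead; rewrite -subset0 => x /(@singsupp_sub_cubes w J0)[k /= /mem_tree_level[Tk _] _].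
by apply: dead; apply/aliveP; exists k; split => //; exact: in_tree_ancestor Tk.
Qed.

End wavelet_series.

(** * Singularity near the nodes with infinite descent *)

Section singularity.
Context {R : realType} {d : nat} {disp : measure_display}
  {Omega : measurableType disp} {P : probability Omega R}.
Variables (Psi : 'I_(2 ^ d).-1 -> 'rV[R]_d -> R) (r : nat) (M s p beta : R).
Hypotheses (rPsi : forall l, Cr_on r setT (Psi l))
  (suppPsi : forall l y, Psi l y != 0 -> in_box M y).
Variables (t : node d -> {RV P >-> R})
  (X : 'I_(2 ^ d).-1 * node d -> {RV P >-> R}).

Local Notation T := (in_tree beta (fun v => t v)).
Local Notation S w := (besov_series Psi s p (fun i => X i) T w).
Local Notation leb := (lebesgue_row R d).

Let mT n l : measurable [set w | T w n l] := measurable_in_tree beta t n l.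

Section pairing.
Variable theta : 'rV[R]_d -> R.
Hypothesis cs_theta : compactly_supported theta.

Definition pairing_coef l j (k : 'rV[int]_d) : R :=
  besov_weight (d := d) s p j * \int[leb]_x (psi Psi l j k x * theta x).

(** [D] marks the indices that are left out. When it is a single one, the rest is
    measurable with respect to the other coefficients and the tree. *)
Definition pairing (D : pred ('I_(2 ^ d).-1 * node d)) J w : R :=
  \sum_(j < J) \sum_(k <- descendants (0 : 'rV[int]_d) j) \sum_(l < (2 ^ d).-1)
    (if D (l, (nat_of_ord j, k)) then 0 else
      \1_[set w | T w j k] w * (X (l, (nat_of_ord j, k)) w * pairing_coef l j k)).

Lemma Rintegral_besov_series w J :
  \int[leb]_x (S w J x * theta x) = pairing pred0 J w.
Proof.
have csT j k l : compactly_supported (fun x => besov_weight (d := d) s p j * X (l, (j, k)) w *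
    (psi Psi l j k x * theta x)).
  apply: compactly_supportedZ; apply: compactly_supportedM => //.
  exact: Cr_on_continuous (Cr_on_psi rPsi l j k).
transitivity (\int[leb]_x (\sum_(j < J) \sum_(k <- tree_level beta t w 0 0 j)
    \sum_(l < (2 ^ d).-1) besov_weight (d := d) s p j * X (l, (nat_of_ord j, k)) w *
    (psi Psi l j k x * theta x))).
  apply: eq_Rintegral => x _; rewrite besov_seriesE mulr_suml; apply: eq_bigr => j _.
  rewrite mulr_suml; apply: eq_bigr => k _; rewrite mulr_suml; apply: eq_bigr => l _.
  by rewrite mulrA.
rewrite Rintegral_sum_compactly_supported => [|j]; last first.
  by apply: compactly_supported_sum => k; exact: compactly_supported_sum.
apply: eq_bigr => j _.
rewrite Rintegral_sum_compactly_supported => [|k]; last exact: compactly_supported_sum.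
rewrite /tree_level big_filter big_mkcond/=; apply: eq_bigr => k _.
have [Tk|Tk] := pselect (T w j k).
  rewrite asboolT//.
  rewrite Rintegral_sum_compactly_supported => [|l]; last exact: csT.
  apply: eq_bigr => l _; rewrite indicE mem_set// mul1r /pairing_coef.
  rewrite RintegralZl//; first by rewrite mulrCA mulrA.
  apply: compactly_supported_integrable; apply: compactly_supportedM => //.
  exact: Cr_on_continuous (Cr_on_psi rPsi l j k).
by rewrite asboolF// big1// => l _; rewrite indicE memNset// mul0r.
Qed.

Lemma pairing_split w J l j k : (j < J)%N -> T w j k ->
  pairing pred0 J w =
  pairing_coef l j k * X (l, (j, k)) w + pairing (pred1 (l, (j, k))) J w.
Proof.
move=> jJ Tk; pose j' := Ordinal jJ; have kD : k \in descendants (0 : 'rV[int]_d) j.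
  by rewrite mem_descendants; apply/eqP; exact: in_tree_ancestor Tk.
rewrite /pairing (bigD1 j')//= [in RHS](bigD1 j')//= addrA; congr (_ + _); last first.
  apply: eq_bigr => i ij; apply: eq_bigr => k' _; apply: eq_bigr => l' _.
  rewrite /= ifF//; apply/negbTE; apply: contra ij => /eqP[_ ij _].
  by apply/eqP/val_inj.
have uD := uniq_descendants (0 : 'rV[int]_d) j.
rewrite (bigD1_seq k)//= [in RHS](bigD1_seq k)//= addrA; congr (_ + _); last first.
  apply: eq_bigr => k' kk'; apply: eq_bigr => l' _.
  by rewrite ifF//; apply/negbTE; apply: contra kk' => /eqP[_ ->].
rewrite (bigD1 l)//= [in RHS](bigD1 l)//= eqxx add0r indicE mem_set// mul1r mulrC.
congr (_ + _); apply: eq_bigr => l' ll'.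
by rewrite ifF//; apply/negbTE; apply: contra ll' => /eqP[->].
Qed.

Let measurable_tree_indic i0 j k : measurable_fun setT
  (\1_[set w | T w j k] : g_sigma_algebraType (other_events X T i0) -> R).
Proof.
apply: measurable_indic; apply: sub_sigma_algebra.
exists [::], (fun=> setT), [:: (j, k)]; split=> //.
by rewrite big_nil big_seq1/= setTI.
Qed.

Lemma measurable_pairing i0 J : measurable_fun setT
  (pairing (pred1 i0) J : g_sigma_algebraType (other_events X T i0) -> R).
Proof.
apply: measurable_sum => j; apply: measurable_sum => k; apply: measurable_sum => l.
case ni0 : (pred1 i0 (l, (nat_of_ord j, k))); first exact: measurable_cst.
apply: measurable_funM; first exact: measurable_tree_indic.
apply: measurable_funM; last exact: measurable_cst.
move=> _ B mB; rewrite setTI; apply: sub_sigma_algebra.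
exists [:: (l, (nat_of_ord j, k))], (fun=> B), [::]; split=> //.
  by rewrite inE eq_sym; apply/negbT; exact: ni0.
by rewrite big_nil big_seq1 setIT.
Qed.

Lemma measurable_pairing0 J : measurable_fun setT (pairing pred0 J).
Proof.
apply: measurable_sum => j; apply: measurable_sum => k; apply: measurable_sum => l.
apply: measurable_funM; first exact: measurable_indic.
by apply: measurable_funM => //; exact: measurable_cst.
Qed.

End pairing.

Variables (c : R) (l0 : 'I_(2 ^ d).-1) (i0 : 'I_d) (H rho c0 : R)
  (eta : R -> 'rV[R]_d -> 'rV[R]_d -> R).
Hypotheses (c_ge0 : 0 <= c)
  (cX : forall i (A : set R), measurable A ->
    (P (X i @^-1` A) <= c%:E * lebesgue_measure A)%E)
  (iX : mutually_independent X) (iXT : independent_of_tree X T)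
  (p1 : 1 <= p) (sr : s < r%:R) (H0 : 0 < H) (c00 : 0 < c0).

Local Notation eta_ j k := (eta (2 ^+ j) (realv k)).
Local Notation h_ j := (H / 2 ^+ j).
Definition wavelet_test j (k : 'rV[int]_d) : 'rV[R]_d -> R :=
  iter r (fdiff (- (h_ j *: unit_row i0))) (eta_ j k).

Hypothesis etaP : forall (L : R) (k : 'rV[R]_d), 0 < L ->
  let theta := iter r (fdiff (- ((H / L) *: unit_row i0))) (eta L k) in
  [/\ [/\ compactly_supported (eta L k), forall x, 0 <= eta L k x,
          0 < \int[leb]_x eta L k x,
          forall n, Cr_on n setT theta
        & compactly_supported theta],
      forall x s, eta L k x != 0 -> 0 <= s <= r%:R * (H / L) ->
        box (L^-1 *: k) (rho / L) (s *: unit_row i0 + x),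
      forall x, theta x != 0 -> box (L^-1 *: k) (rho / L) x
    & c0 * \int[leb]_x eta L k x <=
      `|\int[leb]_x (Psi l0 (L *: x - k) * theta x)|].

Let pow2_gt0 j : 0 < 2 ^+ j :> R. Proof. exact: exprn_gt0. Qed.

(** The decay in [j] of the ratio between the regularity bound for the pairing
    with [wavelet_test j k] and its random part. *)
Definition decay : R := 2 `^ (- (r%:R - s + d%:R / p)).

Lemma decay_lt1 : 0 <= decay < 1.
Proof.
rewrite /decay powR_ge0/= powRN invf_lt1 ?powR_gt0//.
have dp : 0 <= d%:R / p by rewrite divr_ge0// (le_trans ler01).
by apply: powR2_gt1; rewrite ltr_wpDr// subr_gt0.
Qed.

(** The bound of order [h ^+ r] for C^r functions is smaller than the coefficient
    by a factor [decay ^+ j], which is geometric because [s < r]. *)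
Lemma pairing_coef_ge j k :
  c0 * (h_ j ^+ r * \int[leb]_x eta_ j k x) <=
  H ^+ r * decay ^+ j * `|pairing_coef (wavelet_test j k) l0 j k|.
Proof.
have [[_ _ _ _ cs_theta] _ _ ge_c0] := etaP (realv k) (pow2_gt0 j).
pose b : R := besov_weight (d := d) s p j * 2 `^ ((j * d)%:R / 2).
have b0 : 0 <= b by rewrite mulr_ge0// powR_ge0.
have hrE : h_ j ^+ r = H ^+ r * decay ^+ j * b.
  rewrite expr_div_n -mulrA; congr (_ * _).
  rewrite /decay /b /besov_weight -!powR_mulrn ?powR_ge0// -powRN -!powRrM.
  rewrite -!powRD ?pnatr_eq0 ?implybT//; congr (_ `^ _).
  by rewrite !natrM; lra.
have cE : `|pairing_coef (wavelet_test j k) l0 j k| =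
    b * `|\int[leb]_x (Psi l0 (2 ^+ j *: x - realv k) * wavelet_test j k x)|.
  rewrite /pairing_coef; have -> : \int[leb]_x (psi Psi l0 j k x * wavelet_test j k x) =
      2 `^ ((j * d)%:R / 2) * \int[leb]_x (Psi l0 (2 ^+ j *: x - realv k) * wavelet_test j k x).
    rewrite -RintegralZl//; last first.
      apply: compactly_supported_integrable; apply: compactly_supportedM => //.
      rewrite (_ : (fun x => _) = fun x => 1 * Psi l0 (2 ^+ j *: x - realv k)).
        by move=> x; apply: continuous_affine; exact: Cr_on_continuous (rPsi l0) _.
      by apply/funext => x; rewrite mul1r.
    by apply: eq_Rintegral => x _; rewrite /psi mulrA.
  by rewrite mulrA normrM ger0_norm.
rewrite cE hrE [leRHS]mulrA -[X in c0 * X]mulrA mulrCA -[leRHS]mulrA.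
apply: ler_wpM2l; first by rewrite mulr_ge0 ?exprn_ge0 ?powR_ge0// ltW.
by rewrite mulrCA; exact: ler_wpM2l.
Qed.

(** The test function is taken at the first node, in the order of [D], among those
    of the tree at the level [j = n + m] below [(n, k0)]. Which node comes first is
    decided by the tree, hence independent of all the coefficients. *)
Section level.
Variables (n m : nat) (k0 : 'rV[int]_d) (C : R).
Hypothesis C0 : 0 < C.

Let j := (n + m)%N.
Let D := descendants k0 m.
Let k_ i := nth 0 D i.
Let eps i := C * (h_ j ^+ r * \int[leb]_x eta_ j (k_ i) x).

Let node_event i : set Omega :=
  if (i < size D)%N then [set w | T w j (k_ i)] else set0.

Definition small_event J : set Omega :=
  \bigcup_i (seqDU node_event i `&`
    [set w | `|pairing (wavelet_test j (k_ i)) pred0 J w| <= eps i]).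

Let h_gt0 : 0 < h_ j. Proof. exact: divr_gt0. Qed.

Let eps_gt0 i : 0 < eps i.
Proof.
have [[_ _ Ipos _ _] _ _ _] := etaP (realv (k_ i)) (pow2_gt0 j).
by rewrite !mulr_gt0// exprn_gt0.
Qed.

Let measurable_node_event i : measurable (node_event i).
Proof. by rewrite /node_event; case: ifP => // _; exact: mT. Qed.

Let measurable_first i : measurable (seqDU node_event i).
Proof.
by apply: measurableD => //; apply: bigsetU_measurable => i' _.
Qed.

Let measurable_small i J : measurable
  [set w | `|pairing (wavelet_test j (k_ i)) pred0 J w| <= eps i].
Proof.
have mS : measurable_fun setT (fun w => `|pairing (wavelet_test j (k_ i)) pred0 J w|).
  by apply: measurableT_comp => //; exact: measurable_pairing0.
rewrite (_ : [set w | _] = (fun w => `|pairing (wavelet_test j (k_ i)) pred0 J w|) @^-1`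
    `]-oo, eps i]).
  by rewrite -[X in measurable X]setTI; apply: mS => //; exact: measurable_itv.
by apply/seteqP; split=> w /=; rewrite in_itv.
Qed.

Lemma measurable_small_event J : measurable (small_event J).
Proof. by apply: bigcupT_measurable => i; exact: measurableI. Qed.

(** The coefficient at the first node has a bounded density and is independent
    of the other terms of the pairing, so [small_ball] applies. *)
Lemma prob_small_event J : (j < J)%N ->
  (P (small_event J) <= (c * (3 * (C * (H ^+ r * decay ^+ j / c0))))%:E)%E.
Proof.
move=> jJ; set K := c * _.
have K0 : 0 <= K.
  rewrite /K !mulr_ge0// ?(ltW C0)//; last by rewrite invr_ge0 ltW.
    by rewrite exprn_ge0// ltW.
  by rewrite exprn_ge0// powR_ge0.
have bound i : (P (seqDU node_event i `&`
    [set w | (`|pairing (wavelet_test j (k_ i)) pred0 J w| <= eps i)%R]) <=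
    P (seqDU node_event i) * K%:E)%E.
  have [iD|iD] := ltnP i (size D); last first.
    have -> : seqDU node_event i = set0.
      by rewrite /seqDU /node_event ltnNge iD/= set0D.
    by rewrite set0I measure0 mul0e.
  pose i1 := (l0, (j, k_ i)).
  have Ifirst : <<s other_events X T i1 >> (seqDU node_event i).
    have sT i' : <<s other_events X T i1 >> (node_event i').
      rewrite /node_event; case: ifP => _; last first.
        exact: (@measurable0 _ (g_sigma_algebraType (other_events X T i1))).
      apply: sub_sigma_algebra; exists [::], (fun=> setT), [:: (j, k_ i')]; split=> //.
      by rewrite big_nil big_seq1/= setTI.
    apply: (@measurableD _ (g_sigma_algebraType (other_events X T i1))); first exact: sT.
    apply: (@bigsetU_measurable _ (g_sigma_algebraType (other_events X T i1))) => i' _.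
    exact: sT.
  pose a := pairing_coef (wavelet_test j (k_ i)) l0 j (k_ i).
  have [[_ _ Ipos _ cs_theta] _ _ _] := etaP (realv (k_ i)) (pow2_gt0 j).
  have a_ge := pairing_coef_ge j (k_ i); rewrite -/a in a_ge.
  have Hd0 : 0 <= H ^+ r * decay ^+ j.
    by rewrite mulr_ge0 ?exprn_ge0 ?powR_ge0// ltW.
  have a0 : 0 < `|a|.
    rewrite lt_neqAle normr_ge0 andbT eq_sym; apply/negP => /eqP a0.
    move: a_ge; rewrite a0 mulr0 leNgt => /negP; apply.
    by rewrite !mulr_gt0// exprn_gt0.
  have -> : seqDU node_event i `&`
      [set w | (`|pairing (wavelet_test j (k_ i)) pred0 J w| <= eps i)%R] =
    seqDU node_event i `&` [set w | (`|a * X i1 w +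
      pairing (wavelet_test j (k_ i)) (pred1 i1) J w| <= eps i)%R].
    apply/seteqP; split=> w [fw /= le_eps]; split => //=; move: le_eps;
      have : node_event i w by case: fw.
    - by rewrite /node_event iD => Tk; rewrite (@pairing_split _ w J l0 j (k_ i)).
    - by rewrite /node_event iD => Tk; rewrite (@pairing_split _ w J l0 j (k_ i)).
  have := @small_ball R d disp Omega P _ X T mT iX iXT i1 c a (eps i)
    (pairing (wavelet_test j (k_ i)) (pred1 i1) J) (seqDU node_event i) c_ge0 (cX i1).
  have mpair : measurable_fun setT (pairing (wavelet_test j (k_ i)) (pred1 i1) J :
      g_sigma_algebraType (other_events X T i1) -> R) by exact: measurable_pairing.
  rewrite -normr_gt0 => /(_ a0 (eps_gt0 i) mpair Ifirst) h.
  apply: (le_trans h); apply: lee_wpmul2l; first exact: measure_ge0.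
  rewrite lee_fin /K; apply: ler_wpM2l => //.
  rewrite -mulrA; apply: ler_wpM2l => //.
  rewrite /eps -mulrA; apply: ler_wpM2l; first exact: ltW.
  by rewrite ler_pdivlMr// mulrAC ler_pdivrMr// mulrC.
apply: (@le_trans _ _ (\sum_(0 <= i <oo) P (seqDU node_event i `&`
    [set w | (`|pairing (wavelet_test j (k_ i)) pred0 J w| <= eps i)%R]))%E).
  apply: measure_sigma_subadditive => //; last exact: measurable_small_event.
  by move=> i; exact: measurableI.
apply: (@le_trans _ _ (\sum_(0 <= i <oo) P (seqDU node_event i) * K%:E)%E).
  by apply: lee_nneseries => // i _ _; exact: measure_ge0.
rewrite (eq_eseriesr (g := fun i => (K%:E * P (seqDU node_event i))%E)); last first.
  by move=> i _; rewrite muleC.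
rewrite nneseriesZl//.
have -> : (\sum_(0 <= i <oo) P (seqDU node_event i) = P (\bigcup_i seqDU node_event i))%E.
  have tF := @trivIset_seqDU _ node_event.
  rewrite measure_bigcup//.
  by apply/esym/eq_eseriesl => i; rewrite in_setT.
rewrite -[leRHS]mule1; apply: lee_wpmul2l; first by rewrite lee_fin.
by apply: probability_le1; exact: bigcupT_measurable.
Qed.

End level.

(** Its centre is a corner of the cube of the node, hence the factor [2]. *)
Definition node_ball n (k : 'rV[int]_d) : set 'rV[R]_d :=
  ball ((2 ^+ n)^-1 *: realv k) (2 / 2 ^+ n).

(** If the series is a C^r function near the cube of a node with infinite descent,
    its pairings with the test functions of the nodes below have the size given by
    [Rintegral_Cr_fdiff]. *)
Lemma small_event_near n (k0 : 'rV[int]_d) : exists m1, forall w g,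
  (forall m, alive beta t n k0 m w) -> Cr_on r (node_ball n k0) g ->
  gen_eq_on (node_ball n k0) (S w) g ->
  exists C, forall m, (m1 <= m)%N ->
    \forall J \near \oo, small_event n m k0 C.+1%:R J w.
Proof.
pose c1 : 'rV[R]_d := (2 ^+ n)^-1 *: realv k0.
have n0 := pow2_gt0 n.
have rho1 : 0 < 2 * (`|rho| + 1) by rewrite mulr_gt0// ltr_wpDl.
have [m1 m1P] : exists m : nat, (2 ^+ m)^-1 < (2 * (`|rho| + 1))^-1.
  by apply: exists_half_pow_lt; rewrite invr_gt0.
exists m1 => w g al gr gS; set U := node_ball n k0 in gr gS.
have U2 : 0 < 2 / 2 ^+ n :> R by exact: divr_gt0.
have oU : open U by exact: ball_open.
have BU : box c1 ((3 / 2) / 2 ^+ n) `<=` U.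
  move=> x xB; apply/row_ballP => // i; rewrite distrC.
  apply: le_lt_trans (xB i) _; rewrite ltr_pM2r ?invr_gt0//; lra.
have [Cg Cg0 CgP] : exists2 C : R, 0 <= C & _ :=
  @Rintegral_Cr_fdiff R d r U g c1 ((3 / 2) / 2 ^+ n) i0 oU gr
    (divr_ge0 (divr_ge0 (ler0n _ 3) (ler0n _ 2)) (ltW n0)) BU.
have [C CgC] : exists C : nat, Cg < C.+1%:R.
  by exists (Num.truncn Cg); exact: truncnS_gt.
exists C => m m1m; set j := (n + m)%N.
have j0 := pow2_gt0 j.
set D := descendants k0 m.
have [i first_i] : exists i, seqDU
    (fun i => if (i < size D)%N then [set w | T w j (nth 0 D i)] else set0) i w.
  suff : (\bigcup_i (fun i => if (i < size D)%N then [set w | T w j (nth 0 D i)] else set0) i) w.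
    by rewrite seqDU_bigcup_eq => -[i _ wi]; exists i.
  have [l /= lD Tl] := al m; exists (index l D) => //.
  by rewrite index_mem lD/= nth_index.
have [iD Ti] : (i < size D)%N /\ T w j (nth 0 D i).
  by have [] := first_i; case: (i < size D)%N => // Ti _; split.
set k := nth 0 D i in Ti.
have kanc : ancestor m k = k0.
  by apply/eqP; rewrite -mem_descendants; exact: mem_nth.
have kc1 l : `|c1 ord0 l - ((2 ^+ j)^-1 *: realv k : 'rV[R]_d) ord0 l| <= (2 ^+ n)^-1.
  have : cube n k0 ((2 ^+ j)^-1 *: realv k : 'rV[R]_d).
    rewrite -kanc; apply: cube_ancestor => l'.
    by rewrite !mxE mulVKf ?gt_eqF// lexx lerDl ler01.
  move=> /(_ l); rewrite /c1 !mxE; set y := (2 ^+ j)^-1 * _ => /andP[h1 h2].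
  rewrite -(ler_pM2l n0) divff ?gt_eqF// -{1}(gtr0_norm n0) -normrM mulrBr.
  rewrite mulVKf ?gt_eqF//.
  by rewrite ler_norml; apply/andP; split; lra.
have small_box : box ((2 ^+ j)^-1 *: realv k) (rho / 2 ^+ j) `<=` box c1 ((3 / 2) / 2 ^+ n).
  move=> x xB l; have rj : rho / 2 ^+ j <= 2^-1 / 2 ^+ n.
    rewrite /j exprD invfM mulrA [rho / _]mulrC -mulrA mulrC ler_pM2r ?invr_gt0//.
    apply: (@le_trans _ _ (`|rho| / 2 ^+ m)).
      by rewrite ler_wpM2r ?invr_ge0 ?exprn_ge0// ler_norm.
    have : (2 ^+ m)^-1 <= (2 ^+ m1)^-1 :> R.
      by rewrite lef_pV2 ?posrE ?exprn_gt0// ler_weXn2l// ler1n.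
    move=> /le_lt_trans/(_ m1P)/ltW mP.
    apply: (@le_trans _ _ (`|rho| * (2 * (`|rho| + 1))^-1)); first exact: ler_wpM2l.
    by rewrite ler_pdivrMr//; have := normr_ge0 rho; lra.
  have := xB l; have := kc1 l.
  have := ler_distD (((2 ^+ j)^-1 *: realv k : 'rV[R]_d) ord0 l) (x ord0 l) (c1 ord0 l).
  rewrite [`|_ - c1 ord0 l| in X in _ <= X -> _]distrC; lra.
have [[cs_eta eta0 Ipos stheta cs_theta] line_eta supp_theta _] := etaP (realv k) j0.
have tf : test_function U (wavelet_test j k).
  apply: (test_function_box (c := c1) (rho := (3 / 2) / 2 ^+ n)) => // x.
  by move=> /supp_theta/small_box.
have cvS := gS _ tf.
have le_g : `|\int[leb]_x (g x * wavelet_test j k x)| <=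
    Cg * h_ j ^+ r * \int[leb]_x eta_ j k x.
  apply: CgP => //; first by rewrite ltW// divr_gt0.
    by move=> x s' ex /(line_eta x s' ex)/small_box.
  by move=> x /supp_theta/small_box.
have gap : 0 < (C.+1%:R - Cg) * (h_ j ^+ r * \int[leb]_x eta_ j k x).
  by rewrite mulr_gt0 ?subr_gt0// mulr_gt0// exprn_gt0// divr_gt0.
move/cvgrPdist_lt : cvS => /(_ _ gap)[J1 _ J1P]; exists J1 => // J /J1P /= close.
exists i => //; split=> //=.
rewrite -Rintegral_besov_series//.
have := ler_normB (\int[leb]_x (g x * wavelet_test j k x))
  (\int[leb]_x (g x * wavelet_test j k x) - \int[leb]_x (S w J x * wavelet_test j k x)).
rewrite opprB addrC subrK => /le_trans; apply.
move: close le_g; rewrite -/k -/j.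
set I := \int[leb]_x eta_ j k x; rewrite mulrBl mulrA -mulrA => h1 h2; lra.
Qed.

(** By [small_event_near] the event is contained, for some [C] and all large [m], in
    the lower limit of the [small_event n m k0 C], of probability [O(decay ^+ m)]. *)
Lemma alive_not_Cr n (k0 : 'rV[int]_d) : P.-negligible
  [set w | (forall m, alive beta t n k0 m w) /\ gen_Cr_on r (node_ball n k0) (S w)].
Proof.
have [m1 m1P] := small_event_near n k0.
pose late C m J0 := \bigcap_(J in [set J | (J0 <= J)%N]) small_event n m k0 C.+1%:R J.
have mlate C m J0 : measurable (late C m J0).
  apply: bigcap_measurable => [|J _]; last exact: measurable_small_event.
  by exists J0 => /=.
pose E C m := \bigcup_J0 late C m J0.
have mE C m : measurable (E C m) by apply: bigcupT_measurable.
have PE C m : (P (E C m) <=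
    (c * (3 * (C.+1%:R * (H ^+ r * decay ^+ (n + m) / c0))))%:E)%E.
  have late_nd : nondecreasing_seq (late C m).
    apply/nondecreasing_seqP => J0; apply/subsetPset => w h J /= J0J.
    by apply: h => /=; exact: ltnW.
  have cvP := nondecreasing_cvg_mu (mu := P) (mlate C m) (mE C m) late_nd.
  rewrite -(cvg_lim _ cvP)//; apply: lime_le; first exact: cvgP cvP.
  apply: nearW => J0 /=.
  apply: (@le_trans _ _ (P (small_event n m k0 C.+1%:R (maxn J0 (n + m).+1)))).
    apply: le_measure; rewrite ?inE//; first exact: measurable_small_event.
    by move=> w; apply => /=; exact: leq_maxl.
  by apply: prob_small_event => //; exact: leq_maxr.
apply: (@negligibleS _ _ _ _ (\bigcup_C \bigcap_(m in [set m | (m1 <= m)%N]) E C m)).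
  move=> w [al [g [gr gS]]]; have [C CP] := m1P w g al gr gS.
  by exists C.
apply: negligible_bigcup => C.
have mEC : measurable (\bigcap_(m in [set m | (m1 <= m)%N]) E C m).
  by apply: bigcap_measurable => //; exists m1 => /=.
exists (\bigcap_(m in [set m | (m1 <= m)%N]) E C m); split => //.
apply/eqP; rewrite eq_le measure_ge0 andbT.
pose K := c * (3 * (C.+1%:R * (H ^+ r / c0))).
have cv0 : (K * decay ^+ (n + m))%:E @[m --> \oo] --> (0 : R)%:E.
  apply: cvg_EFin; first exact: nearW.
  rewrite -[X in _ --> X](mulr0 K); apply: cvgM; first exact: cvg_cst.
  have /andP[d0 d1] := decay_lt1.
  have : decay ^+ m @[m --> \oo] --> (0 : R) by apply: cvg_expr; rewrite ger0_norm.
  by rewrite -(cvg_shiftn n); under [X in X @ _]eq_fun do rewrite addnC.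
rewrite -[leRHS]/((0 : R)%:E) -(cvg_lim _ cv0)//; apply: lime_ge; first exact: cvgP cv0.
exists m1 => // m /= m1m.
apply: (@le_trans _ _ (P (E C m))).
  by apply: le_measure; rewrite ?inE// => w; apply.
by apply: le_trans (PE C m) _; rewrite lee_fin le_eqVlt; apply/orP; left; apply/eqP; rewrite /K; ring.
Qed.

End singularity.

(** * Hausdorff dimension *)

Section dimension.
Context {R : realType} {d : nat}.
Implicit Types (A : set 'rV[R]_d) (a g : R).

Lemma hausdorff_measure_set0 a : hausdorff_measure a (set0 : set 'rV[R]_d) = 0%E.
Proof.
apply: hausdorff_measure_eq0 => delta delta0; apply/eqP.
rewrite eq_le hausdorff_premeasure_ge0 andbT; apply: ereal_inf_lbound.
exists (fun=> set0).
  by split=> // i; apply: ge_ereal_sup => _ [[x y] [/= []]].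
by apply: eseries0 => i _ _; rewrite /hausdorff_weight eqxx.
Qed.

Lemma hausdorff_dim_set0 : hausdorff_dim (set0 : set 'rV[R]_d) = 0%E.
Proof.
apply/eqP; rewrite eq_le; apply/andP; split.
  by apply: ereal_inf_lbound; exists 0 => //; split=> //; exact: hausdorff_measure_set0.
by apply: le_ereal_inf_tmp => _ [a [a0 _] <-]; rewrite lee_fin.
Qed.

Lemma hausdorff_dim_eq A g : 0 <= g ->
  (forall n, hausdorff_measure (g + n.+1%:R^-1) A = 0%E) ->
  (forall a, 0 <= a -> a < g -> hausdorff_measure a A <> 0%E) ->
  hausdorff_dim A = g%:E.
Proof.
move=> g0 small large; apply/eqP; rewrite eq_le; apply/andP; split; last first.
  apply: le_ereal_inf_tmp => _ [a [a0 aA] <-]; rewrite lee_fin leNgt; apply/negP.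
  by move=> ag; exact: large a0 ag aA.
apply/lee_addgt0Pr => e e0.
have [n _ /(_ n (leqnn _)) ne] := near_infty_natSinv_lt (PosNum e0).
apply: (@le_trans _ _ (g + n.+1%:R^-1)%:E).
  apply: ereal_inf_lbound; exists (g + n.+1%:R^-1) => //; split => //.
  by rewrite addr_ge0.
by rewrite -EFinD lee_fin lerD2l ltW.
Qed.

End dimension.

(** * The number of nodes of a level *)

Section upper_bound.
Context {R : realType} {d : nat} {disp : measure_display}
  {Omega : measurableType disp} {P : probability Omega R}.
Variables (beta : R) (t : node d -> {RV P >-> R}).
Hypotheses (beta0 : 0 < beta) (beta1 : beta <= 1)
  (ut : forall v, uniform01 (t v)) (it : mutually_independent t).
Local Notation T := (in_tree beta (fun v => t v)).

Lemma size_descendants (k : 'rV[int]_d) n : size (descendants k n) = ((2 ^ d) ^ n)%N.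
Proof.
elim: n k => //= n IHn k; rewrite size_allpairs IHn -cardE card_ffun card_bool card_ord.
by rewrite expnSr.
Qed.

Let size_levelE w J : (size (tree_level beta t w 0 0 J))%:R =
  \sum_(k <- descendants (0 : 'rV[int]_d) J) \1_[set w | T w J k] w :> R.
Proof.
rewrite size_filter -sum1_count natr_sum big_mkcond/=; apply: eq_bigr => k _.
by rewrite add0n indicE; case: asboolP => Tk; [rewrite mem_set|rewrite memNset].
Qed.

Let measurable_size_level J :
  measurable_fun setT (fun w => (size (tree_level beta t w 0 0 J))%:R : R).
Proof.
under eq_fun do rewrite size_levelE.
by apply: measurable_sum => k; apply: measurable_indic; exact: measurable_in_tree.
Qed.

Lemma expectation_size_level J :
  (\int[P]_w ((size (tree_level beta t w 0 0 J))%:R%:E) =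
   (((2 ^ d)%:R * beta) ^+ J)%:E)%E.
Proof.
under eq_integral do rewrite size_levelE -sumEFin.
have mT k : measurable [set w | T w J k] by exact: measurable_in_tree.
rewrite ge0_integral_sum//; last first.
  by move=> k; apply/measurable_EFinP; exact: measurable_indic.
rewrite (eq_big_seq (fun=> (beta ^+ J)%:E)) => [|k]; last first.
  rewrite mem_descendants => /eqP k0; rewrite integral_indic// setIT.
  exact: prob_in_tree.
rewrite sumEFin big_const_seq count_predT size_descendants iter_addr_0.
by rewrite exprMn -natrX mulr_natl.
Qed.

Let large (e lam : R) J : set Omega :=
  [set w | e <= (size (tree_level beta t w 0 0 J))%:R * lam ^+ J].

Let measurable_large (e lam : R) J : measurable (large e lam J).
Proof.
rewrite (_ : large e lam J =
    (fun w => (size (tree_level beta t w 0 0 J))%:R * lam ^+ J) @^-1` `[e, +oo[).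
  rewrite -[X in measurable X]setTI.
  by apply: (measurable_funM (measurable_size_level J) (measurable_cst _)).
by apply/seteqP; split=> w /=; rewrite /large/= in_itv/= andbT.
Qed.

Let prob_large (e lam : R) J : 0 < e -> 0 < lam ->
  (P (large e lam J) <= (((2 ^ d)%:R * beta * lam) ^+ J / e)%:E)%E.
Proof.
move=> e0 lam0; set A := large e lam J.
have mA : measurable A by exact: measurable_large.
have lJ : 0 < lam ^+ J by exact: exprn_gt0.
have eA : (\int[P]_w ((e / lam ^+ J)%:E * (\1_A w)%:E) <=
    \int[P]_w ((size (tree_level beta t w 0 0 J))%:R%:E))%E.
  apply: ge0_le_integral => //.
  - by move=> w _; rewrite lee_fin mulr_ge0// divr_ge0// ltW.
  - apply: measurable_funeM; apply/measurable_EFinP; exact: measurable_indic.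
  - by apply/measurable_EFinP; exact: measurable_size_level.
  - move=> w _; rewrite -EFinM lee_fin indicE; have [Aw|Aw] := pselect (A w).
      by rewrite mem_set// mulr1 ler_pdivrMr.
    by rewrite memNset// mulr0.
move: eA; rewrite ge0_integralZl//; last 2 first.
- by apply/measurable_EFinP; exact: measurable_indic.
- by rewrite lee_fin divr_ge0// ltW.
rewrite integral_indic// setIT expectation_size_level => eA.
have [x PA] : exists x, P A = x%:E.
  by exists (fine (P A)); rewrite fineK//; exact: fin_num_measure.
have {}eA : (((e / lam ^+ J) * x)%:E <= (((2 ^ d)%:R * beta) ^+ J)%:E)%E.
  by rewrite EFinM -PA.
rewrite [X in (X <= _)%E](_ : _ = x%:E)// lee_fin ler_pdivlMr// exprMn.
by move: eA; rewrite lee_fin mulrAC ler_pdivrMr// [e * x]mulrC.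
Qed.

(** Markov's inequality: the expectation of the weighted size of a level tends to
    [0] geometrically. *)
Lemma small_levels (a : R) : (2 ^ d)%:R * beta * 2 `^ (- a) < 1 ->
  {ae P, forall w, forall (e : R) j0, 0 < e -> exists2 j, (j0 <= j)%N &
    (size (tree_level beta t w 0 0 j))%:R * 2 `^ (- (j%:R * a)) < e}.
Proof.
set lam := 2 `^ (- a) => sub.
have lam0 : 0 < lam by exact: powR_gt0.
have lamE j : 2 `^ (- (j%:R * a)) = lam ^+ j.
  by rewrite -powR_mulrn ?powR_ge0// -powRrM mulNr mulrC.
pose bad (mj : nat * nat) :=
  \bigcap_(j in [set j | (mj.2 <= j)%N]) large mj.1.+1%:R^-1 lam j.
have mbad mj : measurable (bad mj).
  by apply: bigcap_measurable => [|j _]; [exists mj.2 => /=|exact: measurable_large].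
apply: (@negligibleS _ _ _ _ (\bigcup_m \bigcup_j0 bad (m, j0))).
  move=> w /= nw; apply: contrapT => wbad; apply: nw => e j0 e0.
  apply: contrapT => nj; apply: wbad.
  have [m _ /(_ m (leqnn _)) me] := near_infty_natSinv_lt (PosNum e0).
  exists m => //; exists j0 => // j /= j0j.
  rewrite /large/= leNgt; apply/negP => lt_m; apply: nj; exists j => //.
  by rewrite lamE (lt_trans lt_m).
apply: negligible_bigcup => m; apply: negligible_bigcup => j0.
exists (bad (m, j0)); split => //.
apply/eqP; rewrite eq_le measure_ge0 andbT.
have e0 : 0 < m.+1%:R^-1 :> R by rewrite invr_gt0.
have q0 : 0 <= (2 ^ d)%:R * beta * lam by rewrite !mulr_ge0// ltW.
have cv0 : (((2 ^ d)%:R * beta * lam) ^+ J / m.+1%:R^-1)%:E @[J --> \oo] --> (0 : R)%:E.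
  apply: cvg_EFin; first exact: nearW.
  rewrite -[X in _ --> X](mul0r (m.+1%:R^-1)^-1); apply: cvgM; last exact: cvg_cst.
  by apply: cvg_expr; rewrite ger0_norm.
rewrite -[leRHS]/((0 : R)%:E) -(cvg_lim _ cv0)//; apply: lime_ge; first exact: cvgP cv0.
exists j0 => // J /= j0J.
apply: le_trans (prob_large J e0 lam0).
by apply: le_measure; rewrite ?inE//= => w; apply.
Qed.

End upper_bound.

(** * Wavelets and densities *)

Section wavelet_facts.
Context {R : realType} {d : nat}.
Variables (r : nat) (phi : 'rV[R]_d -> R) (Psi : 'I_(2 ^ d).-1 -> 'rV[R]_d -> R).
Hypothesis wav : is_wavelet_basis r phi Psi.

Lemma wavelet_Cr l : Cr_on r setT (Psi l).
Proof. by have [_ /(_ l)[]] := wav. Qed.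

Lemma wavelet_support : exists M, forall l y, Psi l y != 0 -> in_box M y.
Proof.
have [_ wP _] := wav.
have bnd l : exists M : R, forall y, Psi l y != 0 -> in_box M y.
  have [_ /compact_bounded[N [_ NP]] _] := wP l.
  have N1 : N < N + 1 by rewrite ltrDl.
  exists (N + 1) => y Py i.
  have /(NP _ N1 y)/= : fsupport (Psi l) y by exact: subset_closure.
  apply: le_trans.
  rewrite -[leRHS]/(mx_norm y) mx_normrE.
  exact: (le_bigmax _ (fun ij : 'I_1 * 'I_d => `|y ij.1 ij.2|) (ord0, i)).
have [M MP] := choice bnd.
exists (\sum_l `|M l|) => l y /MP yM i; apply: le_trans (yM i) _.
by rewrite (le_trans (ler_norm _))// (bigD1 l)//= lerDl sumr_ge0.
Qed.

(** Its norm in [L2] is [1]. *)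
Lemma wavelet_neq0 l : exists y, Psi l y != 0.
Proof.
have [_ _ [V [_ _ [_ ortho _]]]] := wav.
apply: contrapT => Psi0; have := ortho (l, 0) (l, 0); rewrite eqxx /inner.
rewrite (@eq_Rintegral _ _ _ _ _ (cst 0)) => [|x _].
  by rewrite Rintegral_cst// mul0r => /esym/eqP; rewrite oner_eq0.
rewrite /= (_ : Psi _ _ = 0) ?mul0r//.
by apply/eqP/negP => /negP Px; apply: Psi0; eexists; exact: Px.
Qed.

End wavelet_facts.

Section exp_power_law.
Context {R : realType} {disp : measure_display}
  {Omega : measurableType disp} {P : probability Omega R}.

Lemma exp_power_law_density (kappa p : R) (I : Type) (Y : I -> {RV P >-> R}) :
  0 < kappa -> same_exp_power_law kappa p Y -> exists2 c : R, 0 <= c &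
    forall i (A : set R), measurable A ->
      (P (Y i @^-1` A) <= c%:E * lebesgue_measure A)%E.
Proof.
move=> kappa0 [c cY]; exists `|c| => // i A mA; rewrite cY//.
set f := fun x : R => c * expR (- (1 / (2 * kappa `^ p)) * `|x| `^ p).
have mf : measurable_fun A f.
  apply: measurable_funM; first exact: measurable_cst.
  apply: measurableT_comp => //; apply: measurable_funM; first exact: measurable_cst.
  exact: (measurableT_comp (measurable_powR p) (@normr_measurable R A)).
rewrite -integral_cst//.
apply: (@le_trans _ _ `|\int[lebesgue_measure]_(x in A) (f x)%:E|)%E; first exact: lee_abs.
apply: (le_trans (le_abse_integral lebesgue_measure mA _)); first exact/measurable_EFinP.
apply: ge0_le_integral => //.
- by apply: measurableT_comp => //; exact/measurable_EFinP.
- move=> x _; rewrite /= lee_fin normrM [`|expR _|]ger0_norm ?expR_ge0// ler_piMr//.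
  by rewrite expR_le1 mulNr oppr_le0 mulr_ge0 ?divr_ge0 ?mulr_ge0 ?powR_ge0.
Qed.

End exp_power_law.

(** * Limit points of infinite paths *)

Section limit_points_singular.
Context {R : realType} {d : nat}.

Lemma sub_gen_Cr_on r (U U' : set 'rV[R]_d) S : U' `<=` U ->
  gen_Cr_on r U S -> gen_Cr_on r U' S.
Proof.
move=> UU' [g [gr gS]]; exists g; split; first exact: sub_Cr_on gr.
by move=> f [fs fc fU']; apply: gS; split=> //; exact: subset_trans UU'.
Qed.

Context {disp : measure_display}
  {Omega : measurableType disp} {P : probability Omega R}.
Variables (beta : R) (t : node d -> {RV P >-> R}).

(** Every neighbourhood of the limit point contains the [node_ball] of a node of
    the path, all of whose nodes have infinite descent. *)
Lemma limit_point_singular r w (S : ('rV[R]_d -> R)^nat) (kap : nat -> 'rV[int]_d) z :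
  (forall n k, (forall m, alive beta t n k m w) -> ~ gen_Cr_on r (node_ball n k) S) ->
  kap 0%N = 0 -> (forall j, half_row (kap j.+1) = kap j) ->
  (forall j, open_indicator beta t w (j.+1, kap j.+1) = 1) ->
  (forall j, cube j (kap j) z) -> singsupp r S z.
Proof.
move=> sing k0 kS opn zk.
have Tk j : in_tree beta (fun v => t v) w j (kap j).
  elim: j => //= j IHj; rewrite kS; split => //.
  have := opn j; rewrite /open_indicator; case: ltP => // _ /eqP.
  by rewrite eq_sym oner_eq0.
have anc j m : ancestor m (kap (j + m)%N) = kap j.
  by elim: m => [|m IHm]; rewrite ?addn0// addnS ancestorSr kS.
split=> [i|[U [/open_rowP/(_ z) oU /oU[e e0 eU] UCr]]].
  by have := zk 0%N i; rewrite k0 expr0 mul1r mxE add0r.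
have e3 : 0 < e / 3 by rewrite divr_gt0.
have [n ne] := exists_half_pow_lt e3.
have n0 : 0 < 2 ^+ n :> R by exact: exprn_gt0.
apply: (sing n (kap n)).
  by move=> m; apply/aliveP; exists (kap (n + m)%N).
apply: sub_gen_Cr_on UCr => y /row_ballP yk; apply: eU => i.
have {}yk := yk (divr_gt0 (ltr0n _ 2) n0) i.
have zc : `|z ord0 i - ((2 ^+ n)^-1 *: realv (kap n) : 'rV[R]_d) ord0 i| <= (2 ^+ n)^-1.
  have := zk n i; rewrite !mxE; set k := (kap n ord0 i)%:~R => /andP[h1 h2].
  rewrite -(ler_pM2l n0) divff ?gt_eqF// -{1}(gtr0_norm n0) -normrM mulrBr.
  rewrite mulVKf ?gt_eqF//.
  by rewrite ler_norml; apply/andP; split; lra.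
apply: le_lt_trans (ler_distD (((2 ^+ n)^-1 *: realv (kap n) : 'rV[R]_d) ord0 i) _ _) _.
by move: ne yk zc; lra.
Qed.

End limit_points_singular.

(** * The almost sure dimension *)

Section almost_sure_dimension.
Context {R : realType} {d : nat} {disp : measure_display}
  {Omega : measurableType disp} {P : probability Omega R}.

Lemma ae_forall_countable (I : countType) (Q : I -> Omega -> Prop) :
  (forall i, {ae P, forall w, Q i w}) -> {ae P, forall w, forall i, Q i w}.
Proof.
move=> Qi; apply: (@negligibleS _ _ _ _
  (\bigcup_n [set w | if @unpickle I n is Some i then ~ Q i w else False])).
  move=> w /= /existsNP[i nQ]; exists (pickle i) => //=.
  by rewrite pickleK.
apply: negligible_bigcup => n.
case: (unpickle n) => [i|]; first exact: Qi.
exact: negligible_set0.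
Qed.

Variables (Psi : 'I_(2 ^ d).-1 -> 'rV[R]_d -> R) (phi : 'rV[R]_d -> R) (r : nat)
  (kappa s p gamma : R).
Hypotheses (d1 : (1 <= d)%N) (p1 : 1 <= p) (kappa0 : 0 < kappa)
  (sr : s < r%:R) (gamma_le : gamma <= d%:R) (wav : is_wavelet_basis r phi Psi).
Variables (t : node d -> {RV P >-> R})
  (X : 'I_(2 ^ d).-1 * node d -> {RV P >-> R}).

Definition tree_density : R := 2 `^ (gamma - d%:R).

Local Notation beta := tree_density.
Local Notation T := (in_tree beta (fun v => t v)).
Local Notation S w := (besov_series Psi s p (fun i => X i) T w).

Lemma tree_density_gt0 : 0 < beta.
Proof. exact: powR_gt0. Qed.

Lemma tree_density_le1 : beta <= 1.
Proof. by rewrite -(powRr0 2); apply: ler_powR; rewrite ?ler1n ?subr_le0. Qed.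

Lemma mean_offspring : (2 ^ d)%:R * beta = 2 `^ gamma.
Proof.
rewrite natrX -powR_mulrn// -powRD ?pnatr_eq0 ?implybT//.
by rewrite addrC subrK.
Qed.

Hypotheses (ut : forall v, uniform01 (t v)) (it : mutually_independent t)
  (lX : same_exp_power_law kappa p X) (iX : mutually_independent X)
  (iXT : independent_of_tree X T).

(** There are countably many nodes. *)
Lemma ae_nodes_singular : {ae P, forall w, forall n k,
  (forall m, alive beta t n k m w) -> ~ gen_Cr_on r (node_ball n k) (S w)}.
Proof.
have i0 : 'I_d := Ordinal d1.
have l0 : 'I_(2 ^ d).-1.
  apply: (@Ordinal _ 0); rewrite -subn1 subn_gt0 -{1}(expn0 2).
  by rewrite ltn_exp2l.
have [M suppPsi] := wavelet_support wav; have rPsi := wavelet_Cr wav.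
have [y0 Py0] := wavelet_neq0 wav l0.
have [c c0 cX] := exp_power_law_density kappa0 lX.
have [H [rho [c1 [eta [H0 c10 etaP]]]]] := exists_wavelet_test i0 r
  (Cr_on_continuous (rPsi l0)) (suppPsi l0) Py0.
have node_sing (v : node d) : {ae P, forall w,
    (forall m, alive beta t v.1 v.2 m w) -> ~ gen_Cr_on r (node_ball v.1 v.2) (S w)}.
  apply: negligibleS (alive_not_Cr rPsi c0 cX iX iXT p1 sr H0 c10 etaP v.1 v.2).
  by move=> w /= /not_implyP[al /contrapT].
apply: filterS (ae_forall_countable node_sing) => w h n k.
exact: (h (n, k)).
Qed.

Hypothesis gamma0 : 0 < gamma.

Let low n : R := gamma - gamma / n.+2%:R.

Let low_gt0 n : 0 < low n.
Proof.
by rewrite subr_gt0 ltr_pdivrMr// ltr_pMr// ltr1n.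
Qed.

Let low_lt n : low n < gamma.
Proof. by rewrite ltrBlDr ltrDl divr_gt0. Qed.

(** For [b < gamma], thinning with probability [2 `^ (- b)] leaves the tree
    supercritical, with mean offspring [2 `^ (gamma - b)], and
    [hausdorff_measure_neq0] applies. For [a > gamma], the expected number of nodes
    at the level [J] is [2 `^ (gamma * J)], less than [2 `^ (a * J)]. *)
Lemma ae_hausdorff_dim : {ae P, forall w, infinite_tree beta t w ->
  singsupp r (S w) <> set0 /\ hausdorff_dim (singsupp r (S w)) = gamma%:E}.
Proof.
have [b0 b1] := (tree_density_gt0, tree_density_le1).
have [M suppPsi] := wavelet_support wav; have rPsi := wavelet_Cr wav.
have surv n : {ae P, forall w, infinite_tree beta t w ->
    (\bigcup_N surviving beta t (delayed (2 `^ (- low n)) N)) w}.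
  apply: (@negligibleS _ _ _ _
    (infinite_tree beta t `\` \bigcup_N surviving beta t (delayed (2 `^ (- low n)) N))).
    by move=> w /= /not_implyP[].
  apply: (infinite_surviving d1 b0 b1 ut it); first exact: powR_gt0.
    rewrite -[leRHS](powRr0 2); apply: ler_powR; first by rewrite ler1n.
    by rewrite oppr_le0 ltW.
  rewrite mulrA mean_offspring -powRD ?pnatr_eq0 ?implybT//.
  by apply: powR2_gt1; rewrite subr_gt0.
have small n : {ae P, forall w, forall (e : R) j0, 0 < e -> exists2 j, (j0 <= j)%N &
    (size (tree_level beta t w 0 0 j))%:R *
      2 `^ (- (j%:R * (gamma + n.+1%:R^-1))) < e}.
  apply: (small_levels b0 b1 ut it).
  rewrite mean_offspring -powRD ?pnatr_eq0 ?implybT//.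
  rewrite opprD addrA subrr sub0r powRN invf_lt1 ?powR_gt0//.
  exact: powR2_gt1.
move: (ae_forall_countable surv) (ae_forall_countable small) ae_nodes_singular.
apply: filterS3 => w survw smallw singw infw.
have limA kap (z : 'rV[R]_d) : kap 0%N = 0 -> (forall j, half_row (kap j.+1) = kap j) ->
    (forall j, open_indicator beta t w (j.+1, kap j.+1) = 1) ->
    (forall j, cube j (kap j) z) -> singsupp r (S w) z.
  exact: limit_point_singular singw.
have large a : 0 <= a -> a < gamma -> hausdorff_measure a (singsupp r (S w)) <> 0%E.
  move=> a0 ag; have [n an] : exists n, a <= low n.
    have ga : 0 < (gamma - a) / gamma by rewrite divr_gt0// subr_gt0.
    have [n _ /(_ n (leqnn _)) ne] := near_infty_natSinv_lt (PosNum ga).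
    exists n; rewrite /low lerBrDr addrC -lerBrDr.
    have : n.+2%:R^-1 <= (gamma - a) / gamma.
      apply: (le_trans _ (ltW ne)); rewrite lef_pV2 ?posrE//.
      by rewrite ler_nat.
    by rewrite ler_pdivlMr// mulrC.
  have [N _ uN] := survw n infw.
  exact: (hausdorff_measure_neq0 (open_indicator01 beta t w) limA a0 an (low_gt0 n) uN).
split=> [S0|]; first by apply: (large 0) => //; rewrite S0; exact: hausdorff_measure_set0.
apply: hausdorff_dim_eq => [|n|//]; first exact: ltW.
apply: (hausdorff_measure_cubes (L := tree_level beta t w 0 0)).
- by rewrite addr_gt0.
- by move=> j; exact: (singsupp_sub_cubes rPsi suppPsi j).
- exact: smallw.
Qed.

End almost_sure_dimension.

Theorem corollary6 (R : realType) (d : nat) (hd : (1 <= d)%N)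
    (p : R) (hp : 1 <= p) (kappa : R) (hkappa : 0 < kappa)
    (r : nat) (hr : (1 <= r)%N) (s : R) (hs : s < r%:R)
    (gamma : R) (hgamma : gamma <= d%:R)
    (phi : 'rV[R]_d -> R) (Psi : 'I_(2 ^ d).-1 -> 'rV[R]_d -> R)
    (hwav : is_wavelet_basis r phi Psi)
    (disp : measure_display) (Omega : measurableType disp)
    (P : probability Omega R)
    (t : node d -> {RV P >-> R}) (X : 'I_(2 ^ d).-1 * node d -> {RV P >-> R}) :
  let beta : R := 2 `^ (gamma - d%:R) in
  let T := in_tree beta (fun n => t n) in
  let f := besov_series Psi s p (fun i => X i) T in
  (forall n, uniform01 (t n)) -> mutually_independent t ->
  same_exp_power_law kappa p X -> mutually_independent X ->
  independent_of_tree X T ->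
  (gamma <= 0 -> {ae P, forall w, gen_Cr_on r setT (f w)}) /\
  (0 < gamma ->
    exists P_beta : R,
      [/\ unique (fun q : R => 0 <= q < 1 /\
                     q = ((1 - beta) + beta * q) ^+ (2 ^ d)) P_beta,
          has_prob P [set w | singsupp r (f w) = set0] P_beta
        & has_prob P [set w | hausdorff_dim (singsupp r (f w)) = gamma%:E]
                     (1 - P_beta)]).
Proof.
move=> beta T f ut it lX iX iXT.
have [b0 b1] := (tree_density_gt0 (d := d) gamma, tree_density_le1 hgamma).
have bE : tree_density (d := d) gamma = beta by [].
have M2 : (1 < 2 ^ d)%N by rewrite -{1}(expn0 2) ltn_exp2l.
have Mb : (2 ^ d)%:R * beta = 2 `^ gamma := mean_offspring gamma.
have [M suppPsi] := wavelet_support hwav; have rPsi := wavelet_Cr hwav.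
have minf : measurable (infinite_tree beta t) := measurable_infinite_tree beta t.
have finite w : ~ infinite_tree beta t w -> exists J0, ~ alive beta t 0 0 J0 w.
  by move=> ninf; apply: contrapT => /forallNP al; apply: ninf => n _; exact: contrapT.
split=> [gamma0|gamma0].
  have Pinf : P (infinite_tree beta t) = 0%:E.
    apply: (prob_infinite_tree b0 b1 ut it); apply: (iter_offspring_cvg0 M2 b0 b1).
    by rewrite bE Mb -[leRHS](powRr0 2); apply: ler_powR; rewrite ?ler1n.
  exists (infinite_tree beta t); split => // w /= nCr.
  apply: contrapT => /finite[J0 dead]; apply: nCr.
  exact: (gen_Cr_on_finite s p rPsi (fun i => X i) dead).
have [e [/andP[e0 e1] eF ecv]] : exists e : R, [/\ 0 < e <= 1, offspring (2 ^ d) beta e = e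
    & forall x, 0 < x <= 1 -> iter n (offspring (2 ^ d) beta) x @[n --> \oo] --> e].
  by apply: (iter_offspring_cvg M2 b0 b1); rewrite bE Mb powR2_gt1.
have Pinf : P (infinite_tree beta t) = e%:E.
  by apply: (prob_infinite_tree b0 b1 ut it); apply: ecv; rewrite ltr01 lexx.
have Pfin : P (~` infinite_tree beta t) = (1 - e)%:E.
  by rewrite probability_setC// [X in (_ - X)%E](_ : _ = e%:E).
(* the equation for an extinction probability [q], in terms of [1 - q] *)
have genE q : q = ((1 - beta) + beta * q) ^+ (2 ^ d) <->
    offspring (2 ^ d) beta (1 - q) = 1 - q.
  have -> : (1 - beta) + beta * q = 1 - beta * (1 - q) by ring.
  rewrite /offspring; split=> [<-//|h].
  by apply: oppr_inj; apply: (addrI 1); rewrite h.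
have fin_empty w : ~ infinite_tree beta t w -> singsupp r (f w) = set0.
  move=> /finite[J0 dead].
  exact: (singsupp_finite s p rPsi suppPsi (fun i => X i) dead).
have aedim := ae_hausdorff_dim hd hp hkappa hs hgamma hwav ut it lX iX iXT gamma0.
exists (1 - e); split.
- split=> [|q [/andP[q0 q1] /genE qF]].
    by split; [rewrite subr_ge0 e1 ltrBlDr ltrDl|apply/genE; rewrite subKr].
  rewrite -[RHS](subKr 1); congr (1 - _).
  apply: (offspring_fixpoint_unique M2 b0 b1) eF qF; first by rewrite e0.
  by rewrite subr_gt0 q1 lerBlDr lerDl.
- exists (~` infinite_tree beta t); split => //; first exact: measurableC.
  apply: negligibleS aedim => w /= [[S0 /contrapT infw] h|[ninf S0]].
    by have [] := h infw.
  by case: (S0 (fin_empty w ninf)).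
- exists (infinite_tree beta t); split => //; first by rewrite subKr.
  apply: negligibleS aedim => w /= [[dimw ninf] _|[infw dimw] h].
    move: dimw; rewrite (fin_empty w ninf) hausdorff_dim_set0 => -[g0].
    by rewrite -g0 ltxx in gamma0.
  by have [_] := h infw.
Qed.
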